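(* Let $f,g\in\mathcal{N}$, where $\mathcal{N}$ is the Nevanlinna class of the unit disc $\mathbb{D}$, and let $\rho\in(0,1)$. Suppose that $$|f^*(\zeta)|=|g^*(\zeta)|\quad\text{for almost every }\zeta\in\mathbb{T},\qquad\text{and}\qquad |f(z)|=|g(z)|\quad\text{for all } z\in\mathbb{C}\text{ with }|z|=\rho,$$ where $f^*,g^*$ denote the radial boundary values of $f,g$ on $\mathbb{T}$. Then there exists $c\in\mathbb{T}$ such that $g(z)=cf(z)$ for all $z\in\mathbb{D}$.
   Context: $\mathbb{D}=\{z\in\mathbb{C}:|z|<1\}$ is the open unit disc and $\mathbb{T}=\{z\in\mathbb{C}:|z|=1\}$ is the unit circle; ''almost every'' is with respect to arc length measure on $\mathbb{T}$. $H^\infty(\mathbb{D})$ is the space of bounded holomorphic functions on $\mathbb{D}$. The Nevanlinna class $\mathcal{N}$ is the set of holomorphic functions $\varphi$ on $\mathbb{D}$ that can be written as $\varphi=u/v$ with $u,v\in H^\infty(\mathbb{D})$. For $\varphi\in\mathcal{N}$, the radial limit $\varphi^*(\zeta)=\lim_{r\to1^-}\varphi(r\zeta)$ exists for almost every $\zeta\in\mathbb{T}$; values of $\varphi$ on $\mathbb{T}$ are understood in this sense. *)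

(* Defs.v *)
From HB Require Import structures.
From mathcomp Require Import all_boot all_order all_algebra.
From mathcomp Require Import all_classical all_reals all_analysis.
From mathcomp Require Import complex.

Set Implicit Arguments.
Unset Strict Implicit.
Unset Printing Implicit Defensive.

Import Order.TTheory GRing.Theory Num.Theory.
Import numFieldNormedType.Exports.

Local Open Scope classical_set_scope.
Local Open Scope ring_scope.
Local Open Scope complex_scope.

(* The norm of R[i] takes its values in R[i] itself, where the order is the
   partial one: x <= y iff y - x is a nonnegative real.  The topology is carried
   by R[i]^o, an alias of R[i]. *)

Definition unit_disc (R : realType) : set R[i] := [set z | `|z| < 1].

(* [derivable] with scalar field R[i] and direction 1 is complex
   differentiability.  Functions are total; their values outside the disc are
   never used. *)
Definition holomorphic_disc (R : realType) (f : R[i] -> R[i]) : Prop :=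
  forall z : R[i], unit_disc z -> derivable (f : R[i]^o -> R[i]^o) z 1.

Definition Hinfty (R : realType) (f : R[i] -> R[i]) : Prop :=
  holomorphic_disc f /\ [bounded (f z : R[i]^o) | z in @unit_disc R].

(* The quotient u / v is a quotient of holomorphic functions: v is not
   identically zero, but it may vanish at some points of the disc, where the
   value of f is determined by continuity. *)
Definition nevanlinna (R : realType) (f : R[i] -> R[i]) : Prop :=
  holomorphic_disc f /\
  exists u v : R[i] -> R[i],
    [/\ Hinfty u, Hinfty v,
        exists2 z, unit_disc z & v z != 0 &
        forall z, unit_disc z -> v z != 0 -> f z = u z / v z].

(* [lim] is an unspecified value where the limit does not exist; for a function
   in the Nevanlinna class this happens only on a set of arc length zero. *)
Definition radial_value (R : realType) (f : R[i] -> R[i]) (zeta : R[i]) : R[i] :=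
  lim ((f (r%:C * zeta) : R[i]^o) @[r --> (1 : R)^'-]).

(* Arc length on the unit circle is the image of the Lebesgue measure on
   [0, 2 pi[ under the bijection t |-> exp (i t). *)
Definition ae_circle (R : realType) (P : R[i] -> Prop) : Prop :=
  {ae @lebesgue_measure R,
    forall t : R, 0 <= t < 2 * pi -> P (cos t +i* sin t)}.

(* Main.v *)
From HB Require Import structures.
Require Import Defs.
From mathcomp Require Import all_boot all_order all_algebra.
From mathcomp Require Import all_classical all_reals all_analysis.
From mathcomp Require Import complex.
From mathcomp Require Import ring lra.

(** Write [f = u / v] with [u] and [v] bounded and holomorphic. If [f] or [g]
    vanishes identically, both do, by the maximum principle on [|z| <= rho];
    assume that neither does.

    Equal moduli on the circle [|z| = rho] force [g / f] to be rational. Divide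
    [f] and [g] by their finitely many zeros in [|z| <= rho] ([zero_factor]). A
    factor [z - a] with [|a| < rho] has, on the circle, the modulus of the
    reflected factor [(rho ^ 2 - a^* z) / rho], which has no zero inside, and
    zeros on the circle are common to [f] and [g]. What remains is a quotient of
    zero-free functions with modulus one on the circle, hence a constant. So
    [f * A = g * B] for nonzero polynomials [A] and [B] with [|A| = |B|] on
    [|z| = rho], and this holds on the whole disc by the identity theorem
    ([rational_quotient]).

    Also [|A| = |B|] on the unit circle ([proportional_of_radial]). Indeed [u]
    and [v] have radial limits almost everywhere ([fatou]), and at a point where
    these are nonzero the hypothesis on the radial values of [f] and [g] says
    that [|A| = |B|]. If [|A|] and [|B|] were different somewhere on the unit
    circle, they would be equal at finitely many points only; then [u * v] would
    have radial limit zero almost everywhere, hence vanish ([radial_zero]).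

    Finally, a rational function [A / B] that is unimodular on two concentric
    circles is preserved by the reflections in both, hence by their composition,
    the dilation [z -> rho ^ 2 z], and so it is constant ([two_circles]).

    Fatou's theorem is proved for a primitive [F] of the bounded function [u]. It
    is Lipschitz, so its boundary values are a Lipschitz function of the angle,
    which is differentiable almost everywhere ([lipschitz_derivable]); at a point
    of differentiability, the maximum principle with a suitable multiplier and
    Cauchy's estimate show that [F' = u] has a radial limit ([fatou_local]).
    Cauchy's formula is derived from Goursat's theorem on polar rectangles,
    integrals over a circle being integrals over [[0, 2 pi]]. *)

Set Implicit Arguments.
Unset Strict Implicit.
Unset Printing Implicit Defensive.

Import Order.TTheory GRing.Theory Num.Theory.
Import numFieldNormedType.Exports.

Local Open Scope classical_set_scope.
Local Open Scope ring_scope.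
Local Open Scope complex_scope.

Local Notation Re := complex.Re.
Local Notation Im := complex.Im.

(** * The modulus of a complex number *)

Section Modulus.
Variable R : realType.
Implicit Types (z w : R[i]) (x y : R).

(** The norm of [R[i]] takes its values in [R[i]], where the order is partial;
    estimates are made with the same quantity as an element of [R]. *)
Definition cm z : R := Num.sqrt (Re z ^+ 2 + Im z ^+ 2).

Lemma RCD x y : (x + y)%:C = x%:C + y%:C.
Proof. exact: (rmorphD (real_complex R)). Qed.
Lemma RCN x : (- x)%:C = - x%:C.
Proof. exact: (rmorphN (real_complex R)). Qed.
Lemma RCB x y : (x - y)%:C = x%:C - y%:C.
Proof. exact: (rmorphB (real_complex R)). Qed.
Lemma RCM x y : (x * y)%:C = x%:C * y%:C.
Proof. exact: (rmorphM (real_complex R)). Qed.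
Lemma RCX x n : (x ^+ n)%:C = x%:C ^+ n.
Proof. exact: (rmorphXn (real_complex R)). Qed.
Lemma RCV x : (x^-1)%:C = x%:C^-1.
Proof. exact: (fmorphV (real_complex R)). Qed.
Lemma RCeq0 x : (x%:C == 0) = (x == 0).
Proof. exact: (fmorph_eq0 (real_complex R)). Qed.

Lemma normE z : `|z| = (cm z)%:C.
Proof. exact: normc_def. Qed.

Lemma cm_ge0 z : 0 <= cm z.
Proof. exact: sqrtr_ge0. Qed.

Lemma cm0 : cm 0 = 0.
Proof. by apply: complexI; rewrite -normE normr0. Qed.

Lemma cm1 : cm 1 = 1.
Proof. by apply: complexI; rewrite -normE normr1. Qed.

Lemma cm_eq0 z : (cm z == 0) = (z == 0).
Proof. by rewrite -RCeq0 -normE normr_eq0. Qed.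

Lemma cm_gt0 z : (0 < cm z) = (z != 0).
Proof. by rewrite lt_def cm_ge0 andbT cm_eq0. Qed.

Lemma cmM z w : cm (z * w) = cm z * cm w.
Proof. by apply: complexI; rewrite RCM -!normE normrM. Qed.

Lemma cmX z n : cm (z ^+ n) = cm z ^+ n.
Proof. by elim: n => [|n IH]; rewrite ?cm1// !exprS cmM IH. Qed.

Lemma cmV z : cm z^-1 = (cm z)^-1.
Proof. by apply: complexI; rewrite RCV -!normE normfV. Qed.

Lemma cm_div z w : cm (z / w) = cm z / cm w.
Proof. by rewrite cmM cmV. Qed.

Lemma cmN z : cm (- z) = cm z.
Proof. by apply: complexI; rewrite -!normE normrN. Qed.

Lemma cmBC z w : cm (z - w) = cm (w - z).
Proof. by rewrite -cmN opprB. Qed.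

Lemma cmD z w : cm (z + w) <= cm z + cm w.
Proof. by rewrite -lecR RCD -!normE; exact: ler_normD. Qed.

Lemma cmB z w : cm (z - w) <= cm z + cm w.
Proof. by rewrite (le_trans (cmD _ _))// cmN. Qed.

Lemma cm_tri u z w : cm (z - w) <= cm (z - u) + cm (u - w).
Proof. by rewrite (_ : z - w = (z - u) + (u - w)) ?cmD//; ring. Qed.

Lemma cm_sub z w : cm z - cm w <= cm (z - w).
Proof. by rewrite lerBlDr -{1}(subrK w z) cmD. Qed.

Lemma cmR x : cm x%:C = `|x|.
Proof. by rewrite /cm /= expr0n addr0 sqrtr_sqr. Qed.

Lemma cm_sqr z : cm z ^+ 2 = Re z ^+ 2 + Im z ^+ 2.
Proof. by rewrite sqr_sqrtr// addr_ge0// sqr_ge0. Qed.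

Lemma cmJ z : cm z^* = cm z.
Proof. by case: z => a b; rewrite /cm /= sqrrN. Qed.

Lemma mulcJE z : z * z^* = (cm z ^+ 2)%:C.
Proof. by rewrite -sqr_normc normE RCX. Qed.

Lemma Re_le z : `|Re z| <= cm z.
Proof. by rewrite -lecR -normE normc_ge_Re. Qed.

Lemma Im_le z : `|Im z| <= cm z.
Proof.
rewrite -ler_sqr ?nnegrE ?cm_ge0// real_normK ?num_real// cm_sqr.
by rewrite lerDr sqr_ge0.
Qed.

Lemma cm_le z : cm z <= `|Re z| + `|Im z|.
Proof.
rewrite -ler_sqr ?nnegrE ?cm_ge0 ?addr_ge0// cm_sqr sqrrD.
by rewrite !real_normK ?num_real// lerD2r lerDl mulrn_wge0// mulr_ge0.
Qed.

Lemma cmi : cm ('i : R[i]) = 1.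
Proof. by rewrite /cm /= expr0n expr1n add0r sqrtr1. Qed.

(** A positive element of [R[i]] is real, so balls of real radius suffice. *)
Lemma cnbhsP (z : R[i]) (A : set R[i]) :
  nbhs (z : R[i]^o) A <-> exists2 d : R, 0 < d & forall w, cm (w - z) < d -> A w.
Proof.
split=> [/nbhs_ballP[e /= e0 H]|[d d0 H]].
  have eE : (Re e)%:C = e by apply: RRe_real; exact: gtr0_real.
  exists (Re e); first by rewrite -ltcR eE.
  move=> w wz; apply: H; rewrite -eE.
  by rewrite -ball_normE /= normE ltcR cmBC.
apply/nbhs_ballP; exists d%:C => /=; first by rewrite ltcR.
by move=> w; rewrite -ball_normE /= normE ltcR cmBC; exact: H.
Qed.

Lemma ccvgP (T : Type) (F : set_system T) {FF : Filter F} (f : T -> R[i]) (l : R[i]) :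
  ((f : T -> R[i]^o) @ F --> (l : R[i]^o)) <->
  (forall e : R, 0 < e -> \forall x \near F, cm (f x - l) < e).
Proof.
split=> [H e e0|H A /cnbhsP[d d0 dA]].
  have N : nbhs (l : R[i]^o) [set w | cm (w - l) < e] by apply/cnbhsP; exists e.
  exact: (H _ N).
by move: (H d d0); apply: filterS => x; exact: dA.
Qed.

Lemma ccontP (f : R[i] -> R[i]) z :
  {for z, continuous (f : R[i]^o -> R[i]^o)} <->
  forall e : R, 0 < e -> exists2 d : R, 0 < d &
    forall w, cm (w - z) < d -> cm (f w - f z) < e.
Proof.
split=> [/ccvgP H e e0|H].
  by have /cnbhsP := H e e0.
by apply/(ccvgP (F := nbhs (z : R[i]^o))) => e e0; apply/cnbhsP; exact: H.
Qed.

Lemma cvgReIm (T : Type) (F : set_system T) {FF : Filter F} (f : T -> R[i]) (l : R[i]) :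
  ((f : T -> R[i]^o) @ F --> (l : R[i]^o)) <->
  (Re (f x) @[x --> F] --> Re l) /\ (Im (f x) @[x --> F] --> Im l).
Proof.
split=> [/ccvgP H|[HR HI]].
  split; apply/cvgrPdist_lt => e e0; move: (H e e0); apply: filterS => x.
    by apply: le_lt_trans; rewrite distrC -raddfB; exact: Re_le.
  by apply: le_lt_trans; rewrite distrC -raddfB; exact: Im_le.
apply/ccvgP => e e0; have e20 : 0 < e / 2 by rewrite divr_gt0.
move/cvgrPdist_lt : HR => /(_ _ e20) HR; move/cvgrPdist_lt : HI => /(_ _ e20) HI.
near=> x; rewrite (le_lt_trans (cm_le _))// !raddfB /=.
rewrite (_ : e = e / 2 + e / 2); last by field.
by rewrite ltrD// distrC; near: x.
Unshelve. all: by end_near. Qed.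

End Modulus.

(** * Integrals over a segment *)

Section RealIntegral.
Variable R : realType.
Implicit Types (a b c x : R) (f g : R -> R).

Definition rI a b f : R := \int[@lebesgue_measure R]_(x in `[a, b]) f x.

(** Two-sided continuity at every point, including the end points: it passes
    through sums, products and compositions without subspace topologies. *)
Definition cont_itv (T : topologicalType) a b (f : R -> T) :=
  forall x, a <= x <= b -> {for x, continuous f}.

Lemma cont_itv_within (T : topologicalType) a b (f : R -> T) :
  cont_itv a b f -> {within `[a, b], continuous f}.
Proof.
move=> H; apply: continuous_in_subspaceT => x /set_mem/=.
by rewrite in_itv /= => /H.
Qed.

Lemma cont_itv_integrable a b f : cont_itv a b f ->
  (@lebesgue_measure R).-integrable `[a, b] (EFin \o f).
Proof.
move=> /cont_itv_within H; apply: continuous_compact_integrable => //.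
exact: segment_compact.
Qed.

Lemma rID a b f g : cont_itv a b f -> cont_itv a b g ->
  rI a b (fun x => f x + g x) = rI a b f + rI a b g.
Proof. by move=> /cont_itv_integrable cf /cont_itv_integrable cg; exact: RintegralD. Qed.

Lemma rIZ a b f k : cont_itv a b f -> rI a b (fun x => k * f x) = k * rI a b f.
Proof. by move=> /cont_itv_integrable cf; exact: RintegralZl. Qed.

Lemma eq_rI a b f g : (forall x, a <= x <= b -> f x = g x) -> rI a b f = rI a b g.
Proof.
move=> fg; apply: eq_Rintegral => x /set_mem /=.
by rewrite in_itv /=; exact: fg.
Qed.

Lemma rI_cst a b k : a <= b -> rI a b (fun=> k) = k * (b - a).
Proof.
move=> ab; rewrite /rI Rintegral_cst//= lebesgue_measure_itv /= lte_fin.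
by move: ab; rewrite le_eqVlt => /predU1P[->|->//]; rewrite ltxx subrr.
Qed.

Lemma le_rI a b f g : cont_itv a b f -> cont_itv a b g ->
  (forall x, a <= x <= b -> f x <= g x) -> rI a b f <= rI a b g.
Proof.
move=> /cont_itv_integrable cf /cont_itv_integrable cg fg; exact: le_Rintegral.
Qed.

Lemma cont_itv_cst (T : topologicalType) a b (k : T) : cont_itv a b (fun=> k).
Proof. by move=> x _; exact: cst_continuous. Qed.

Lemma rI_bound a b f M : a <= b -> cont_itv a b f ->
  (forall x, a <= x <= b -> `|f x| <= M) -> `|rI a b f| <= M * (b - a).
Proof.
move=> ab cf fM; rewrite ler_norml -mulNr -!rI_cst//.
apply/andP; split; apply: le_rI => //; try exact: cont_itv_cst;
  by move=> x /fM; rewrite ler_norml => /andP[].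
Qed.

Lemma rI_split a c b f : a <= c <= b -> cont_itv a b f ->
  rI a b f = rI a c f + rI c b f.
Proof.
move=> /andP[ac cb] cf; have /cont_itv_integrable i := cf.
have := @Rintegral_itvB R f (BLeft a) (BRight b) c i.
rewrite !bnd_simp => /(_ ac cb) /eqP; rewrite subr_eq => /eqP.
rewrite Rintegral_itv_obnd_cbnd; first by rewrite /rI => ->; rewrite addrC.
apply: integrableS i => //; apply: subset_itv; rewrite bnd_simp//.
Qed.

Lemma rI_FTC a b f F : a <= b -> cont_itv a b f ->
  (forall x, a <= x <= b -> is_derive x (1 : R) F (f x)) -> rI a b f = F b - F a.
Proof.
move=> ab cf dF; move: ab; rewrite le_eqVlt => /predU1P[<-|ab].
  by rewrite /rI set_itv1 Rintegral_set1 subrr.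
have cF x : a <= x <= b -> {for x, continuous F}.
  move=> /dF d; apply: differentiable_continuous.
  by apply/derivable1_diffP; exact: ex_derive.
rewrite /rI /Rintegral (@continuous_FTC2 _ f F a b) //.
- exact: cont_itv_within.
- split.
  + move=> x; rewrite in_itv /= => /andP[ax xb].
    by have := dF x; rewrite !ltW// => /(_ isT) d; exact: ex_derive.
  + by apply: cvg_at_right_filter; apply: cF; rewrite lexx ltW.
  + by apply: cvg_at_left_filter; apply: cF; rewrite lexx ltW.
- move=> x; rewrite in_itv /= => /andP[ax xb].
  by have := dF x; rewrite !ltW// => /(_ isT) d; rewrite derive1E derive_val.
Qed.

End RealIntegral.

Section ComplexIntegral.
Variable R : realType.
Implicit Types (a b c x : R) (f g : R -> R[i]).

Local Notation ccont_itv a b f := (@cont_itv R R[i]^o a b f).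

Definition cI a b f : R[i] :=
  rI a b (fun x => Re (f x)) +i* rI a b (fun x => Im (f x)).

Lemma con_Re a b f : ccont_itv a b f -> cont_itv a b (fun x => Re (f x)).
Proof. by move=> H x /H /cvgReIm[]. Qed.

Lemma con_Im a b f : ccont_itv a b f -> cont_itv a b (fun x => Im (f x)).
Proof. by move=> H x /H /cvgReIm[]. Qed.

Lemma cID a b f g : ccont_itv a b f -> ccont_itv a b g ->
  cI a b (fun x => f x + g x) = cI a b f + cI a b g.
Proof.
move=> cf cg; rewrite /cI.
have RE := rID (con_Re cf) (con_Re cg); have IE := rID (con_Im cf) (con_Im cg).
apply/eqP; rewrite eq_complex /= -RE -IE.
by apply/andP; split; apply/eqP; apply: eq_rI => x _; rewrite raddfD.
Qed.

Lemma cIZ a b f k : ccont_itv a b f -> cI a b (fun x => k * f x) = k * cI a b f.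
Proof.
move=> cf; rewrite /cI; apply/eqP; rewrite eq_complex /=.
case: k => p q /=.
have cR := con_Re cf; have cIm := con_Im cf.
have cz (h : R -> R) (l : R) : cont_itv a b h -> cont_itv a b (fun x => l * h x).
  by move=> ch x /ch; exact: cvgMr.
rewrite -mulNr -(rIZ p cR) -(rIZ (- q) cIm) -(rIZ p cIm) -(rIZ q cR).
rewrite -(rID (cz _ p cR) (cz _ (- q) cIm)) -(rID (cz _ p cIm) (cz _ q cR)).
apply/andP; split; apply/eqP; apply: eq_rI => x _; case: (f x) => u v //=.
by rewrite mulNr.
Qed.

Lemma cconN a b f : ccont_itv a b f -> ccont_itv a b (fun x => - f x).
Proof. by move=> cf x /cf; exact: cvgN. Qed.

Lemma cconD a b f g : ccont_itv a b f -> ccont_itv a b g -> ccont_itv a b (fun x => f x + g x).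
Proof. by move=> cf cg x h; exact: cvgD (cf x h) (cg x h). Qed.

Lemma cconM a b f g : ccont_itv a b f -> ccont_itv a b g -> ccont_itv a b (fun x => f x * g x).
Proof. by move=> cf cg x h; exact: cvgM (cf x h) (cg x h). Qed.

Lemma cconV a b f : ccont_itv a b f -> (forall x, a <= x <= b -> f x != 0) ->
  ccont_itv a b (fun x => (f x)^-1).
Proof. by move=> cf f0 x h; apply: cvgV (cf x h); exact: f0. Qed.

Lemma cIN a b f : ccont_itv a b f -> cI a b (fun x => - f x) = - cI a b f.
Proof.
move=> cf; rewrite -mulN1r -cIZ//; congr cI.
by apply/funext => x; rewrite mulN1r.
Qed.

Lemma cIB a b f g : ccont_itv a b f -> ccont_itv a b g ->
  cI a b (fun x => f x - g x) = cI a b f - cI a b g.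
Proof. by move=> cf cg; rewrite (cID cf (cconN cg)) (cIN cg). Qed.

Lemma eq_cI a b f g : (forall x, a <= x <= b -> f x = g x) -> cI a b f = cI a b g.
Proof.
by move=> fg; rewrite /cI; congr Complex; apply: eq_rI => x /fg ->.
Qed.

Lemma cI_cst a b k : a <= b -> cI a b (fun=> k) = k * (b - a)%:C.
Proof.
by move=> ab; rewrite /cI !rI_cst//; case: k => p q; simpc.
Qed.

Lemma cI_split a c b f : a <= c <= b -> ccont_itv a b f ->
  cI a b f = cI a c f + cI c b f.
Proof.
move=> acb cf; rewrite /cI (rI_split acb (con_Re cf)) (rI_split acb (con_Im cf)).
by [].
Qed.

(** The constant 2 comes from bounding the real and imaginary parts separately;
    where it matters, taking powers removes it ([max_circle]). *)
Lemma cI_bound a b f M : a <= b -> ccont_itv a b f ->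
  (forall x, a <= x <= b -> cm (f x) <= M) -> cm (cI a b f) <= 2 * M * (b - a).
Proof.
move=> ab cf fM; rewrite (le_trans (cm_le _))//= -mulrA mulr_natl mulr2n lerD//.
  apply: rI_bound => //; first exact: con_Re.
  by move=> x /fM; apply: le_trans; exact: Re_le.
apply: rI_bound => //; first exact: con_Im.
by move=> x /fM; apply: le_trans; exact: Im_le.
Qed.

Definition kderiv (g : R -> R[i]) x (l : R[i]) : Prop :=
  is_derive x (1 : R) (fun t => Re (g t)) (Re l) /\
  is_derive x (1 : R) (fun t => Im (g t)) (Im l).

Lemma cI_FTC a b f F : a <= b -> ccont_itv a b f ->
  (forall x, a <= x <= b -> kderiv F x (f x)) -> cI a b f = F b - F a.
Proof.
move=> ab cf dF; rewrite /cI.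
have RE := @rI_FTC _ _ _ _ (fun t => Re (F t)) ab (con_Re cf).
have IE := @rI_FTC _ _ _ _ (fun t => Im (F t)) ab (con_Im cf).
rewrite (RE (fun x h => (dF x h).1)) (IE (fun x h => (dF x h).2)).
by apply/eqP; rewrite eq_complex /= !raddfB !eqxx.
Qed.

End ComplexIntegral.
Notation ccont_itv a b f := (@cont_itv _ (complex _)^o a b f).

(** * Curves in the plane *)

Section Curves.
Variable R : realType.
Implicit Types (a b t x : R) (f g : R -> R[i]).

Lemma ReM (z w : R[i]) : Re (z * w) = Re z * Re w - Im z * Im w.
Proof. by case: z => ? ?; case: w. Qed.

Lemma ImM (z w : R[i]) : Im (z * w) = Re z * Im w + Im z * Re w.
Proof. by case: z => ? ?; case: w. Qed.

Lemma kderiv_cont f x l : kderiv f x l -> {for x, continuous (f : R -> R[i]^o)}.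
Proof.
move=> [dR dI]; apply/(cvgReIm (F := nbhs x)); split.
  by apply/differentiable_continuous/derivable1_diffP; exact: ex_derive.
by apply/differentiable_continuous/derivable1_diffP; exact: ex_derive.
Qed.

Lemma kderiv_eq f x l l' : kderiv f x l -> l = l' -> kderiv f x l'.
Proof. by move=> ? <-. Qed.

Lemma kderiv_cst (k : R[i]) x : kderiv (fun=> k) x 0.
Proof. by split; exact: is_derive_cst. Qed.

Lemma kderiv_RC x : kderiv (fun t => t%:C) x 1.
Proof. by split; [exact: is_derive_id|exact: is_derive_cst]. Qed.

Lemma kderivD f g x l m : kderiv f x l -> kderiv g x m ->
  kderiv (fun t => f t + g t) x (l + m).
Proof.
move=> [fR fI] [gR gI]; split; rewrite raddfD.
  rewrite (_ : (fun t => Re (f t + g t)) =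
    (fun t => Re (f t)) + (fun t => Re (g t))).
    exact: is_deriveD.
  by apply/funext => t; rewrite raddfD.
rewrite (_ : (fun t => Im (f t + g t)) =
  (fun t => Im (f t)) + (fun t => Im (g t))).
  exact: is_deriveD.
by apply/funext => t; rewrite raddfD.
Qed.

Lemma kderivM f g x l m : kderiv f x l -> kderiv g x m ->
  kderiv (fun t => f t * g t) x (l * g x + f x * m).
Proof.
move=> [fR fI] [gR gI]; split.
  rewrite (_ : (fun t => Re (f t * g t)) =
    (fun t => Re (f t)) * (fun t => Re (g t)) -
    (fun t => Im (f t)) * (fun t => Im (g t))).
    apply: (is_derive_eq (is_deriveB (is_deriveM fR gR) (is_deriveM fI gI))).
    rewrite /GRing.scale /=.
    by case: l fR fI => ? ?; case: m gR gI => ? ?; case: (f x) => ? ?;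
      case: (g x) => ? ? /= *; ring.
  by apply/funext => t; exact: ReM.
rewrite (_ : (fun t => Im (f t * g t)) =
  (fun t => Re (f t)) * (fun t => Im (g t)) +
  (fun t => Im (f t)) * (fun t => Re (g t))).
  apply: (is_derive_eq (is_deriveD (is_deriveM fR gI) (is_deriveM fI gR))).
  rewrite /GRing.scale /=.
  by case: l fR fI => ? ?; case: m gR gI => ? ?; case: (f x) => ? ?;
    case: (g x) => ? ? /= *; ring.
by apply/funext => t; exact: ImM.
Qed.

Lemma kderivZ (k : R[i]) f x l : kderiv f x l -> kderiv (fun t => k * f t) x (k * l).
Proof.
move=> df; apply: kderiv_eq (kderivM (kderiv_cst k x) df) _.
by rewrite mul0r add0r.
Qed.

Definition expi t : R[i] := cos t +i* sin t.

Lemma expiD a b : expi (a + b) = expi a * expi b.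
Proof.
by rewrite /expi cosD sinD; simpc; congr Complex; rewrite addrC [_ * cos b]mulrC.
Qed.

Lemma expi0 : expi 0 = 1.
Proof. by rewrite /expi cos0 sin0. Qed.

Lemma expi_2pi : expi (2 * pi) = 1.
Proof. by rewrite /expi mulr_natl cos2pi sin2pi. Qed.

Lemma cm_expi t : cm (expi t) = 1.
Proof. by rewrite /cm /= cos2Dsin2 sqrtr1. Qed.

Lemma expi_neq0 t : expi t != 0.
Proof. by rewrite -cm_eq0 cm_expi oner_eq0. Qed.

Lemma cm_pol (s t : R) : 0 <= s -> cm (s%:C * expi t) = s.
Proof. by move=> s0; rewrite cmM cm_expi mulr1 cmR ger0_norm. Qed.

Lemma kderiv_expi t : kderiv expi t ('i * expi t).
Proof.
split; rewrite /expi /=; simpc.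
  by apply: is_derive_eq (is_derive_cos t) _.
by apply: is_derive_eq (is_derive_sin t) _.
Qed.

Lemma expi_cont t : {for t, continuous (expi : R -> R[i]^o)}.
Proof. exact: kderiv_cont (kderiv_expi t). Qed.

Lemma RC_cont t : {for t, continuous ((fun x => x%:C) : R -> R[i]^o)}.
Proof. exact: kderiv_cont (kderiv_RC t). Qed.

Lemma expi_lip a b : cm (expi b - expi a) <= 2 * `|b - a|.
Proof.
wlog ab : a b / a <= b.
  move=> H; have [/H//|/ltW/H] := leP a b.
  by rewrite cmBC distrC.
have c : ccont_itv a b (fun t => 'i * expi t).
  by move=> t _; apply: cvgM; [exact: cvg_cst|exact: expi_cont].
rewrite -(cI_FTC ab c (fun t _ => kderiv_expi t)).
rewrite (le_trans (cI_bound (M := 1) ab c _))//.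
  by move=> x _; rewrite cmM cm_expi cmi mulr1.
by rewrite mulr1 ger0_norm// subr_ge0.
Qed.

End Curves.

(** * Complex differentiability and Goursat's theorem *)

Section Bisection.
Variable R : realType.

Lemma nested_intervals (x h : nat -> R) :
  (forall n, x n <= x n.+1) -> (forall n, x n.+1 + h n.+1 <= x n + h n) ->
  (forall n, 0 <= h n) -> exists s, forall n, x n <= s <= x n + h n.
Proof.
move=> xS xhS h0.
have xm m n : (m <= n)%N -> x m <= x n.
  by apply: (@homo_leq _ x <=%R) => //; exact: le_trans.
have xhm m n : (m <= n)%N -> x n + h n <= x m + h m.
  elim: n => [|n IH]; first by rewrite leqn0 => /eqP ->.
  rewrite leq_eqVlt => /predU1P[->//|/IH]; exact: le_trans (xhS n).
have ub m n : x m <= x n + h n.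
  have [mn|/ltnW nm] := leqP m n.
    by rewrite (le_trans (xm _ _ mn))// lerDl.
  by rewrite (le_trans _ (xhm _ _ nm))// lerDl.
have ne : range x !=set0 by exists (x 0%N), 0%N.
exists (sup (range x)) => n; apply/andP; split.
  apply: ub_le_sup; last by exists n.
  by exists (x 0%N + h 0%N) => _ [m _ <-]; exact: ub.
by apply: ge_sup => // _ [m _ <-]; exact: ub.
Qed.

Variables (J : R -> R -> R -> R -> R) (a b c d : R).
Hypotheses (ab : a <= b) (c_le_d : c <= d).
Hypothesis Jsub : forall x y h k : R, 0 <= h -> 0 <= k ->
  a <= x -> x + 2 * h <= b -> c <= y -> y + 2 * k <= d ->
  J x (x + 2 * h) y (y + 2 * k) <=
  J x (x + h) y (y + k) + J (x + h) (x + 2 * h) y (y + k) +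
  (J x (x + h) (y + k) (y + 2 * k) + J (x + h) (x + 2 * h) (y + k) (y + 2 * k)).

Let h n : R := (b - a) / 2 ^+ n.
Let k n : R := (d - c) / 2 ^+ n.

Let choose n (p : R * R) : R * R :=
  let x := p.1 in let y := p.2 in
  let h := h n.+1 in let k := k n.+1 in
  let j := J x (x + 2 * h) y (y + 2 * k) in
  if j <= 4 * J x (x + h) y (y + k) then (x, y) else
  if j <= 4 * J (x + h) (x + 2 * h) y (y + k) then (x + h, y) else
  if j <= 4 * J x (x + h) (y + k) (y + 2 * k) then (x, y + k) else
  (x + h, y + k).

Let p := fix p n := if n is m.+1 then choose m (p m) else (a, c).

Let h_ge0 n : 0 <= h n.
Proof. by rewrite divr_ge0 ?subr_ge0// exprn_ge0. Qed.
Let k_ge0 n : 0 <= k n.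
Proof. by rewrite divr_ge0 ?subr_ge0// exprn_ge0. Qed.
Let hS n : h n = 2 * h n.+1.
Proof. by rewrite /h exprS; field. Qed.
Let kS n : k n = 2 * k n.+1.
Proof. by rewrite /k exprS; field. Qed.

Let pS n : ((p n.+1).1 = (p n).1 \/ (p n.+1).1 = (p n).1 + h n.+1) /\
  ((p n.+1).2 = (p n).2 \/ (p n.+1).2 = (p n).2 + k n.+1).
Proof.
rewrite /= /choose.
by do 3 (case: ifP => _ /=; first by split; auto); split; right.
Qed.

Let p_in n : [/\ a <= (p n).1, (p n).1 + h n <= b, c <= (p n).2 & (p n).2 + k n <= d].
Proof.
elim: n => [|n [ax xb cy yd]].
  by rewrite /= /h /k !expr0 !divr1; split=> //; lra.
have := h_ge0 n.+1; have := k_ge0 n.+1.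
move: ax xb cy yd; rewrite (hS n) (kS n).
by have [[->|->] [->|->]] := pS n => *; split; lra.
Qed.

Let Jp n : J (p n).1 ((p n).1 + h n) (p n).2 ((p n).2 + k n) <=
  4 * J (p n.+1).1 ((p n.+1).1 + h n.+1) (p n.+1).2 ((p n.+1).2 + k n.+1).
Proof.
have [ax xb cy yd] := p_in n; move: xb yd.
rewrite (hS n) (kS n) => xb yd.
have := Jsub (h_ge0 n.+1) (k_ge0 n.+1) ax xb cy yd.
rewrite /= /choose /=; case: (p n) {ax xb cy yd} => x y /=.
have E1 : x + h n.+1 + h n.+1 = x + 2 * h n.+1 by ring.
have E2 : y + k n.+1 + k n.+1 = y + 2 * k n.+1 by ring.
move=> sub; case: ifP => /= [//|/negbT l1].
case: ifP => /= [|/negbT l2]; first by rewrite E1.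
case: ifP => /= [|/negbT l3]; first by rewrite E2.
rewrite E1 E2; move: l1 l2 l3; rewrite -!ltNge => *; lra.
Qed.

(** A quantity that is subadditive under cutting a rectangle into four
    quarters cannot be small on all small rectangles: some point lies in nested
    rectangles each of which carries its share of the whole. *)
Lemma bisection : exists s t : R, forall n, exists x y : R,
  [/\ a <= x /\ x + (b - a) / 2 ^+ n <= b,
      c <= y /\ y + (d - c) / 2 ^+ n <= d,
      x <= s <= x + (b - a) / 2 ^+ n, y <= t <= y + (d - c) / 2 ^+ n &
      J a b c d <= 4 ^+ n *
        J x (x + (b - a) / 2 ^+ n) y (y + (d - c) / 2 ^+ n)].
Proof.
have [s Hs] : exists s, forall n, (p n).1 <= s <= (p n).1 + h n.
  apply: nested_intervals => // n.
    by have [[->|->] _] := pS n; rewrite ?lerDl.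
  have := h_ge0 n.+1; rewrite (hS n).
  by have [[->|->] _] := pS n => ?; lra.
have [t Ht] : exists s, forall n, (p n).2 <= s <= (p n).2 + k n.
  apply: nested_intervals => // n.
    by have [_ [->|->]] := pS n; rewrite ?lerDl.
  have := k_ge0 n.+1; rewrite (kS n).
  by have [_ [->|->]] := pS n => ?; lra.
exists s, t => n; exists (p n).1, (p n).2; split => //.
- by have [] := p_in n.
- by have [] := p_in n.
- elim: n => [|n IH].
    by rewrite expr0 mul1r !divr1 /= !subrKC.
  apply: le_trans IH _; rewrite exprS [_ * 4 ^+ n]mulrC -mulrA ler_pM2l ?exprn_gt0//.
Qed.

End Bisection.

Section Derivative.
Variable R : realType.
Implicit Types (f g : R[i] -> R[i]) (z w l : R[i]).

(** A first-order expansion with a real tolerance, free of division by [w - z]. *)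
Definition cder f z l := forall e : R, 0 < e -> exists2 d : R, 0 < d &
  forall w, cm (w - z) < d -> cm (f w - f z - l * (w - z)) <= e * cm (w - z).

Definition cdiff f z := exists l, cder f z l.

Lemma cdiffP f z : derivable (f : R[i]^o -> R[i]^o) z 1 <-> cdiff f z.
Proof.
split=> [/cvg_ex[l] /(ccvgP (F := (0 : R[i]^o)^')) H|[l H]].
  exists l => e e0; have /cnbhsP[d d0 dH] := H e e0.
  exists d => // w wz; have [->|wNz] := eqVneq w z.
    by rewrite !subrr mulr0 subrr cm0 mulr0.
  have wz0 : w - z != 0 by rewrite subr_eq0.
  have := dH (w - z); rewrite subr0 => /(_ wz wz0) /ltW.
  have -> : f w - f z - l * (w - z) =
    ((w - z)^-1 *: (f ((w - z) *: 1 + z) - f z) - l) * (w - z).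
    by rewrite {2}/GRing.scale /= mulr1 subrK /GRing.scale /=; field.
  by rewrite cmM => /ler_pM; apply => //; exact: cm_ge0.
apply/cvg_ex; exists l; apply/(ccvgP (F := (0 : R[i]^o)^')) => e e0.
have e20 : 0 < e / 2 by rewrite divr_gt0.
have [d d0 dH] := H _ e20; apply/cnbhsP; exists d => // h.
rewrite subr0 => hd h0; have := dH (h + z).
rewrite addrK => /(_ hd) E.
have -> : h^-1 *: (f (h *: 1 + z) - f z) - l = (f (h + z) - f z - l * h) / h.
  by rewrite {2}/GRing.scale /= mulr1 /GRing.scale /=; field.
rewrite cm_div ltr_pdivrMr ?cm_gt0// (le_lt_trans E)// ltr_pM2r ?cm_gt0//.
by rewrite ltr_pdivrMr// ltr_pMr// ltr1n.
Qed.

Lemma cdiff_cont f z : cdiff f z -> {for z, continuous (f : R[i]^o -> R[i]^o)}.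
Proof. by move=> /cdiffP/derivable1_diffP; exact: differentiable_continuous. Qed.

Lemma cder_unique f z l m : cder f z l -> cder f z m -> l = m.
Proof.
move=> fl fm; apply/eqP; rewrite -subr_eq0 -cm_eq0; apply/eqP/le_anti.
rewrite cm_ge0 andbT; apply/ler_addgt0Pr => e e0; rewrite add0r.
have e20 : 0 < e / 2 by rewrite divr_gt0.
have [d d0 dH] := fl _ e20; have [d' d'0 d'H] := fm _ e20.
pose r := Num.min d d' / 2.
have m0 : 0 < Num.min d d' by rewrite lt_min d0.
have r0 : 0 < r by rewrite divr_gt0.
have rm : r < Num.min d d' by rewrite /r; lra.
have [rd rd'] : r < d /\ r < d' by move: rm; rewrite lt_min => /andP.
have C : cm (z + r%:C - z) = r by rewrite addrAC subrr add0r cmR gtr0_norm.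
have := dH (z + r%:C); have := d'H (z + r%:C); rewrite C => /(_ rd') A /(_ rd) B.
rewrite -(ler_pM2r r0) -{1}C -cmM.
have -> : (l - m) * (z + r%:C - z) =
  (f (z + r%:C) - f z - m * (z + r%:C - z)) - (f (z + r%:C) - f z - l * (z + r%:C - z)).
  by ring.
rewrite (le_trans (cmB _ _))// (le_trans (lerD A B))//.
by rewrite -mulrDl -splitr.
Qed.

Lemma cdiff_near f g z d : 0 < d -> (forall w, cm (w - z) < d -> f w = g w) ->
  cdiff f z -> cdiff g z.
Proof.
move=> d0 fg [l H]; exists l => e /H[d' d'0 d'H].
exists (Num.min d d'); first by rewrite lt_min d0.
move=> w; rewrite lt_min => /andP[wd wd']; rewrite -!fg ?subrr ?cm0//.
exact: d'H.
Qed.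

Lemma cdiff_cst k z : cdiff (fun=> k) z.
Proof. by apply/cdiffP; exact: derivable_cst. Qed.

Lemma cdiff_id z : cdiff id z.
Proof. by apply/cdiffP; exact: derivable_id. Qed.

Lemma cdiffD f g z : cdiff f z -> cdiff g z -> cdiff (fun w => f w + g w) z.
Proof. by move=> /cdiffP df /cdiffP dg; apply/cdiffP; exact: (derivableD df dg). Qed.

Lemma cdiffB f g z : cdiff f z -> cdiff g z -> cdiff (fun w => f w - g w) z.
Proof. by move=> /cdiffP df /cdiffP dg; apply/cdiffP; exact: (derivableB df dg). Qed.

Lemma cdiffM f g z : cdiff f z -> cdiff g z -> cdiff (fun w => f w * g w) z.
Proof. by move=> /cdiffP df /cdiffP dg; apply/cdiffP; exact: (derivableM df dg). Qed.

Lemma cdiffV f z : f z != 0 -> cdiff f z -> cdiff (fun w => (f w)^-1) z.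
Proof. by move=> f0 /cdiffP df; apply/cdiffP; exact: (derivableV f0 df). Qed.

Lemma cdiffX f z n : cdiff f z -> cdiff (fun w => f w ^+ n) z.
Proof.
move=> fz; elim: n => [|n IH]; first exact: cdiff_cst.
by rewrite (_ : (fun _ => _) = fun w => f w * f w ^+ n);
  [exact: cdiffM|apply/funext => w; rewrite exprS].
Qed.

Lemma cdiff_affine f a b z : cdiff f (a * z + b) -> cdiff (fun w => f (a * w + b)) z.
Proof.
move=> [l H]; exists (l * a) => e e0.
have [a0|a0] := eqVneq a 0.
  by exists 1 => // w _; rewrite a0 !mul0r subrr mulr0 mul0r subrr cm0 mulr_ge0 ?cm_ge0// ltW.
have ca : 0 < cm a by rewrite cm_gt0.
have [d d0 dH] := H _ (divr_gt0 e0 ca).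
exists (d / cm a); first exact: divr_gt0.
move=> w; rewrite ltr_pdivlMr// => wd.
have E : a * w + b - (a * z + b) = (w - z) * a by ring.
have := dH (a * w + b); rewrite E cmM => /(_ wd).
rewrite (_ : l * a * _ = l * ((w - z) * a)); last by ring.
by rewrite (_ : e / cm a * _ = e * cm (w - z)); last by field; rewrite gt_eqF.
Qed.

End Derivative.

Section Goursat.
Variable R : realType.
Implicit Types (q : R[i] -> R[i]) (s t a b : R).

Local Notation "{ 'cont' q 'at' z }" := {for (z : R[i]^o), continuous (q : R[i]^o -> R[i]^o)}
  (at level 0, q at level 99, z at level 99).

Definition arc_int q s a b : R[i] :=
  cI a b (fun t => q (s%:C * expi t) * ('i * (s%:C * expi t))).
Definition rad_int q t a b : R[i] := cI a b (fun s => q (s%:C * expi t) * expi t).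

(** Integral of [q] along the boundary of the polar rectangle
    [s1 <= |z| <= s2], [t1 <= arg z <= t2]. *)
Definition bdry_int q s1 s2 t1 t2 : R[i] :=
  rad_int q t1 s1 s2 + arc_int q s2 t1 t2 - rad_int q t2 s1 s2 - arc_int q s1 t1 t2.

Definition cont_polar q s1 s2 t1 t2 :=
  forall s t, s1 <= s <= s2 -> t1 <= t <= t2 -> {cont q at s%:C * expi t}.

Lemma cont_comp (g : R -> R[i]) q x : {for x, continuous (g : R -> R[i]^o)} ->
  {cont q at g x} -> {for x, continuous ((fun y => q (g y)) : R -> R[i]^o)}.
Proof. by move=> cg cq; exact: (@continuous_comp R R[i]^o R[i]^o g q x cg cq). Qed.

Lemma polt_cont s t : {for t, continuous ((fun t => s%:C * expi t) : R -> R[i]^o)}.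
Proof. by apply: cvgM; [exact: cvg_cst|exact: expi_cont]. Qed.

Lemma pols_cont s t : {for s, continuous ((fun s => s%:C * expi t) : R -> R[i]^o)}.
Proof. by apply: cvgM; [exact: RC_cont|exact: cvg_cst]. Qed.

Lemma arc_con q s a b : (forall t, a <= t <= b -> {cont q at s%:C * expi t}) ->
  ccont_itv a b (fun t => q (s%:C * expi t) * ('i * (s%:C * expi t))).
Proof.
move=> cq; apply: cconM => [t tab|].
  by apply: cont_comp (cq _ tab); exact: polt_cont.
by apply: cconM => [|t _]; [exact: cont_itv_cst|exact: polt_cont].
Qed.

Lemma rad_con q t a b : (forall s, a <= s <= b -> {cont q at s%:C * expi t}) ->
  ccont_itv a b (fun s => q (s%:C * expi t) * expi t).
Proof.
move=> cq; apply: cconM => [s sab|]; last exact: cont_itv_cst.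
by apply: cont_comp (cq _ sab); exact: pols_cont.
Qed.

Lemma cont_polar_sides q s1 s2 t1 t2 : s1 <= s2 -> t1 <= t2 -> cont_polar q s1 s2 t1 t2 ->
  [/\ ccont_itv s1 s2 (fun s => q (s%:C * expi t1) * expi t1),
      ccont_itv s1 s2 (fun s => q (s%:C * expi t2) * expi t2),
      ccont_itv t1 t2 (fun t => q (s1%:C * expi t) * ('i * (s1%:C * expi t))) &
      ccont_itv t1 t2 (fun t => q (s2%:C * expi t) * ('i * (s2%:C * expi t)))].
Proof.
move=> s12 t12 cq; split.
- by apply: rad_con => s h; apply: cq; rewrite // lexx.
- by apply: rad_con => s h; apply: cq; rewrite // lexx andbT.
- by apply: arc_con => s h; apply: cq; rewrite // lexx.
- by apply: arc_con => s h; apply: cq; rewrite // lexx andbT.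
Qed.

Lemma bdry_intB p q s1 s2 t1 t2 : s1 <= s2 -> t1 <= t2 ->
  cont_polar p s1 s2 t1 t2 -> cont_polar q s1 s2 t1 t2 ->
  bdry_int (fun z => p z - q z) s1 s2 t1 t2 = bdry_int p s1 s2 t1 t2 - bdry_int q s1 s2 t1 t2.
Proof.
move=> s12 t12 /cont_polar_sides => /(_ s12 t12)[p1 p2 p3 p4].
move=> /cont_polar_sides => /(_ s12 t12)[q1 q2 q3 q4].
have E (h k m : R -> R[i]) a b : ccont_itv a b (fun x => h x * m x) ->
  ccont_itv a b (fun x => k x * m x) -> cI a b (fun x => (h x - k x) * m x) =
  cI a b (fun x => h x * m x) - cI a b (fun x => k x * m x).
  by move=> ch ck; rewrite -(cIB ch ck); congr cI; apply/funext => x; rewrite mulrBl.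
rewrite /bdry_int /rad_int /arc_int (E _ _ _ _ _ p1 q1) (E _ _ _ _ _ p2 q2).
rewrite (E _ _ _ _ _ p3 q3) (E _ _ _ _ _ p4 q4).
have ringE (x1 x2 x3 x4 y1 y2 y3 y4 : R[i]) : x1 - y1 + (x2 - y2) - (x3 - y3) -
  (x4 - y4) = x1 + x2 - x3 - x4 - (y1 + y2 - y3 - y4) by ring.
exact: ringE.
Qed.

(** Affine functions have polynomial primitives. *)
Lemma bdry_int_affine (k l z0 : R[i]) s1 s2 t1 t2 : s1 <= s2 -> t1 <= t2 ->
  bdry_int (fun z => k + l * (z - z0)) s1 s2 t1 t2 = 0.
Proof.
move=> s12 t12; pose G (z : R[i]) := k * z + l * (z * z / 2 - z0 * z).
have dG (g : R -> R[i]) x m : kderiv g x m ->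
    kderiv (fun y => G (g y)) x ((k + l * (g x - z0)) * m).
  move=> dg; have d2 := kderivM dg dg.
  have := kderivD (kderivZ k dg) (kderivZ l (kderivD (kderivZ 2^-1 d2) (kderivZ (- z0) dg))).
  rewrite (_ : (fun t => _) = (fun y => G (g y))); last first.
    by apply/funext => y; rewrite /G; field.
  by move=> /kderiv_eq; apply; field.
have c0 (z : R[i]) : {cont (fun z => k + l * (z - z0)) at z}.
  apply: cdiff_cont; apply: cdiffD; first exact: cdiff_cst.
  by apply: cdiffM; [exact: cdiff_cst|apply: cdiffB; [exact: cdiff_id|exact: cdiff_cst]].
have A s : arc_int (fun z => k + l * (z - z0)) s t1 t2 =
    G (s%:C * expi t2) - G (s%:C * expi t1).
  rewrite /arc_int (cI_FTC (F := fun t => G (s%:C * expi t)) t12)//.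
    by apply: (@arc_con (fun z => k + l * (z - z0))) => *; exact: c0.
  move=> x _; apply: kderiv_eq (dG _ _ _ (kderivZ _ (kderiv_expi x))) _.
  by ring.
have B t : rad_int (fun z => k + l * (z - z0)) t s1 s2 =
    G (s2%:C * expi t) - G (s1%:C * expi t).
  rewrite /rad_int (cI_FTC (F := fun s => G (s%:C * expi t)) s12)//.
    by apply: (@rad_con (fun z => k + l * (z - z0))) => *; exact: c0.
  move=> x _; apply: kderiv_eq (dG _ _ _ (kderivM (kderiv_RC x) (kderiv_cst (expi t) x))) _.
  by rewrite mulr0 addr0 mul1r.
by rewrite /bdry_int !A !B; ring.
Qed.

Lemma bdry_int_split q s1 s s2 t1 t t2 : s1 <= s <= s2 -> t1 <= t <= t2 ->
  cont_polar q s1 s2 t1 t2 ->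
  bdry_int q s1 s2 t1 t2 = bdry_int q s1 s t1 t + bdry_int q s s2 t1 t +
                     (bdry_int q s1 s t t2 + bdry_int q s s2 t t2).
Proof.
move=> sh th cq; have [/andP[s1s ss2] /andP[t1t tt2]] := (sh, th).
have s12 := le_trans s1s ss2; have t12 := le_trans t1t tt2.
have [p1 p2 p3 p4] := cont_polar_sides s12 t12 cq.
rewrite /bdry_int /rad_int /arc_int.
rewrite (cI_split sh p1) (cI_split sh p2) (cI_split th p3) (cI_split th p4).
have ringE (a1 a2 b1 b2 c1 c2 d1 d2 e1 e2 f1 f2 : R[i]) :
  a1 + a2 + (b1 + b2) - (c1 + c2) - (d1 + d2) =
  a1 + e1 - f1 - d1 + (a2 + b1 - f2 - e1) + (f1 + e2 - c1 - d2 + (f2 + b2 - c2 - e2))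
  by ring.
exact: ringE.
Qed.

Lemma bdry_int_bound q s1 s2 t1 t2 M : 0 <= s1 -> s1 <= s2 -> t1 <= t2 ->
  cont_polar q s1 s2 t1 t2 ->
  (forall s t, s1 <= s <= s2 -> t1 <= t <= t2 -> cm (q (s%:C * expi t)) <= M) ->
  cm (bdry_int q s1 s2 t1 t2) <= 4 * M * ((s2 - s1) + s2 * (t2 - t1)).
Proof.
move=> s10 s12 t12 cq qM; have [p1 p2 p3 p4] := cont_polar_sides s12 t12 cq.
have s20 := le_trans s10 s12.
have M0 : 0 <= M by apply: le_trans (qM s1 t1 _ _); rewrite ?cm_ge0 ?lexx.
have r t : t1 <= t <= t2 -> ccont_itv s1 s2 (fun s => q (s%:C * expi t) * expi t) ->
    cm (rad_int q t s1 s2) <= 2 * M * (s2 - s1).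
  move=> th c; apply: cI_bound => // s sh.
  by rewrite cmM cm_expi mulr1; exact: qM.
have a s : s1 <= s <= s2 ->
    ccont_itv t1 t2 (fun t => q (s%:C * expi t) * ('i * (s%:C * expi t))) ->
    cm (arc_int q s t1 t2) <= 2 * (M * s2) * (t2 - t1).
  move=> /andP[s1s ss2] c; apply: cI_bound => // t th.
  rewrite cmM cmM cmi mul1r cm_pol ?(le_trans s10)//.
  apply: ler_pM => //; rewrite ?cm_ge0 ?(le_trans s10)//.
  by apply: qM => //; rewrite s1s.
have := r t1; have := r t2; have := a s1; have := a s2.
rewrite !lexx !s12 !t12 => /(_ isT p4) a2 /(_ isT p3) a1 /(_ isT p2) r2 /(_ isT p1) r1.
rewrite /bdry_int (le_trans (cmB _ _))// (le_trans (lerD (cmB _ _) (lexx _)))//.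
rewrite (le_trans (lerD (lerD (cmD _ _) (lexx _)) (lexx _)))//.
rewrite (le_trans (lerD (lerD (lerD r1 a2) r2) a1))//.
by rewrite le_eqVlt; apply/orP; left; apply/eqP; ring.
Qed.

(** Cutting into quarters, a nonzero boundary integral would persist, up to the
    factor [4 ^ n], on rectangles shrinking to a point; but near a point of
    differentiability [q] is affine up to a small error, affine functions
    contribute nothing, and the error contributes [o(4 ^- n)]. *)
Lemma goursat q s1 s2 t1 t2 : 0 <= s1 -> s1 <= s2 -> t1 <= t2 ->
  (forall s t, s1 <= s <= s2 -> t1 <= t <= t2 -> cdiff q (s%:C * expi t)) ->
  bdry_int q s1 s2 t1 t2 = 0.
Proof.
move=> s10 s12 t12 dq.
have cq s s' t t' : s1 <= s -> s' <= s2 -> t1 <= t -> t' <= t2 -> cont_polar q s s' t t'.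
  move=> h1 h2 h3 h4 x y /andP[xh hx] /andP[yh hy]; apply/cdiff_cont/dq.
    by rewrite (le_trans h1 xh) (le_trans hx h2).
  by rewrite (le_trans h3 yh) (le_trans hy h4).
pose J a b c d := cm (bdry_int q a b c d).
have [] := @bisection R J s1 s2 t1 t2 s12 t12.
  move=> x y h k h0 k0 xs xs2 yt yt2; rewrite /J.
  rewrite (@bdry_int_split q x (x + h) (x + 2 * h) y (y + k) (y + 2 * k)).
  - rewrite (le_trans (cmD _ _))// lerD// cmD//.
  - by apply/andP; split; lra.
  - by apply/andP; split; lra.
  - exact: cq.
move=> s [t H].
have s20 := le_trans s10 s12.
have [x0 [y0 [[x01 x02] [y01 y02] sx0 ty0 _]]] := H 0%N.
rewrite !divr1 in x02 y02 sx0 ty0.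
have sh : s1 <= s <= s2.
  by case/andP: sx0 => ? ?; rewrite (le_trans x01)//= (le_trans _ x02).
have th : t1 <= t <= t2.
  by case/andP: ty0 => ? ?; rewrite (le_trans y01)//= (le_trans _ y02).
have [l dl] := dq s t sh th.
set z0 := s%:C * expi t in dl.
pose L := (s2 - s1) + 2 * s2 * (t2 - t1).
pose P := 4 * L * ((s2 - s1) + s2 * (t2 - t1)).
have ds0 : 0 <= s2 - s1 by rewrite subr_ge0.
have dt0 : 0 <= s2 * (t2 - t1) by rewrite mulr_ge0// subr_ge0.
have L0 : 0 <= L by rewrite /L; lra.
suff E e : 0 < e -> J s1 s2 t1 t2 <= e * (P + 1).
  have P0 : 0 < P + 1 by rewrite ltr_wpDl// !mulr_ge0// addr_ge0.
  apply/eqP; rewrite -cm_eq0; apply/eqP/le_anti; rewrite cm_ge0 andbT.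
  apply/ler_addgt0Pr => e e0; rewrite add0r.
  by rewrite (le_trans (E _ (divr_gt0 e0 P0)))// divfK// gt_eqF.
move=> e0; have [d d0 dH] := dl e e0.
(* [L / 2 ^+ n] bounds the distance to [z0] in the rectangle of generation [n]. *)
have [n Ln] : exists n, L / 2 ^+ n < d.
  have [n Ld] : exists n, L / d < n%:R.
    by exists (Num.bound (L / d)); rewrite archi_boundP// divr_ge0// ltW.
  exists n; rewrite ltr_pdivrMr ?exprn_gt0//.
  move: Ld; rewrite ltr_pdivrMr// => /lt_le_trans; apply.
  rewrite mulrC ler_pM2l// -natrX ler_nat; exact/ltnW/ltn_expl.
have [x [y [[xs xs2] [yt yt2] sx ty]]] := H n.
set h := (s2 - s1) / 2 ^+ n in xs2 sx *; set k := (t2 - t1) / 2 ^+ n in yt2 ty *.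
have h0 : 0 <= h by rewrite divr_ge0// exprn_ge0.
have k0 : 0 <= k by rewrite divr_ge0 ?subr_ge0// exprn_ge0.
have near a b : x <= a <= x + h -> y <= b <= y + k ->
    cm (a%:C * expi b - z0) <= L / 2 ^+ n.
  move=> /andP[xa ax] /andP[yb by_]; rewrite (le_trans (cm_tri (a%:C * expi t) _ _))//.
  rewrite -mulrBr -mulrBl !cmM cm_expi mulr1 -RCB !cmR.
  have -> : L / 2 ^+ n = s2 * (2 * k) + h by rewrite /L /h /k; field; rewrite expf_neq0.
  move: sx ty => /andP[xs_ sx] /andP[yt_ ty].
  apply: lerD; last by rewrite ler_norml; apply/andP; split; lra.
  apply: ler_pM; rewrite ?normr_ge0 ?cm_ge0//.
    by rewrite ger0_norm; lra.
  rewrite (le_trans (expi_lip _ _))// ler_pM2l// ler_norml; apply/andP; split; lra.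
move=> Jn; apply: le_trans Jn _.
have c1 := cq x (x + h) y (y + k) xs xs2 yt yt2.
pose A z := q z0 + l * (z - z0).
have dA z : cdiff A z.
  apply: cdiffD; first exact: cdiff_cst.
  by apply: cdiffM; [exact: cdiff_cst|apply: cdiffB; [exact: cdiff_id|exact: cdiff_cst]].
have cA : cont_polar A x (x + h) y (y + k) by move=> ? ? _ _; exact/cdiff_cont/dA.
have xh : x <= x + h by rewrite lerDl.
have yk : y <= y + k by rewrite lerDl.
have -> : J x (x + h) y (y + k) = cm (bdry_int (fun z => q z - A z) x (x + h) y (y + k)).
  by rewrite bdry_intB// bdry_int_affine// subr0.
have cqA : cont_polar (fun z => q z - A z) x (x + h) y (y + k).
  by move=> a b ha hb; apply: (cvgB (c1 a b ha hb) (cA a b ha hb)).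
have B := @bdry_int_bound _ _ _ _ _ (e * (L / 2 ^+ n)) (le_trans s10 xs) xh yk cqA.
have {}B : cm (bdry_int (fun z => q z - A z) x (x + h) y (y + k)) <=
   4 * (e * (L / 2 ^+ n)) * (h + s2 * k).
  apply: le_trans (B _) _.
    move=> a b ha hb; have nab := near a b ha hb.
    rewrite /A opprD addrA; apply: le_trans (dH _ _) _.
      exact: le_lt_trans nab Ln.
    by rewrite ler_pM2l.
  apply: ler_pM => //.
  - by rewrite !mulr_ge0// ?ltW// invr_ge0 exprn_ge0.
  - by rewrite (addrC x) addrK (addrC y) addrK addr_ge0// mulr_ge0// addr_ge0//
    (le_trans s10).
  - rewrite (addrC x) addrK (addrC y) addrK lerD2l ler_wpM2r//.
    by rewrite addrC.
rewrite (le_trans (ler_wpM2l _ B)) ?exprn_ge0//.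
have -> : 4 ^+ n * (4 * (e * (L / 2 ^+ n)) * (h + s2 * k)) = e * P.
  rewrite /P /h /k (_ : 4 = 2 * 2) ?exprMn; last by rewrite -natrM.
  by field; rewrite expf_neq0.
by rewrite (ler_pM2l e0) lerDl.
Qed.

End Goursat.

(** * Cauchy's formula and its consequences *)

Section Cauchy.
Variable R : realType.
Implicit Types (f q : R[i] -> R[i]) (s t r : R) (z w : R[i]).

Local Notation "{ 'cont' q 'at' z }" := {for (z : R[i]^o), continuous (q : R[i]^o -> R[i]^o)}
  (at level 0, q at level 99, z at level 99).
Local Notation pi2 := (2 * pi : R).

Lemma pi2_ge0 : 0 <= pi2.
Proof. by rewrite mulr_ge0// pi_ge0. Qed.

(** In a full annulus the two radial sides of the polar rectangle coincide and
    cancel. *)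
Lemma arc_int_const q s1 s2 : 0 <= s1 -> s1 <= s2 ->
  (forall z, s1 <= cm z <= s2 -> cdiff q z) -> arc_int q s1 0 pi2 = arc_int q s2 0 pi2.
Proof.
move=> s10 s12 dq; have := @goursat R q s1 s2 0 pi2 s10 s12 pi2_ge0.
have -> : bdry_int q s1 s2 0 pi2 = arc_int q s2 0 pi2 - arc_int q s1 0 pi2.
  by rewrite /bdry_int /rad_int expi_2pi expi0; congr (_ - _); rewrite addrAC subrr add0r.
move=> H; apply/eqP; rewrite eq_sym -subr_eq0; apply/eqP/H => s t sh _.
by apply: dq; rewrite cm_pol//; case/andP: sh => /(le_trans s10).
Qed.

Lemma disc_bounded q r : (forall z, cm z <= r -> {cont q at z}) ->
  exists M, forall s t, `|s| <= r -> 0 <= t <= pi2 -> cm (q (s%:C * expi t)) <= M.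
Proof.
move=> cq; have [r0|r0] := leP 0 r; last first.
  by exists 0 => s t /(le_trans (normr_ge0 s)); rewrite leNgt r0.
pose A : set (R * R) := `[- r, r]%classic `*` `[0, pi2]%classic.
pose F (p : R * R) := cm (q (p.1%:C * expi p.2)).
have cF p : A p -> {for p, continuous F}.
  move=> [/=]; rewrite !in_itv/= => p1 p2.
  have cg : {for p, continuous ((fun p => p.1%:C * expi p.2) : R * R -> R[i]^o)}.
    apply: cvgM.
      by apply: (@cvg_comp _ _ _ fst); [exact: cvg_fst|exact: RC_cont].
    by apply: (@cvg_comp _ _ _ snd); [exact: cvg_snd|exact: expi_cont].
  have pr : cm (p.1%:C * expi p.2) <= r by rewrite cmM cm_expi mulr1 cmR ler_norml.
  have := @continuous_comp (R * R)%type R[i]^o R[i]^o _ q p cg (cq _ pr).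
  move/(ccvgP (F := nbhs p)) => H; apply/cvgrPdist_lt => e /H.
  apply: filterS => x; apply: le_lt_trans; rewrite /F /=.
  rewrite ler_norml; apply/andP; split.
    by rewrite lerNl opprB cm_sub.
  by rewrite (le_trans (cm_sub _ _))// cmBC.
have [] := @compact_EVT_max _ R F A.
- by exists (0, 0); split => /=; rewrite in_itv/= ?lexx ?oppr_le0 ?r0 ?pi2_ge0.
- by apply: compact_setX; exact: segment_compact.
- by apply: continuous_in_subspaceT => p /set_mem; exact: cF.
move=> p [_ pM]; exists (F p) => s t sr th; apply: (pM (s, t)).
by apply/mem_set; split => /=; rewrite in_itv/= -?ler_norml.
Qed.

Lemma rI_continuous (F : R -> R -> R) r b M : 0 <= b ->
  (forall s, `|s| < r -> cont_itv 0 b (F s)) ->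
  (forall s t, `|s| < r -> 0 <= t <= b -> {for s, continuous (F ^~ t)}) ->
  (forall s t, `|s| < r -> 0 <= t <= b -> `|F s t| <= M) ->
  forall s, `|s| < r -> {for s, continuous (fun s => rI 0 b (F s))}.
Proof.
move=> b0 cF1 cF2 FM s sr.
have I x : `]- r, r[%classic x -> `|x| < r by rewrite /= in_itv/= ltr_norml.
apply: (@continuity_under_integral R _ _ (@lebesgue_measure R) F `[0, b]%classic
  _ (- r) r _ _ (fun=> M)) => //.
- by move=> x /I xr; apply: cont_itv_integrable; exact: cF1.
- apply: aeW => t; rewrite /= in_itv /= => th x /set_mem/I xr.
  exact: cF2.
- by apply: cont_itv_integrable; exact: cont_itv_cst.
- move=> x /I xr; apply: aeW => t; rewrite /= in_itv/= => th; exact: FM.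
- by apply/mem_set; rewrite /= in_itv/= -ltr_norml.
Qed.

Lemma arc_int_continuous q r : (forall z, cm z <= r -> {cont q at z}) ->
  forall s, `|s| < r -> {for s, continuous ((fun s => arc_int q s 0 pi2) : R -> R[i]^o)}.
Proof.
move=> cq s0 sr.
have qc s t : `|s| < r -> {cont q at s%:C * expi t}.
  by move=> sr'; apply: cq; rewrite cmM cm_expi mulr1 cmR ltW.
have [M MP] := disc_bounded cq.
pose G s t := q (s%:C * expi t) * ('i * (s%:C * expi t)).
have cG1 s : `|s| < r -> ccont_itv 0 pi2 (G s).
  by move=> h; apply: arc_con => t _; exact: qc.
have cG2 s t : `|s| < r -> {for s, continuous ((G ^~ t) : R -> R[i]^o)}.
  move=> h; apply: cvgM; first by apply: cont_comp (qc _ _ h); exact: pols_cont.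
  by apply: cvgM; [exact: cvg_cst|exact: pols_cont].
have GM s t : `|s| < r -> 0 <= t <= pi2 -> cm (G s t) <= M * r.
  move=> h th; rewrite /G !cmM cmi cm_expi mul1r mulr1 cmR.
  by apply: ler_pM; rewrite ?cm_ge0 ?normr_ge0 ?MP// ltW.
apply/(cvgReIm (F := nbhs s0)); split.
  apply: (@rI_continuous (fun s t => Re (G s t)) r pi2 (M * r)) => //.
  - exact: pi2_ge0.
  - by move=> x /cG1; exact: con_Re.
  - by move=> x t /(cG2 _ t) /(cvgReIm (F := nbhs x))[].
  - by move=> x t h th; rewrite (le_trans (Re_le _))// GM.
apply: (@rI_continuous (fun s t => Im (G s t)) r pi2 (M * r)) => //.
- exact: pi2_ge0.
- by move=> x /cG1; exact: con_Im.
- by move=> x t /(cG2 _ t) /(cvgReIm (F := nbhs x))[].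
- by move=> x t h th; rewrite (le_trans (Im_le _))// GM.
Qed.

Lemma eq_of_lim (G : R -> R[i]) (a b s0 : R) (c : R[i]) :
  {for s0, continuous (G : R -> R[i]^o)} -> a <= s0 <= b -> a < b ->
  (forall s, a < s < b -> G s = c) -> G s0 = c.
Proof.
move=> /(ccvgP (F := nbhs s0)) H /andP[as0 s0b] ab Gc.
apply/eqP; rewrite -subr_eq0 -cm_eq0; apply/eqP/le_anti.
rewrite cm_ge0 andbT; apply/ler_addgt0Pr => e e0; rewrite add0r.
have /nbhs_ballP[d /= d0 dH] := H e e0.
have [x [xs xd]] : exists x, a < x < b /\ `|s0 - x| < d.
  have [s0b'|] := ltP s0 b.
    exists (Num.min ((s0 + b) / 2) (s0 + d / 2)).
    by rewrite ltr_norml; case: (leP ((s0 + b) / 2)) => ?; split; apply/andP; split; lra.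
  move=> bs0; exists (Num.max ((a + s0) / 2) (s0 - d / 2)).
  by rewrite ltr_norml; case: (leP ((a + s0) / 2)) => ?; split; apply/andP; split; lra.
by have := dH x xd; rewrite /= Gc// cmBC => /ltW.
Qed.

(** Cauchy's theorem on a disc, with one exceptional point: the circle
    integral of [q] is locally constant off the radius of [z0], continuous
    across it, and zero at radius zero. *)
Lemma cauchy0 q r z0 : cm z0 < r -> (forall z, cm z <= r -> {cont q at z}) ->
  (forall z, cm z <= r -> z != z0 -> cdiff q z) -> arc_int q r 0 pi2 = 0.
Proof.
move=> z0r cq dq; have z00 := cm_ge0 z0; have r0 := le_lt_trans z00 z0r.
have cG := arc_int_continuous cq.
have nz s z : s != cm z0 -> cm z = s -> z != z0.
  by move=> sz zs; apply: contra_neq sz => <-.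
have G0 : arc_int q 0 0 pi2 = 0.
  rewrite /arc_int (eq_cI (g := fun=> 0)); last by move=> x _; rewrite !mul0r mulr0 mulr0.
  by rewrite cI_cst ?mul0r// pi2_ge0.
have Gr : arc_int q (cm z0) 0 pi2 = arc_int q r 0 pi2.
  apply: (@eq_of_lim (fun s => arc_int q s 0 pi2) (cm z0) r) => //.
    by apply: cG; rewrite ger0_norm.
    by rewrite lexx ltW.
  move=> s /andP[sz sr]; apply: arc_int_const; [exact: le_trans (ltW sz)|exact: ltW|].
  move=> z /andP[h1 h2]; apply: dq => //.
  by apply: (nz (cm z)) => //; rewrite gt_eqF// (lt_le_trans sz).
rewrite -Gr; have [z0E|z0N] := eqVneq (cm z0) 0; first by rewrite z0E.
have z0p : 0 < cm z0 by rewrite lt_def z0N.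
pose c := arc_int q (cm z0 / 2) 0 pi2.
have Gc s : 0 < s < cm z0 -> arc_int q s 0 pi2 = c.
  move=> /andP[s0 sz].
  have d a b z : 0 < a -> b < cm z0 -> a <= cm z <= b -> cdiff q z.
    move=> a0 bz /andP[az zb]; apply: dq; first by rewrite (le_trans zb)// ltW// (lt_trans bz).
    by apply: (nz (cm z)) => //; rewrite lt_eqF// (le_lt_trans zb).
  rewrite /c; have [h|h] := leP s (cm z0 / 2).
    by apply: arc_int_const => // [|z]; [exact: ltW|apply: d => //; lra].
  by apply/esym/arc_int_const => [||z]; [lra|exact: ltW|apply: d => //; lra].
rewrite (@eq_of_lim (fun s => arc_int q s 0 pi2) 0 (cm z0) (cm z0) c) ?lexx ?andbT//; last first.
  by apply: cG; rewrite ger0_norm.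
rewrite -(@eq_of_lim (fun s => arc_int q s 0 pi2) 0 (cm z0) 0 c) ?lexx//.
by apply: cG; rewrite normr0.
Qed.

(** The integral does not depend on [r], and its limit at infinity is that of
    the constant 1. *)
Lemma cauchy_kernel r z0 : cm z0 < r ->
  cI 0 pi2 (fun t => (r%:C * expi t) / (r%:C * expi t - z0)) = pi2%:C.
Proof.
move=> z0r; have z00 := cm_ge0 z0; have r0 := le_lt_trans z00 z0r.
pose q z := (z - z0)^-1.
have dq z : cm z0 < cm z -> cdiff q z.
  move=> h; apply: cdiffV; last by apply: cdiffB; [exact: cdiff_id|exact: cdiff_cst].
  by rewrite subr_eq0; apply: contraTneq h => ->; rewrite ltxx.
pose g s t := (s%:C * expi t) / (s%:C * expi t - z0).
have nz s t : cm z0 < s -> s%:C * expi t - z0 != 0.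
  move=> h; rewrite subr_eq0; apply: contraTneq h => <-.
  rewrite cmM cm_expi mulr1 cmR ltNge negbK ler_norm//.
have cg s : cm z0 < s -> ccont_itv 0 pi2 (g s).
  move=> h; apply: cconM => [t _|]; first exact: polt_cont.
  apply: cconV => [|t _]; last exact: nz.
  by apply: cconD => [t _|]; [exact: polt_cont|exact: cont_itv_cst].
have gE s : cm z0 < s -> arc_int q s 0 pi2 = 'i * cI 0 pi2 (g s).
  move=> h; rewrite -(cIZ 'i (cg _ h)) /arc_int; congr cI.
  by apply/funext => t; rewrite /q /g; field; exact: nz.
have i0 : ('i : R[i]) != 0 by rewrite -cm_eq0 cmi oner_eq0.
apply/eqP; rewrite -subr_eq0 -cm_eq0; apply/eqP/le_anti.
rewrite cm_ge0 andbT; apply/ler_addgt0Pr => e e0; rewrite add0r.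
pose s := r + cm z0 * (1 + 2 * pi2 / e).
have K0 : 0 <= cm z0 * (1 + 2 * pi2 / e).
  by rewrite mulr_ge0// addr_ge0// divr_ge0 ?mulr_ge0 ?pi_ge0// ltW.
have rs : r <= s by rewrite lerDl.
have zs := lt_le_trans z0r rs.
have -> : cI 0 pi2 (g r) = cI 0 pi2 (g s).
  apply: (mulfI i0); rewrite -!gE//; apply: arc_int_const => // [|z /andP[rz _]].
    exact: ltW.
  by apply: dq; exact: lt_le_trans rz.
have -> : pi2%:C = cI 0 pi2 (fun=> 1) by rewrite cI_cst ?mul1r ?subr0 ?pi2_ge0.
rewrite -(cIB (cg _ zs) (@cont_itv_cst R R[i]^o 0 pi2 1)).
have s0 : 0 <= s by rewrite (le_trans _ rs)// ltW.
rewrite (le_trans (@cI_bound R 0 pi2 _ (cm z0 / (s - cm z0)) pi2_ge0 _ _))//.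
- by apply: (@cconD R 0 pi2 (g s) (fun=> -1)); [exact: cg|exact: cont_itv_cst].
- move=> t _; rewrite (_ : _ - 1 = z0 / (s%:C * expi t - z0)); last by rewrite /g; field; exact: nz.
  rewrite cm_div ler_wpM2l// lef_pV2 ?posrE ?cm_gt0 ?nz ?subr_gt0//.
  by rewrite -{1}(cm_pol t s0) cm_sub.
have zs' : 0 < s - cm z0 by rewrite subr_gt0.
rewrite subr0 (_ : 2 * _ * _ = 2 * cm z0 * pi2 / (s - cm z0)); last first.
  by field; rewrite gt_eqF.
rewrite ler_pdivrMr//.
rewrite /s; have := r0; have : 0 < r - cm z0 by rewrite subr_gt0.
move=> h _; have -> : e * (r + cm z0 * (1 + 2 * pi2 / e) - cm z0) =
  e * r + 2 * cm z0 * pi2 by field; rewrite gt_eqF.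
by rewrite lerDr mulr_ge0// ltW.
Qed.

(** The difference quotient of [f] at [z0], completed by [f' z0], is continuous
    everywhere and differentiable off [z0], so its circle integral vanishes. *)
Theorem cauchy_formula f r z0 : cm z0 < r -> (forall z, cm z <= r -> cdiff f z) ->
  cI 0 pi2 (fun t => f (r%:C * expi t) * ((r%:C * expi t) / (r%:C * expi t - z0))) =
  f z0 * pi2%:C.
Proof.
move=> z0r df; have z00 := cm_ge0 z0; have r0 := le_lt_trans z00 z0r.
have [l dl] := df z0 (ltW z0r).
pose q z := if z == z0 then l else (f z - f z0) / (z - z0).
have dq z : cm z <= r -> z != z0 -> cdiff q z.
  move=> zr zz0; have d0 : 0 < cm (z - z0) by rewrite cm_gt0 subr_eq0.
  apply: (@cdiff_near _ (fun z => (f z - f z0) / (z - z0)) _ _ _ d0).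
    move=> w wz; rewrite /q ifN//; apply: contraTneq wz => ->.
    by rewrite cmBC ltxx.
  apply: cdiffM; first by apply: cdiffB; [exact: df|exact: cdiff_cst].
  apply: cdiffV; first by rewrite subr_eq0.
  by apply: cdiffB; [exact: cdiff_id|exact: cdiff_cst].
have cq z : cm z <= r -> {cont q at z}.
  move=> zr; have [->|/(dq _ zr)] := eqVneq z z0; last exact: cdiff_cont.
  apply/ccontP => e e0; have e20 : 0 < e / 2 by rewrite divr_gt0.
  have [d d0 dH] := dl _ e20; exists d => // w wd; rewrite /q eqxx.
  case: eqVneq => [_|wz]; first by rewrite subrr cm0.
  have wz0 : w - z0 != 0 by rewrite subr_eq0.
  rewrite (_ : _ - l = (f w - f z0 - l * (w - z0)) / (w - z0)); last by field.
  rewrite cm_div ltr_pdivrMr ?cm_gt0// (le_lt_trans (dH w wd))//.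
  by rewrite ltr_pM2r ?cm_gt0//; lra.
have := cauchy0 z0r cq dq; rewrite /arc_int.
have nz t : r%:C * expi t - z0 != 0.
  rewrite subr_eq0; apply: contraTneq z0r => <-.
  by rewrite cm_pol ?ltxx// ltW.
have cK : ccont_itv 0 pi2 (fun t => (r%:C * expi t) / (r%:C * expi t - z0)).
  apply: cconM => [t _|]; first exact: polt_cont.
  apply: cconV => [|t _]; last exact: nz.
  by apply: cconD => [t _|]; [exact: polt_cont|exact: cont_itv_cst].
have cf : ccont_itv 0 pi2 (fun t => f (r%:C * expi t)).
  move=> t _; apply: cont_comp; first exact: polt_cont.
  by apply/cdiff_cont/df; rewrite cm_pol// ltW.
rewrite (eq_cI (g := fun t => 'i * (f (r%:C * expi t) * ((r%:C * expi t) / (r%:C * expi t - z0))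
   - f z0 * ((r%:C * expi t) / (r%:C * expi t - z0))))); last first.
  move=> t _; rewrite /q ifN; last by rewrite -subr_eq0.
  by field; exact: nz.
have c1 := cconM cf cK; have c2 := cconM (@cont_itv_cst _ R[i]^o 0 pi2 (f z0)) cK.
rewrite (cIZ 'i (cconD c1 (cconN c2))) (cIB c1 c2) (cIZ (f z0) cK) cauchy_kernel//.
move/eqP; rewrite mulf_eq0 -cm_eq0 cmi oner_eq0 /= subr_eq0 => /eqP.
exact.
Qed.

End Cauchy.

Section Consequences.
Variable R : realType.
Implicit Types (f q u : R[i] -> R[i]) (s t r : R) (z w a l : R[i]).

Local Notation pi2 := (2 * pi : R).

Definition holo_on r f := forall z, cm z <= r -> cdiff f z.

Lemma pi2_gt0 : 0 < pi2.
Proof. by rewrite mulr_gt0// pi_gt0. Qed.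

Lemma bernoulli (x : R) n : 0 <= x -> 1 + n%:R * x <= (1 + x) ^+ n.
Proof.
move=> x0; elim: n => [|n IH]; first by rewrite mul0r addr0 expr0.
rewrite exprS -natr1 (le_trans _ (ler_wpM2l _ IH))//; last by rewrite addr_ge0.
rewrite -subr_ge0 (_ : _ - _ = n%:R * (x * x)); last by ring.
by rewrite !mulr_ge0.
Qed.

Lemma le_of_powers (x y C : R) : 0 <= y -> 0 <= x ->
  (forall n, x ^+ n <= C * y ^+ n) -> x <= y.
Proof.
move=> y0 x0 H; rewrite leNgt; apply/negP => yx.
have [y00|yN] := eqVneq y 0.
  have := H 1%N; rewrite !expr1 y00 mulr0 leNgt => /negP; apply.
  exact: le_lt_trans yx.
have yp : 0 < y by rewrite lt_def yN.
pose d := x / y - 1; have d0 : 0 < d by rewrite subr_gt0 ltr_pdivlMr// mul1r.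
have B n : 1 + n%:R * d <= C.
  rewrite (le_trans (bernoulli n (ltW d0)))// /d addrC subrK expr_div_n.
  by rewrite ler_pdivrMr ?exprn_gt0.
have := archi_boundP (divr_ge0 (le_trans _ (B 0%N)) (ltW d0)).
rewrite mul0r addr0 => /(_ ler01); rewrite ltr_pdivrMr//.
by have := B (Num.bound (C / d)); lra.
Qed.

Lemma circle_sub r z t : cm z < r -> r - cm z <= cm (r%:C * expi t - z).
Proof.
move=> zr; have r0 : 0 <= r by rewrite (le_trans (cm_ge0 z))// ltW.
by rewrite -{1}(cm_pol t r0) cm_sub.
Qed.

Lemma circle_sub_neq0 r z t : cm z < r -> r%:C * expi t - z != 0.
Proof.
move=> zr; rewrite -cm_gt0 (lt_le_trans _ (circle_sub t zr))//.
by rewrite subr_gt0.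
Qed.

Lemma circle_con r z : cm z < r -> ccont_itv 0 pi2 (fun t => (r%:C * expi t - z)^-1).
Proof.
move=> zr; apply: cconV => [|t _]; last exact: circle_sub_neq0.
by apply: cconD => [t _|]; [exact: polt_cont|exact: cont_itv_cst].
Qed.

Lemma circle_fcon f r : 0 <= r -> holo_on r f -> ccont_itv 0 pi2 (fun t => f (r%:C * expi t)).
Proof.
move=> r0 hf t _; apply: cont_comp; first exact: polt_cont.
by apply/cdiff_cont/hf; rewrite cm_pol.
Qed.

(** Cauchy's formula bounds [|f z|] by a multiple of the supremum on the
    circle; applied to all powers of [f] it loses the constant. *)
Lemma max_circle f r (m : R) : holo_on r f ->
  (forall t, 0 <= t <= pi2 -> cm (f (r%:C * expi t)) <= m) ->
  forall z, cm z < r -> cm (f z) <= m.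
Proof.
move=> hf fm z zr.
have z0 := cm_ge0 z; have r0 := le_lt_trans z0 zr.
have m0 : 0 <= m by rewrite (le_trans _ (fm 0 _)) ?cm_ge0// lexx pi2_ge0.
apply: (@le_of_powers _ _ (2 * (r / (r - cm z)))) => [//||n]; first exact: cm_ge0.
have hfn : holo_on r (fun z => f z ^+ n) by move=> w wr; apply: cdiffX; exact: hf.
have := cauchy_formula zr hfn.
move/(congr1 (@cm R)); rewrite cmM cmX cmR (ger0_norm (pi2_ge0 R)) => E.
rewrite -(ler_pM2r pi2_gt0) -E.
rewrite (le_trans (@cI_bound R 0 pi2 _ (m ^+ n * (r / (r - cm z))) (pi2_ge0 R) _ _))//.
- apply: cconM; first exact: circle_fcon (ltW r0) hfn.
  by apply: cconM => [t _|]; [exact: polt_cont|exact: circle_con].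
- move=> t th; rewrite cmM cmX cm_div cm_pol ?(ltW r0)//.
  apply: ler_pM; rewrite ?exprn_ge0 ?cm_ge0 ?divr_ge0 ?cm_ge0 ?(ltW r0)//.
    by rewrite lerXn2r ?nnegrE ?cm_ge0 ?fm.
  rewrite ler_pM2l// lef_pV2 ?posrE ?subr_gt0//; first exact: circle_sub.
  by rewrite cm_gt0 circle_sub_neq0.
- by rewrite subr0 [m ^+ n * _]mulrC [2 * (_ * m ^+ n)]mulrA.
Qed.

Lemma max_principle f r (m : R) : holo_on r f ->
  (forall z, cm z = r -> cm (f z) <= m) -> forall z, cm z <= r -> cm (f z) <= m.
Proof.
move=> hf fm z; rewrite le_eqVlt => /predU1P[/fm//|zr].
have r0 : 0 <= r by rewrite (le_trans (cm_ge0 z))// ltW.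
by apply: max_circle zr => // t _; apply: fm; rewrite cm_pol.
Qed.

(** Expanding the Cauchy kernel to second order about [a] gives a Taylor
    expansion whose error constant is uniform over a smaller disc. *)
Lemma taylor3 f r r' : 0 <= r' -> r' < r -> holo_on r f -> exists2 K, 0 <= K &
  forall a, cm a <= r' -> exists A1 A2 : R[i], cm A2 <= K /\
  forall z, cm z <= r' ->
    cm (f z - f a - A1 * (z - a) - A2 * (z - a) ^+ 2) <= K * cm (z - a) ^+ 3.
Proof.
move=> r'0 r'r hf; have r0 := le_lt_trans r'0 r'r.
have [M MP] : exists M, forall t, 0 <= t <= pi2 -> cm (f (r%:C * expi t)) <= M.
  have [|M MP] := @disc_bounded R f r; first by move=> z /hf /cdiff_cont.
  by exists M => t; apply: MP; rewrite ger0_norm// ltW.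
have M0 : 0 <= M by rewrite (le_trans _ (MP 0 _)) ?cm_ge0// lexx pi2_ge0.
pose d := r - r'; have d0 : 0 < d by rewrite subr_gt0.
have dd n : 0 <= 2 * (M * r / d ^+ n).
  by rewrite mulr_ge0// divr_ge0 ?exprn_ge0 ?mulr_ge0// ltW.
exists (2 * (M * r / d ^+ 3) + 2 * (M * r / d ^+ 4)); first by rewrite addr_ge0.
move=> a ar.
have cf := circle_fcon (ltW r0) hf.
have cp : ccont_itv 0 pi2 (fun t => f (r%:C * expi t) * (r%:C * expi t)).
  by apply: (cconM cf) => t _; exact: polt_cont.
have D z : cm z <= r' -> ccont_itv 0 pi2 (fun t => (r%:C * expi t - z)^-1).
  by move=> zr; apply: circle_con; exact: le_lt_trans r'r.
have Dd z t : cm z <= r' -> cm (r%:C * expi t - z)^-1 <= d^-1.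
  move=> zr; have zr' := le_lt_trans zr r'r.
  rewrite cmV lef_pV2 ?posrE ?cm_gt0 ?circle_sub_neq0// (le_trans _ (circle_sub t zr'))//.
  by rewrite lerB.
pose g t := f (r%:C * expi t) * (r%:C * expi t).
have gM t : 0 <= t <= pi2 -> cm (g t) <= M * r.
  move=> th; rewrite /g cmM cm_pol ?(ltW r0)// ler_wpM2r ?(ltW r0)//.
  exact: MP.
have d'0 : 0 <= d^-1 by rewrite invr_ge0 ltW.
have bnd (h : R -> R[i]) n : ccont_itv 0 pi2 h ->
  (forall t, 0 <= t <= pi2 -> cm (h t) <= d^-1 ^+ n) ->
  cm (cI 0 pi2 (fun t => g t * h t) / pi2%:C) <= 2 * (M * r / d ^+ n).
  move=> ch hM; rewrite cm_div cmR (ger0_norm (pi2_ge0 R)) ler_pdivrMr ?pi2_gt0//.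
  rewrite -{2}[pi2]subr0; apply: (cI_bound (pi2_ge0 R) (cconM cp ch)).
  move=> t th; rewrite cmM; apply: ler_pM; rewrite ?cm_ge0 ?gM//.
  by rewrite -exprVn hM.
pose D1 t := (r%:C * expi t - a)^-1.
have c1 : ccont_itv 0 pi2 D1 := D a ar.
have c2 : ccont_itv 0 pi2 (fun t => D1 t * D1 t) := cconM c1 c1.
have c3 : ccont_itv 0 pi2 (fun t => D1 t * D1 t * D1 t) := cconM c2 c1.
pose A1 := cI 0 pi2 (fun t => g t * (D1 t * D1 t)) / pi2%:C.
pose A2 := cI 0 pi2 (fun t => g t * (D1 t * D1 t * D1 t)) / pi2%:C.
have b3 t : cm (D1 t * D1 t * D1 t) <= d^-1 ^+ 3.
  rewrite !cmM !exprS expr0 mulr1 mulrA.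
  by apply: ler_pM; rewrite ?mulr_ge0 ?cm_ge0 ?Dd//; apply: ler_pM;
    rewrite ?cm_ge0 ?Dd.
exists A1, A2; split.
  rewrite (le_trans (bnd _ 3%N c3 (fun t _ => b3 t)))// lerDl//.
move=> z zr; have cz := D z zr.
pose D2 t := (r%:C * expi t - z)^-1.
have c4 : ccont_itv 0 pi2 (fun t => D1 t * D1 t * D1 t * D2 t) := cconM c3 cz.
have P : pi2%:C != 0 :> R[i] by rewrite RCeq0 gt_eqF ?pi2_gt0.
have fE w : cm w <= r' -> f w = cI 0 pi2 (fun t => g t * (r%:C * expi t - w)^-1) / pi2%:C.
  move=> wr; apply: (canRL (mulfK P)).
  rewrite -(cauchy_formula (le_lt_trans wr r'r) hf); congr cI.
  by apply/funext => t; rewrite /g mulrA.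
have -> : f z - f a - A1 * (z - a) - A2 * (z - a) ^+ 2 =
    (z - a) ^+ 3 * (cI 0 pi2 (fun t => g t * (D1 t * D1 t * D1 t * D2 t)) / pi2%:C).
  rewrite (fE z zr) (fE a ar).
  have -> : cI 0 pi2 (fun t => g t * (r%:C * expi t - z)^-1) =
      cI 0 pi2 (fun t => g t * D1 t + (z - a) * (g t * (D1 t * D1 t)) +
        ((z - a) ^+ 2 * (g t * (D1 t * D1 t * D1 t)) +
         (z - a) ^+ 3 * (g t * (D1 t * D1 t * D1 t * D2 t)))).
    apply: eq_cI => t _; rewrite /D1 /D2.
    have na := circle_sub_neq0 t (le_lt_trans ar r'r).
    have nz := circle_sub_neq0 t (le_lt_trans zr r'r).
    by move: (g t) (r%:C * expi t) na nz => v c na nz; field; rewrite na nz.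
  have Z (k : R[i]) h : ccont_itv 0 pi2 h -> ccont_itv 0 pi2 (fun t => k * h t).
    by move=> ch; exact: (cconM (@cont_itv_cst R R[i]^o 0 pi2 k) ch).
  have G h : ccont_itv 0 pi2 h -> ccont_itv 0 pi2 (fun t => g t * h t).
    by move=> ch; exact: (cconM cp ch).
  rewrite (cID (cconD (G _ c1) (Z (z - a) _ (G _ c2)))
    (cconD (Z ((z - a) ^+ 2) _ (G _ c3)) (Z ((z - a) ^+ 3) _ (G _ c4)))).
  rewrite (cID (G _ c1) (Z (z - a) _ (G _ c2))).
  rewrite (cID (Z ((z - a) ^+ 2) _ (G _ c3)) (Z ((z - a) ^+ 3) _ (G _ c4))).
  rewrite (cIZ _ (G _ c2)) (cIZ _ (G _ c3)) (cIZ _ (G _ c4)).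
  rewrite /A1 /A2 -/D1.
  move: (cI _ _ _) (cI _ _ _) (cI _ _ _) (cI _ _ _) => x1 x2 x3 x4.
  by move: (pi2%:C)^-1 => p; ring.
rewrite cmM cmX mulrC ler_wpM2r ?exprn_ge0 ?cm_ge0//.
rewrite (le_trans (bnd _ 4%N c4 _))// ?lerDr//.
move=> t _; rewrite cmM exprSr; apply: ler_pM; rewrite ?cm_ge0 ?b3//.
exact: Dd.
Qed.

Definition cderive f z : R[i] := xget 0 [set l | cder f z l].

Lemma cderiveP f z : cdiff f z -> cder f z (cderive f z).
Proof. by move=> [l dl]; exact: (@xgetI _ _ _ l). Qed.

Lemma taylor_cder f (d : R) a A1 A2 (K : R) : 0 < d ->
  (forall z, cm (z - a) < d ->
    cm (f z - f a - A1 * (z - a) - A2 * (z - a) ^+ 2) <= K * cm (z - a) ^+ 3) ->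
  cder f a A1.
Proof.
move=> d0 H e e0; pose L := cm A2 + `|K| * d + 1.
have L0 : 0 < L by rewrite ltr_wpDl// addr_ge0 ?cm_ge0// mulr_ge0// ltW.
exists (Num.min d (e / L)); first by rewrite lt_min d0 divr_gt0.
move=> w; rewrite lt_min => /andP[wd we].
rewrite -[_ - _ * _](subrK (A2 * (w - a) ^+ 2)) (le_trans (cmD _ _))//.
rewrite (le_trans (lerD (H _ wd) (lexx _)))// cmM cmX.
have c0 := cm_ge0 (w - a).
have -> : K * cm (w - a) ^+ 3 + cm A2 * cm (w - a) ^+ 2 =
  (K * cm (w - a) + cm A2) * cm (w - a) * cm (w - a) by ring.
rewrite ler_wpM2r// (le_trans (y := L * cm (w - a)))//.
  rewrite ler_wpM2r// /L [cm A2 + _]addrC -addrA lerD ?lerDl//.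
  rewrite (le_trans (ler_norm _))// normrM (ger0_norm c0) ler_wpM2l//.
  exact: ltW.
by rewrite mulrC -ler_pdivlMr// ltW.
Qed.

Lemma taylor2 f r r' : 0 <= r' -> r' < r -> holo_on r f -> exists2 K, 0 <= K &
  forall a z, cm a <= r' -> cm z <= r' ->
    cm (f z - f a - cderive f a * (z - a)) <= K * cm (z - a) ^+ 2.
Proof.
move=> r'0 r'r hf; pose s := (r + r') / 2.
have [s0 r's sr] : [/\ 0 <= s, r' < s & s < r] by split; rewrite /s; lra.
have [K K0 KP] := taylor3 s0 sr hf.
exists (K + K * (2 * r')); first by rewrite addr_ge0// !mulr_ge0.
move=> a z ar zr; have [A1 [A2 [A2K H]]] := KP a (le_trans ar (ltW r's)).
have dA1 : cder f a A1.
  apply: (@taylor_cder f (s - r') a A1 A2 K); first by rewrite subr_gt0.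
  move=> w wd; apply: H; rewrite -(subrK a w) (le_trans (cmD _ _))//; lra.
have -> : cderive f a = A1.
  by apply: cder_unique dA1; apply: cderiveP; apply: hf; rewrite (le_trans ar) ?ltW.
have {}H := H z (le_trans zr (ltW r's)).
rewrite -[_ - _ * _](subrK (A2 * (z - a) ^+ 2)) (le_trans (cmD _ _))//.
rewrite (le_trans (lerD H (lexx _)))// cmM cmX addrC mulrDl.
have c0 := cm_ge0 (z - a).
apply: lerD; first by rewrite ler_wpM2r ?exprn_ge0.
rewrite exprS mulrA ler_wpM2r ?exprn_ge0// ler_wpM2l//.
rewrite (le_trans (cmB _ _))//; lra.
Qed.

(** The singularity of the difference quotient is removable: its derivative at
    [a] is the coefficient of order two in the Taylor expansion of [f]. *)
Lemma quotient_hol f r a : cm a < r -> holo_on r f -> exists q,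
  (forall z, f z - f a = (z - a) * q z) /\ (forall z, cdiff f z -> cdiff q z).
Proof.
move=> ar hf; have a0 := cm_ge0 a.
pose s := (r + cm a) / 2.
have [s0 as_ sr] : [/\ 0 <= s, cm a < s & s < r] by split; rewrite /s; lra.
have [K K0 KP] := taylor3 s0 sr hf.
have [A1 [A2 [_ H]]] := KP a (ltW as_).
have near z : cm (z - a) < s - cm a -> cm z <= s.
  by move=> h; rewrite -(subrK a z) (le_trans (cmD _ _))//; lra.
pose q z := if z == a then A1 else (f z - f a) / (z - a).
exists q; split=> [z|z dz].
  rewrite /q; case: eqVneq => [->|za]; first by rewrite !subrr mul0r.
  by field; rewrite subr_eq0.
have [->|za] := eqVneq z a; last first.
  have d0 : 0 < cm (z - a) by rewrite cm_gt0 subr_eq0.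
  apply: (@cdiff_near _ (fun z => (f z - f a) / (z - a)) _ _ _ d0).
    move=> w wz; rewrite /q ifN//; apply: contraTneq wz => ->.
    by rewrite cmBC ltxx.
  apply: cdiffM; first by apply: cdiffB; [exact: dz|exact: cdiff_cst].
  apply: cdiffV; first by rewrite subr_eq0.
  by apply: cdiffB; [exact: cdiff_id|exact: cdiff_cst].
exists A2 => e e0.
have K1 : 0 < K + 1 by rewrite ltr_wpDl.
exists (Num.min (s - cm a) (e / (K + 1))).
  by rewrite lt_min subr_gt0 as_ divr_gt0.
move=> w; rewrite lt_min => /andP[ws we].
have [->|wa] := eqVneq w a; first by rewrite !subrr mulr0 subrr cm0 mulr0.
have wa0 : w - a != 0 by rewrite subr_eq0.
have cwa : 0 < cm (w - a) by rewrite cm_gt0.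
rewrite /q (negbTE wa) eqxx.
have -> : (f w - f a) / (w - a) - A1 - A2 * (w - a) =
  (f w - f a - A1 * (w - a) - A2 * (w - a) ^+ 2) / (w - a) by field.
rewrite cm_div ler_pdivrMr// (le_trans (H _ (near _ ws)))//.
rewrite (_ : K * _ = K * cm (w - a) * cm (w - a) * cm (w - a)); last by ring.
rewrite !ler_pM2r//.
move: we; rewrite ltr_pdivlMr// => /ltW; apply: le_trans.
by rewrite mulrC ler_wpM2l ?lerDl// ltW.
Qed.

Lemma cm_segment (k : R) z w r : 0 <= k <= 1 -> cm z <= r -> cm w <= r ->
  cm (z + k%:C * (w - z)) <= r.
Proof.
move=> /andP[k0 k1] zr wr.
have -> : z + k%:C * (w - z) = (1 - k)%:C * z + k%:C * w by rewrite RCB; ring.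
rewrite (le_trans (cmD _ _))// !cmM !cmR (ger0_norm k0) ger0_norm ?subr_ge0//.
have -> : r = (1 - k) * r + k * r by ring.
by rewrite lerD// ler_wpM2l// subr_ge0.
Qed.

(** Summing the quadratic expansion over [n] equal steps along the segment
    leaves an error [O(1 / n)]. *)
Lemma mean_value f r r' (M : R) : r' < r -> holo_on r f ->
  (forall z, cm z <= r' -> cm (cderive f z) <= M) ->
  forall z w, cm z <= r' -> cm w <= r' -> cm (f w - f z) <= M * cm (w - z).
Proof.
move=> r'r hf fM z w zr wr.
have r'0 := le_trans (cm_ge0 z) zr.
have [K K0 KP] := taylor2 r'0 r'r hf.
have c0 := cm_ge0 (w - z); pose D := cm (w - z); rewrite -/D.
suff E n : cm (f w - f z) <= M * D + K * D ^+ 2 / n.+1%:R.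
  apply/ler_addgt0Pr => e e0.
  have A0 : 0 <= K * D ^+ 2 / e by rewrite divr_ge0 ?mulr_ge0 ?exprn_ge0 ?(ltW e0).
  pose n := Num.bound (K * D ^+ 2 / e).
  rewrite (le_trans (E n))// lerD2l ler_pdivrMr ?ltr0n//.
  have := archi_boundP A0; rewrite ltr_pdivrMr// => /ltW/le_trans; apply.
  by rewrite mulrC ler_pM2l// ler_nat.
pose x k := z + (k%:R / n.+1%:R)%:C * (w - z).
have N0 : 0 < n.+1%:R :> R by rewrite ltr0n.
have xr k : (k <= n.+1)%N -> cm (x k) <= r'.
  move=> kn; apply: cm_segment => //; rewrite divr_ge0//= ler_pdivrMr// mul1r ler_nat//.
have step k : (k < n.+1)%N -> cm (f (x k.+1) - f (x k)) <=
    M * (D / n.+1%:R) + K * (D / n.+1%:R) ^+ 2.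
  move=> kn; have E : x k.+1 - x k = (n.+1%:R^-1)%:C * (w - z).
    by rewrite /x -natr1 mulrDl RCD mul1r; ring.
  have CE : cm (x k.+1 - x k) = D / n.+1%:R.
    by rewrite E cmM cmR ger0_norm ?invr_ge0// mulrC.
  rewrite -CE -[f (x k.+1) - f (x k)](subrK (cderive f (x k) * (x k.+1 - x k))).
  rewrite (le_trans (cmD _ _))// addrC lerD//.
    by rewrite cmM ler_wpM2r ?cm_ge0// fM// xr// ltnW.
  by apply: KP; apply: xr => //; exact: ltnW.
have tot k : (k <= n.+1)%N -> cm (f (x k) - f z) <=
    k%:R * (M * (D / n.+1%:R) + K * (D / n.+1%:R) ^+ 2).
  elim: k => [|k IH] kn; first by rewrite /x !mul0r addr0 subrr cm0.
  rewrite (le_trans (cm_tri (f (x k)) _ _))// -natr1 mulrDl mul1r addrC.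
  by rewrite lerD// ?IH ?step// ltnW.
have := tot n.+1 (leqnn _).
have -> : x n.+1 = w by rewrite /x divff ?gt_eqF// mul1r addrC subrK.
move=> /le_trans; apply; rewrite le_eqVlt; apply/orP; left; apply/eqP.
by field; rewrite gt_eqF.
Qed.

End Consequences.

(** * Zeros, and functions of equal modulus on a circle *)

Section Zeros.
Variable R : realType.
Implicit Types (f g u v : R[i] -> R[i]) (r rho : R) (z w a : R[i]) (s : seq R[i]).

Definition holo f := forall z, cm z < 1 -> cdiff f z.

Lemma holo_holo_on f r : r < 1 -> holo f -> holo_on r f.
Proof. by move=> r1 hf z zr; apply: hf; exact: le_lt_trans r1. Qed.

Definition prod_sub s z := \prod_(a <- s) (z - a).

Lemma cdiff_prod_sub s z : cdiff (prod_sub s) z.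
Proof.
elim: s => [|a s IH].
  rewrite (_ : prod_sub [::] = fun=> 1); first exact: cdiff_cst.
  by apply/funext => w; rewrite /prod_sub big_nil.
rewrite (_ : prod_sub (a :: s) = fun w => (w - a) * prod_sub s w); last first.
  by apply/funext => w; rewrite /prod_sub big_cons.
apply: cdiffM; last exact: IH.
by apply: cdiffB; [exact: cdiff_id|exact: cdiff_cst].
Qed.

Lemma prod_sub_eq0 s z : (prod_sub s z == 0) = (z \in s).
Proof.
elim: s => [|a s IH]; first by rewrite /prod_sub big_nil oner_eq0.
by rewrite /prod_sub big_cons mulf_eq0 -/(prod_sub s z) IH subr_eq0 inE.
Qed.

(** The point [a] reflected in the circle of radius [rho], as a factor with the
    same modulus as [z - a] on that circle. *)
Definition refl_factor rho a z : R[i] := ((rho ^+ 2)%:C - a^* * z) / rho%:C.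

Lemma refl_factor_sqr rho a z : 0 < rho -> cm (refl_factor rho a z) ^+ 2 =
  cm (z - a) ^+ 2 + (rho ^+ 2 - cm a ^+ 2) * (rho ^+ 2 - cm z ^+ 2) / rho ^+ 2.
Proof.
move=> r0; rewrite /refl_factor cm_div exprMn exprVn cmR (gtr0_norm r0) !cm_sqr.
case: z => x y; case: a => b c /=.
by field; rewrite gt_eqF.
Qed.

Lemma refl_factor_circle rho a z : 0 < rho -> cm z = rho -> cm (refl_factor rho a z) = cm (z - a).
Proof.
move=> r0 zr; apply/eqP; rewrite -(@eqrXn2 _ 2) ?cm_ge0// refl_factor_sqr// zr subrr.
by rewrite mulr0 mul0r addr0.
Qed.

Lemma cdiff_refl_factor rho a z : cdiff (refl_factor rho a) z.
Proof.
apply: cdiffM; last exact: cdiff_cst.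
apply: cdiffB; first exact: cdiff_cst.
by apply: cdiffM; [exact: cdiff_cst|exact: cdiff_id].
Qed.

Lemma avoid s r : 0 < r -> exists2 z : R[i], cm z <= r & z \notin s.
Proof.
move=> r0; apply: contrapT => H.
pose x (k : nat) : R[i] := (r / k.+1%:R)%:C.
have xs k : x k \in s.
  apply: contrapT => /negP xk; apply: H; exists (x k) => //.
  rewrite cmR ger0_norm ?divr_ge0 ?(ltW r0)// ler_pdivrMr ?ltr0n//.
  by rewrite ler_peMr ?(ltW r0)// ler1n.
have ux : uniq [seq x k | k <- iota 0 (size s).+1].
  rewrite map_inj_uniq ?iota_uniq// => j k /complexI /(mulfI (lt0r_neq0 r0)).
  by move=> /invr_inj /eqP; rewrite eqr_nat => /eqP[].
have := @uniq_leq_size _ _ s ux.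
rewrite size_map size_iota ltnn => E; suff: false by [].
by apply: E => _ /mapP[k _ ->].
Qed.

(** Dividing out zeros one by one must stop: after [n] steps, comparison with
    the reflected factors on a larger circle and the maximum principle give
    [|f z1| ^ 2 <= M ^ 2 * k ^ n] with [k < 1]. *)
Lemma zero_factor f r z1 : holo f -> r < 1 -> cm z1 < 1 -> f z1 != 0 ->
  exists s f1, [/\ holo f1, forall z, cm z < 1 -> f z = prod_sub s z * f1 z &
    forall z, cm z <= r -> f1 z != 0].
Proof.
move=> hf r1 z11 fz1; apply: contrapT => H.
pose r' := Num.max r (cm z1).
have r'1 : r' < 1 by rewrite gt_max r1.
have z1r : cm z1 <= r' by rewrite le_max lexx orbT.
have r'0 : 0 <= r' by rewrite (le_trans (cm_ge0 z1)).
pose rho := (1 + r') / 2.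
have [rho0 r'rho rho1] : [/\ 0 < rho, r' < rho & rho < 1] by split; rewrite /rho; lra.
have fac n : exists s f1, [/\ size s = n, forall a, a \in s -> cm a <= r', holo f1 &
    forall z, cm z < 1 -> f z = prod_sub s z * f1 z].
  elim: n => [|n [s [f1 [sn sr hf1 fE]]]].
    by exists [::], f; split => // z _; rewrite /prod_sub big_nil mul1r.
  have [a ar fa] : exists2 a, cm a <= r' & f1 a = 0.
    apply: contrapT => Ha; apply: H; exists s, f1; split=> // z zr.
    apply/negP => /eqP f1z; apply: Ha; exists z => //.
    by rewrite (le_trans zr)// le_max lexx.
  have [q [qE qd]] := quotient_hol (le_lt_trans ar r'rho) (holo_holo_on rho1 hf1).
  exists (a :: s), q; split => //=.
  - by rewrite sn.
  - by move=> b; rewrite inE => /predU1P[->//|/sr].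
  - by move=> z z1_; apply: qd; exact: hf1.
  - move=> z zz; rewrite fE// /prod_sub big_cons -/(prod_sub s z).
    have := qE z; rewrite fa subr0 => ->.
    by ring.
have [M MP] : exists M, forall t, 0 <= t <= 2 * pi -> cm (f (rho%:C * expi t)) <= M.
  have [|M MP] := @disc_bounded R f rho.
    by move=> z /(holo_holo_on rho1 hf) /cdiff_cont.
  by exists M => t; apply: MP; rewrite ger0_norm// ltW.
pose d := (rho ^+ 2 - r' ^+ 2) ^+ 2 / rho ^+ 2.
have rr : 0 < rho ^+ 2 - r' ^+ 2.
  by rewrite subr_gt0 ltrXn2r ?nnegrE// ltW.
have d0 : 0 < d by rewrite divr_gt0 ?exprn_gt0.
have d1 : d <= 1.
  rewrite /d ler_pdivrMr ?exprn_gt0// mul1r lerXn2r ?nnegrE ?(ltW rr) ?(ltW rho0)//.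
  rewrite (le_trans (y := rho ^+ 2))// ?gerBl ?sqr_ge0//.
  by rewrite expr2 ler_piMl// ltW.
pose k := 1 - d / 4.
have k0 : 0 <= k by rewrite /k; lra.
have fact a : cm a <= r' -> cm (z1 - a) ^+ 2 <= k * cm (refl_factor rho a z1) ^+ 2.
  move=> ar; have E := refl_factor_sqr a z1 rho0.
  have d_le : d <= (rho ^+ 2 - cm a ^+ 2) * (rho ^+ 2 - cm z1 ^+ 2) / rho ^+ 2.
    rewrite ler_pM2r ?invr_gt0 ?exprn_gt0// expr2.
    by apply: ler_pM; rewrite ?(ltW rr)// lerD2l lerN2 lerXn2r ?nnegrE ?cm_ge0.
  have B2 : cm (refl_factor rho a z1) ^+ 2 <= 4.
    have -> : 4 = 2 ^+ 2 :> R by rewrite -natrX.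
    rewrite lerXn2r ?nnegrE ?cm_ge0// /refl_factor cm_div cmR (gtr0_norm rho0).
    rewrite ler_pdivrMr// (le_trans (cmB _ _))// cmM cmJ cmR ger0_norm ?sqr_ge0//.
    have h : cm a * cm z1 <= rho * rho.
      by apply: ler_pM; rewrite ?cm_ge0// (le_trans _ (ltW r'rho)).
    have h2 : rho * rho <= rho by rewrite ler_piMl// ltW.
    by rewrite expr2; lra.
  rewrite /k mulrBl mul1r; have := ltW d0; nra.
have bound n : cm (f z1) ^+ 2 <= M ^+ 2 * k ^+ n.
  have [s [f1 [sn sr hf1 fE]]] := fac n.
  pose g z := \prod_(a <- s) refl_factor rho a z * f1 z.
  have hg : holo_on rho g.
    move=> z zr; apply: cdiffM; last exact: (holo_holo_on rho1 hf1).
    elim: (s) => [|a s' IH].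
      rewrite (_ : (fun _ => _) = fun=> 1); first exact: cdiff_cst.
      by apply/funext => w; rewrite big_nil.
    rewrite (_ : (fun _ => _) = fun w => refl_factor rho a w * \prod_(b <- s') refl_factor rho b w).
      by apply: cdiffM; [exact: cdiff_refl_factor|exact: IH].
    by apply/funext => w; rewrite big_cons.
  have gM : cm (g z1) <= M.
    apply: (max_circle hg) => [t th|]; last exact: le_lt_trans r'rho.
    have E : cm (rho%:C * expi t) = rho by rewrite cm_pol// ltW.
    rewrite (le_trans _ (MP t th))// fE ?E// /g /prod_sub !cmM ler_wpM2r ?cm_ge0//.
    rewrite le_eqVlt; apply/orP; left; apply/eqP.
    elim: (s) => [|a s' IH]; first by rewrite !big_nil.
    by rewrite !big_cons cmM [RHS]cmM IH (refl_factor_circle _ rho0 E).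
  have pk : cm (prod_sub s z1) ^+ 2 <= k ^+ n * cm (\prod_(a <- s) refl_factor rho a z1) ^+ 2.
    rewrite -sn; elim: (s) (sr) => [|a s' IH] sr'.
      by rewrite /prod_sub !big_nil cm1 expr1n mulr1.
    have ha : cm a <= r' by apply: sr'; rewrite mem_head.
    have hs : forall b, b \in s' -> cm b <= r'.
      by move=> b bs; apply: sr'; rewrite inE bs orbT.
    have := ler_pM (exprn_ge0 2 (cm_ge0 _)) (exprn_ge0 2 (cm_ge0 _)) (fact a ha) (IH hs).
    rewrite /prod_sub !big_cons (cmM (z1 - a)) (cmM (refl_factor rho a z1)).
    move: (cm _) (cm _) (cm _) (cm _) => x1 x2 x3 x4 h.
    rewrite [size _]/= [k ^+ _.+1]exprS.
    have -> : (x4 * x3) ^+ 2 = x4 ^+ 2 * x3 ^+ 2 by ring.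
    by rewrite (le_trans h)// le_eqVlt; apply/orP; left; apply/eqP; ring.
  rewrite fE// cmM exprMn [M ^+ 2 * _]mulrC.
  rewrite (le_trans (ler_wpM2r _ pk)) ?exprn_ge0 ?cm_ge0// -mulrA ler_wpM2l ?exprn_ge0//.
  rewrite -exprMn -cmM lerXn2r ?nnegrE ?cm_ge0//.
  by rewrite (le_trans (cm_ge0 (g z1))).
have F0 : 0 < cm (f z1) ^+ 2 by rewrite exprn_gt0// cm_gt0.
have : 1 <= k.
  apply: (@le_of_powers _ _ _ (M ^+ 2 / cm (f z1) ^+ 2)) => // n.
  by rewrite expr1n mulrAC ler_pdivlMr// mul1r.
by rewrite /k; lra.
Qed.

(** On a small disc both functions have finitely many zeros, so a point avoids
    them all. *)
Lemma mul_eq0_holo u v z1 : holo u -> holo v -> cm z1 < 1 -> v z1 != 0 ->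
  (forall z, cm z < 1 -> u z * v z = 0) -> forall z, cm z < 1 -> u z = 0.
Proof.
move=> hu hv z11 vz1 uv z zz; apply/eqP; apply/negPn/negP => uz.
have h1 : 2^-1 < 1 :> R by lra.
have [s [u1 [_ uE u1N]]] := zero_factor hu h1 zz uz.
have [s' [v1 [_ vE v1N]]] := zero_factor hv h1 z11 vz1.
have [|w wr] := @avoid (s ++ s') 2^-1; first by lra.
have w1 := le_lt_trans wr h1.
rewrite mem_cat negb_or -!prod_sub_eq0 => /andP[ws ws'].
have /eqP := uv w w1; rewrite uE// vE// !mulf_eq0.
by rewrite (negbTE ws) (negbTE ws') (negbTE (u1N w wr)) (negbTE (v1N w wr)).
Qed.

Lemma identity_holo u r : holo u -> 0 < r -> (forall z, cm z <= r -> u z = 0) ->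
  forall z, cm z < 1 -> u z = 0.
Proof.
move=> hu r0 u0 z zz; apply/eqP; apply/negPn/negP => uz.
pose r' := Num.min r 2^-1.
have r'1 : r' < 1 by rewrite gt_min; apply/orP; right; lra.
have r'0 : 0 < r' by rewrite lt_min r0/=; lra.
have [s [u1 [_ uE u1N]]] := zero_factor hu r'1 zz uz.
have [w wr ws] := @avoid s r' r'0.
have := uE w (le_lt_trans wr r'1); rewrite u0; last first.
  by rewrite (le_trans wr)// ge_min lexx.
by apply/eqP; rewrite eq_sym mulf_neq0 ?prod_sub_eq0 ?u1N.
Qed.

(** If the derivative [l] at [w] were nonzero, a small step in the direction
    [F w * l^*] would make the modulus exceed 1. *)
Lemma unimodular_const F rho : holo_on rho F -> (forall z, cm z <= rho -> cm (F z) = 1) ->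
  forall z, cm z < rho -> F z = F 0.
Proof.
move=> hF F1 z zr.
have dF w : cm w < rho -> cderive F w = 0.
  move=> wr; apply: contrapT => /eqP l0.
  have := cderiveP (hF _ (ltW wr)); set l := cderive F w in l0 *.
  have cl : 0 < cm l by rewrite cm_gt0.
  have e0 : 0 < cm l / 2 by rewrite divr_gt0.
  move=> /(_ _ e0)[d d0 H].
  pose m := Num.min d (rho - cm w).
  have m0 : 0 < m by rewrite lt_min d0 subr_gt0.
  pose t := m / (2 * cm l); have t0 : 0 < t by rewrite divr_gt0// mulr_gt0.
  pose h := t%:C * F w * l^*.
  have ch : cm h = m / 2.
    rewrite /h !cmM cmJ F1 ?(ltW wr)// cmR gtr0_norm// mulr1 /t.
    by field; rewrite gt_eqF.
  have hm : cm h < m by rewrite ch; lra.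
  have [hd hr] : cm h < d /\ cm h < rho - cm w by move: hm; rewrite lt_min => /andP.
  have wh : w + h - w = h by rewrite addrAC subrr add0r.
  have := H (w + h); rewrite wh => /(_ hd) E.
  have whr : cm (w + h) <= rho by rewrite (le_trans (cmD _ _))//; lra.
  have : cm (F w + l * h) <= 1 + cm l / 2 * cm h.
    have -> : F w + l * h = F (w + h) - (F (w + h) - F w - l * h) by ring.
    by rewrite (le_trans (cmB _ _))// F1// lerD2l.
  have -> : F w + l * h = (1 + t * cm l ^+ 2)%:C * F w.
    by rewrite RCD RCM -mulcJE /h; ring.
  rewrite cmM F1 ?(ltW wr)// mulr1 cmR ger0_norm; last first.
    by rewrite addr_ge0// mulr_ge0 ?exprn_ge0 ?cm_ge0// ltW.
  rewrite lerD2l ch; have -> : t * cm l ^+ 2 = cm l * m / 2.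
    by rewrite /t; field; rewrite gt_eqF.
  have := mulr_gt0 cl m0; lra.
have r0 := le_lt_trans (cm_ge0 z) zr.
have := mean_value zr hF (M := 0) _ (z := 0) (w := z).
rewrite mul0r cm0 cm_ge0 lexx => E; apply/eqP; rewrite -subr_eq0 -cm_eq0.
apply/eqP/le_anti; rewrite cm_ge0 andbT; apply: E => // w wz.
by rewrite dF ?cm0// (le_lt_trans wz).
Qed.

(** A point of the circle is a limit of other points of the circle. *)
Lemma circle_ext f g rho a :
  {for (a : R[i]^o), continuous (f : R[i]^o -> R[i]^o)} ->
  {for (a : R[i]^o), continuous (g : R[i]^o -> R[i]^o)} ->
  0 < rho -> cm a = rho ->
  (forall z, cm z = rho -> z != a -> cm (f z) = cm (g z)) -> cm (f a) = cm (g a).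
Proof.
move=> /ccontP cf /ccontP cg r0 ar fg.
apply/eqP; rewrite -subr_eq0 -normr_eq0; apply/eqP/le_anti.
rewrite normr_ge0 andbT; apply/ler_addgt0Pr => e e0; rewrite add0r.
have e20 : 0 < e / 2 by rewrite divr_gt0.
have [d d0 dH] := cf _ e20; have [d' d'0 d'H] := cg _ e20.
pose m := Num.min d d'; have m0 : 0 < m by rewrite lt_min d0.
pose t := Num.min (m / (4 * rho)) (pi / 2).
have t0 : 0 < t by rewrite lt_min !divr_gt0 ?mulr_gt0 ?pi_gt0.
have wa : cm (a * expi t - a) < m.
  have -> : a * expi t - a = a * (expi t - expi 0) by rewrite expi0; ring.
  rewrite cmM ar (le_lt_trans (ler_wpM2l (ltW r0) (expi_lip 0 t)))// subr0 gtr0_norm//.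
  have : t <= m / (4 * rho) by rewrite ge_min lexx.
  rewrite ler_pdivlMr ?mulr_gt0//; lra.
have wN : a * expi t != a.
  rewrite -subr_eq0 (_ : _ - a = a * (expi t - 1)); last by ring.
  rewrite mulf_neq0//; first by rewrite -cm_gt0 ar.
  rewrite subr_eq0 eq_complex /= negb_and; apply/orP; right.
  rewrite gt_eqF// sin_gt0_pi// t0/=.
  have p0 := pi_gt0 R; have : t <= pi / 2 by rewrite ge_min lexx orbT.
  by lra.
have E := fg (a * expi t); rewrite cmM cm_expi mulr1 in E; have {}E := E ar wN.
move: wa; rewrite lt_min => /andP[/dH A /d'H B].
have := cm_sub (f (a * expi t)) (f a); have := cm_sub (g (a * expi t)) (g a).
have := cm_sub (f a) (f (a * expi t)); have := cm_sub (g a) (g (a * expi t)).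
rewrite [cm (g a - _)]cmBC [cm (f a - _)]cmBC ler_norml => *; apply/andP; split; lra.
Qed.

Lemma cdiff_horner (p : {poly R[i]}) z : cdiff (horner p) z.
Proof.
elim/poly_ind: p => [|p c IH].
  rewrite (_ : horner 0 = fun=> 0); first exact: cdiff_cst.
  by apply/funext => w; rewrite horner0.
rewrite (_ : horner _ = fun w => p.[w] * w + c); last first.
  by apply/funext => w; rewrite hornerMXaddC.
apply: cdiffD; last exact: cdiff_cst.
by apply: cdiffM; [exact: IH|exact: cdiff_id].
Qed.

Section Pair.
Variable rho : R.
Hypothesis rho0 : 0 < rho.

(** The hypothesis and the conclusion of an induction on the number of zeros of
    [f = prod_sub s1 * f1] and [g = prod_sub s2 * g1], where the zero-free [f1]
    and [g1] absorb the zeros one at a time. *)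
Definition balanced s1 f1 s2 g1 := [/\ holo_on rho f1, holo_on rho g1,
  forall z, cm z <= rho -> f1 z != 0, forall z, cm z <= rho -> g1 z != 0 &
  forall z, cm z = rho -> cm (prod_sub s1 z * f1 z) = cm (prod_sub s2 z * g1 z)].

Definition proportional s1 f1 s2 g1 := exists A B : {poly R[i]},
  [/\ A != 0, B != 0, forall z, cm z = rho -> cm A.[z] = cm B.[z] &
   forall z, cm z < rho -> prod_sub s1 z * f1 z * A.[z] = prod_sub s2 z * g1 z * B.[z]].

Lemma balanced_sym s1 f1 s2 g1 : balanced s1 f1 s2 g1 -> balanced s2 g1 s1 f1.
Proof. by move=> [h1 h2 h3 h4 h5]; split => // z /h5. Qed.

Lemma proportional_sym s1 f1 s2 g1 :
  proportional s1 f1 s2 g1 -> proportional s2 g1 s1 f1.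
Proof.
move=> [A [B [A0 B0 AB E]]]; exists B, A; split => // [z /AB|z /E] //.
Qed.

(** The maximum principle for [f1 / g1] and for its inverse shows that the
    quotient is unimodular on the whole disc, hence constant. *)
Lemma pair_nil f1 g1 : balanced [::] f1 [::] g1 -> proportional [::] f1 [::] g1.
Proof.
move=> [hf hg f0 g0 fg].
have fg' z : cm z = rho -> cm (f1 z) = cm (g1 z).
  by move=> /fg; rewrite /prod_sub !big_nil !mul1r.
have quo f g : holo_on rho f -> holo_on rho g -> (forall z, cm z <= rho -> g z != 0) ->
    (forall z, cm z = rho -> cm (f z) = cm (g z)) ->
    holo_on rho (fun z => f z / g z) /\ (forall z, cm z <= rho -> cm (f z / g z) <= 1).
  move=> hf' hg' g0' E; have hq : holo_on rho (fun z => f z / g z).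
    move=> z zr; apply: cdiffM; first exact: hf'.
    by apply: cdiffV; [exact: g0'|exact: hg'].
  split => // z zr; apply: (max_principle hq) zr => w wr.
  by rewrite cm_div E// divff// cm_eq0 g0'// wr.
have [hq q1] := quo _ _ hf hg g0 fg'.
have [_ q1'] := quo _ _ hg hf f0 (fun z h => esym (fg' z h)).
have qu z : cm z <= rho -> cm (f1 z / g1 z) = 1.
  move=> zr; apply/le_anti; rewrite q1//=.
  have := q1' z zr; rewrite !cm_div !ler_pdivrMr ?ler_pdivlMr ?cm_gt0 ?f0 ?g0//.
  by rewrite !mul1r.
have C := unimodular_const hq qu.
pose c := f1 0 / g1 0.
have c1 : cm c = 1 by apply: qu; rewrite cm0 ltW.
have c0 : c != 0 by rewrite -cm_eq0 c1 oner_eq0.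
exists 1, c%:P; split.
- exact: oner_neq0.
- by rewrite polyC_eq0.
- by move=> z _; rewrite (hornerC c z) (hornerC 1 z) c1 cm1.
- move=> z zr; rewrite (hornerC c z) (hornerC 1 z) /prod_sub !big_nil !mul1r mulr1.
  by rewrite /c -(C z zr) mulrC divfK// g0// ltW.
Qed.

(** Each zero is moved to the nonvanishing factor: directly if it lies outside
    the circle, through its reflection if inside; a zero on the circle is shared
    by both sides and cancels. *)
Lemma pair_cons n a s f1 s2 g1 :
  (forall s1 f1 s2 g1, (size s1 + size s2 <= n)%N ->
     balanced s1 f1 s2 g1 -> proportional s1 f1 s2 g1) ->
  (size (a :: s) + size s2 <= n.+1)%N ->
  balanced (a :: s) f1 s2 g1 -> proportional (a :: s) f1 s2 g1.
Proof.
move=> IH; rewrite /= addSn ltnS => sn [hf hg f0 g0 fg].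
have pE z : prod_sub (a :: s) z = (z - a) * prod_sub s z by rewrite /prod_sub big_cons.
have hza z : cdiff (fun z => z - a) z.
  by apply: cdiffB; [exact: cdiff_id|exact: cdiff_cst].
have [ar|ar|ar] := ltgtP (cm a) rho.
- have [|A [B [A0 B0 AB E]]] := IH s (fun z => refl_factor rho a z * f1 z) s2 g1 sn.
    split => // [z zr|z zr|z zr].
    + by apply: cdiffM; [exact: cdiff_refl_factor|exact: hf].
    + rewrite mulf_neq0 ?f0// -cm_eq0 -sqrf_eq0 refl_factor_sqr//.
      apply: lt0r_neq0; have h1 : 0 <= rho ^+ 2 - cm z ^+ 2.
        by rewrite subr_ge0 lerXn2r ?nnegrE ?cm_ge0// ltW.
      have h2 : 0 < rho ^+ 2 - cm a ^+ 2.
        by rewrite subr_gt0 ltrXn2r ?nnegrE ?cm_ge0// ltW.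
      have [za|za] := eqVneq z a.
        rewrite za subrr cm0 expr0n add0r divr_gt0 ?exprn_gt0// mulr_gt0//.
      rewrite ltr_pwDl// ?exprn_gt0 ?cm_gt0 ?subr_eq0//.
      by rewrite divr_ge0 ?exprn_ge0 ?(ltW rho0)// mulr_ge0// ltW.
    + by rewrite -fg// pE cmM (cmM (refl_factor _ _ _)) refl_factor_circle// -!cmM; congr cm; ring.
  exists (((rho ^+ 2)%:C%:P - (a^*)%:P * 'X) * (rho%:C^-1)%:P * A), (('X - a%:P) * B).
  have PE z : ((((rho ^+ 2)%:C%:P - (a^*)%:P * 'X) * (rho%:C^-1)%:P).[z]) = refl_factor rho a z.
    by rewrite !hornerE.
  have r0 : rho%:C != 0 :> R[i] by rewrite RCeq0 gt_eqF.
  split.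
  + rewrite !mulf_neq0// ?polyC_eq0 ?invr_eq0//.
    apply/eqP => /(congr1 (horner^~ 0)); rewrite !hornerE /= ?mulr0 ?subr0.
    by apply/eqP; rewrite RCeq0 expf_neq0// gt_eqF.
  + by rewrite mulf_neq0// polyXsubC_eq0.
  + move=> z zr; rewrite hornerM PE hornerM cmM [RHS]cmM AB// refl_factor_circle//.
    by rewrite hornerXsubC.
  + move=> z zr; rewrite hornerM PE hornerM hornerXsubC pE.
    have := E z zr => E'.
    rewrite (_ : _ * _ * (refl_factor _ _ _ * _) = (z - a) * (prod_sub s z * (refl_factor rho a z * f1 z) * A.[z])).
      by rewrite E'; ring.
    by ring.
- have [|A [B [A0 B0 AB E]]] := IH s (fun z => (z - a) * f1 z) s2 g1 sn.
    split => // [z zr|z zr|z zr].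
    + by apply: cdiffM; [exact: hza|exact: hf].
    + rewrite mulf_neq0 ?f0// subr_eq0; apply: contraTneq ar => <-.
      by rewrite -leNgt.
    + by rewrite -fg// pE; congr cm; ring.
  exists A, B; split => // z zr; rewrite -E// pE; ring.
- have as2 : a \in s2.
    rewrite -prod_sub_eq0; have /eqP := fg a ar.
    rewrite pE subrr !mul0r cm0 eq_sym cm_eq0 mulf_eq0.
    by rewrite (negbTE (g0 a _)) ?ar// orbF.
  have p2E z : prod_sub s2 z = (z - a) * prod_sub (rem a s2) z.
    by rewrite /prod_sub (big_rem a as2).
  have [||A [B [A0 B0 AB E]]] := IH s f1 (rem a s2) g1.
    + by rewrite (leq_trans _ sn)// leq_add2l size_rem// leq_pred.
    + split => // z zr.
      have off w : cm w = rho -> w != a ->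
          cm (prod_sub s w * f1 w) = cm (prod_sub (rem a s2) w * g1 w).
        move=> wr wa; have := fg w wr; rewrite pE p2E -!mulrA !(cmM (w - a)).
        by move/mulfI; apply; rewrite cm_eq0 subr_eq0.
      have [->|za] := eqVneq z a; last exact: off.
      apply: (@circle_ext (fun w => prod_sub s w * f1 w) (fun w => prod_sub (rem a s2) w * g1 w) rho) => //.
        by apply: cdiff_cont; apply: cdiffM; [exact: cdiff_prod_sub|apply: hf; rewrite ar].
      by apply: cdiff_cont; apply: cdiffM; [exact: cdiff_prod_sub|apply: hg; rewrite ar].
  exists A, B; split => // z zr.
  by rewrite pE p2E -!mulrA; congr (_ * _); rewrite !mulrA E.
Qed.

Lemma balanced_proportional s1 f1 s2 g1 :
  balanced s1 f1 s2 g1 -> proportional s1 f1 s2 g1.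
Proof.
suff H n : forall s1 f1 s2 g1, (size s1 + size s2 <= n)%N ->
  balanced s1 f1 s2 g1 -> proportional s1 f1 s2 g1 by exact: (H _ _ _ _ _ (leqnn _)).
elim: n => [|n IH] {}s1 {}f1 {}s2 {}g1.
  by case: s1 => //; case: s2 => // _; exact: pair_nil.
case: s1 => [|a s1]; last exact: pair_cons.
case: s2 => [|a s2]; first by move=> _; exact: pair_nil.
rewrite addnC => sn /balanced_sym b; apply: proportional_sym.
exact: (pair_cons IH sn b).
Qed.

End Pair.

(** Inside the circle this is the induction on the zeros; the identity theorem
    carries it to the unit disc. *)
Lemma rational_quotient f g rho zf zg : 0 < rho -> rho < 1 -> holo f -> holo g ->
  cm zf < 1 -> f zf != 0 -> cm zg < 1 -> g zg != 0 ->
  (forall z, cm z = rho -> cm (f z) = cm (g z)) -> exists A B : {poly R[i]},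
  [/\ A != 0, B != 0, forall z, cm z = rho -> cm A.[z] = cm B.[z] &
   forall z, cm z < 1 -> f z * A.[z] = g z * B.[z]].
Proof.
move=> r0 r1 hf hg zf1 fzf zg1 gzg fg.
have [s1 [f1 [hf1 fE f1N]]] := zero_factor hf r1 zf1 fzf.
have [s2 [g1 [hg1 gE g1N]]] := zero_factor hg r1 zg1 gzg.
have [|A [B [A0 B0 AB E]]] := @balanced_proportional rho r0 s1 f1 s2 g1.
  split => //; [exact: holo_holo_on|exact: holo_holo_on|] => z zr.
  by rewrite -fE ?zr// -gE ?zr// fg.
exists A, B; split => // z zz; apply/eqP; rewrite -subr_eq0; apply/eqP.
apply: (@identity_holo (fun z => f z * A.[z] - g z * B.[z]) (rho / 2)) zz => //.
- move=> w w1; apply: cdiffB.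
    by apply: cdiffM; [exact: hf|exact: cdiff_horner].
  by apply: cdiffM; [exact: hg|exact: cdiff_horner].
- by rewrite divr_gt0.
- move=> w wr; have wr' : cm w < rho by lra.
  have w1 := lt_trans wr' r1.
  by rewrite fE// gE// E// subrr.
Qed.

End Zeros.

(** * Polynomials of equal modulus on two circles *)

Section Polynomials.
Variable R : realType.
Implicit Types (A B p : {poly R[i]}) (z w : R[i]) (s : seq R[i]) (r rho : R).

Lemma avoid_circle s r : 0 < r -> exists2 z : R[i], cm z = r & z \notin s.
Proof.
move=> r0; apply: contrapT => H.
pose x (k : nat) : R[i] := r%:C * expi k.+1%:R^-1.
have xs k : x k \in s.
  apply: contrapT => /negP xk; apply: H; exists (x k) => //.
  by rewrite cm_pol// ltW.
have ux : uniq [seq x k | k <- iota 0 (size s).+1].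
  rewrite map_inj_uniq ?iota_uniq// => j k /mulfI.
  rewrite RCeq0 gt_eqF// => /(_ isT) [cE _].
  have I n : (n.+1%:R^-1 : R) \in `[0, pi].
    rewrite in_itv/= invr_ge0 ler0n/= (le_trans (y := 1))//.
      by rewrite invf_le1// ler1n.
    have := pihalf_ge1 R; lra.
  by have /invr_inj/eqP := cos_inj (I j) (I k) cE; rewrite eqr_nat => /eqP[].
have := @uniq_leq_size _ _ s ux.
rewrite size_map size_iota ltnn => E; suff: false by [].
by apply: E => _ /mapP[k _ ->].
Qed.

Lemma poly_roots_fin p : p != 0 -> exists s, forall z, p.[z] = 0 -> z \in s.
Proof.
move=> p0; have [s pE] := closed_field_poly_normal p.
exists s => z /eqP; rewrite pE hornerZ mulf_eq0 lead_coef_eq0 (negbTE p0)/=.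
by rewrite -[_ == 0]/(root _ z) root_prod_XsubC.
Qed.

Lemma poly_eq0_circle p r : 0 < r -> (forall z, cm z = r -> p.[z] = 0) -> p = 0.
Proof.
move=> r0 H; apply/eqP/negPn/negP => /poly_roots_fin[s sP].
by have [z zr] := avoid_circle s r0; rewrite sP// H.
Qed.

Lemma poly_neq0_circle p r : 0 < r -> p != 0 -> exists2 z, cm z = r & p.[z] != 0.
Proof.
move=> r0 /poly_roots_fin[s sP]; have [z zr zs] := avoid_circle s r0.
by exists z => //; apply: contra zs => /eqP/sP.
Qed.

(** On the circle [|z| = r] this polynomial is [z ^+ N * (A.[z])^*], because
    there [z^* = r ^+ 2 / z]. *)
Definition conj_recip N r A : {poly R[i]} :=
  \sum_(j < N.+1) ((A`_j)^* * ((r ^+ 2) ^+ j)%:C) *: 'X^(N - j).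

Lemma horner_conj_recip N r A z : (conj_recip N r A).[z] =
  \sum_(j < N.+1) (A`_j)^* * ((r ^+ 2) ^+ j)%:C * z ^+ (N - j).
Proof.
rewrite /conj_recip horner_sum; apply: eq_bigr => j _.
by rewrite hornerZ hornerXn.
Qed.

Lemma conj_recip_circle N r A z : (size A <= N.+1)%N -> cm z = r ->
  (conj_recip N r A).[z] = z ^+ N * (A.[z])^*.
Proof.
move=> AN zr; rewrite horner_conj_recip (horner_coef_wide _ AN) rmorph_sum mulr_sumr.
apply: eq_bigr => j _; rewrite (rmorphM conjc) (rmorphXn conjc) /= -zr.
have jN : (j <= N)%N by rewrite -ltnS.
have -> : ((cm z ^+ 2) ^+ j)%:C = (z * z^*) ^+ j.
  by rewrite RCX; congr (_ ^+ _); exact/esym/mulcJE.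
have zN : z ^+ N = z ^+ (N - j) * z ^+ j by rewrite -exprD subnK.
by rewrite exprMn zN; ring.
Qed.

Lemma conj_recip_scale N r A z : (conj_recip N r A).[(r ^+ 2)%:C * z] =
  ((r ^+ 2) ^+ N)%:C * (conj_recip N 1 A).[z].
Proof.
rewrite !horner_conj_recip mulr_sumr; apply: eq_bigr => j _.
have jN : (j <= N)%N by rewrite -ltnS.
rewrite !expr1n [(_ * z) ^+ _]exprMn (_ : 1%:C = 1 :> R[i])//.
have -> : ((r ^+ 2) ^+ N)%:C = ((r ^+ 2) ^+ j)%:C * (r ^+ 2)%:C ^+ (N - j).
  by rewrite -RCX -RCM -exprD subnKC.
by ring.
Qed.

Lemma mul_conj_recip_circle N r A z : (size A <= N.+1)%N -> cm z = r ->
  (A * conj_recip N r A).[z] = z ^+ N * (cm A.[z] ^+ 2)%:C.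
Proof. by move=> AN zr; rewrite hornerM conj_recip_circle// -mulcJE; ring. Qed.

Lemma cancel_poly p1 p2 : p1 != 0 -> (forall z, p1.[z] * p2.[z] = 0) ->
  forall z, p2.[z] = 0.
Proof.
move=> p10 H z; have /eqP : p1 * p2 = 0.
  by apply: (@poly_eq0_circle _ 1) => // w _; rewrite hornerM H.
by rewrite mulf_eq0 (negbTE p10)/= => /eqP ->; rewrite horner0.
Qed.

Lemma horner_dil p (q : R[i]) z : (p \Po (q *: 'X)).[z] = p.[q * z].
Proof. by rewrite horner_comp hornerZ hornerX. Qed.

(** Reflection in the two circles shows that [A / B] is invariant under the
    dilation by [rho ^+ 2]; a rational function invariant under a contraction is
    constant. *)
Lemma two_circles A B N rho : A != 0 -> B != 0 ->
  (size A <= N.+1)%N -> (size B <= N.+1)%N -> 0 < rho -> rho < 1 ->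
  (forall z, cm z = rho -> cm A.[z] = cm B.[z]) ->
  A * conj_recip N 1 A = B * conj_recip N 1 B ->
  exists2 k : R[i], cm k = 1 & forall z, A.[z] = k * B.[z].
Proof.
move=> A0 B0 AN BN r0 r1 AB E1.
pose q := (rho ^+ 2)%:C : R[i].
have q0 : q != 0 by rewrite RCeq0 expf_neq0// gt_eqF.
have Er : A * conj_recip N rho A = B * conj_recip N rho B.
  apply/eqP; rewrite -subr_eq0; apply/eqP; apply: (@poly_eq0_circle _ rho) => // z zr.
  by rewrite hornerD hornerN !mul_conj_recip_circle// AB// subrr.
have rB : conj_recip N 1 B != 0.
  have [z z1 Bz] := poly_neq0_circle ltr01 B0.
  apply: contraNneq Bz => r0'; have := conj_recip_circle BN z1; rewrite r0' horner0.
  move/eqP; rewrite eq_sym mulf_eq0 expf_eq0 -(cm_eq0 z) z1 oner_eq0 andbF /=.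
  by rewrite conjc_eq0.
have dil1 z : A.[q * z] * B.[z] = A.[z] * B.[q * z].
  pose p2 := (A \Po (q *: 'X)) * B - A * (B \Po (q *: 'X)).
  have p2E w : p2.[w] = A.[q * w] * B.[w] - A.[w] * B.[q * w].
    by rewrite /p2 hornerD hornerN !hornerM !horner_dil.
  apply/eqP; rewrite -subr_eq0 -p2E; apply/eqP.
  apply: (cancel_poly rB) => w; rewrite p2E.
  have := congr1 (horner^~ (q * w)) Er; have := congr1 (horner^~ w) E1.
  rewrite !hornerM !conj_recip_scale -/q => h1 h2.
  have Q : ((rho ^+ 2) ^+ N)%:C != 0 :> R[i] by rewrite RCX expf_neq0.
  have {}h2 : A.[q * w] * (conj_recip N 1 A).[w] = B.[q * w] * (conj_recip N 1 B).[w].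
    by apply: (mulfI Q); rewrite !(mulrCA _ (_ .[q * w])) h2.
  have -> : (conj_recip N 1 B).[w] * (A.[q * w] * B.[w] - A.[w] * B.[q * w]) =
    A.[q * w] * (B.[w] * (conj_recip N 1 B).[w]) - A.[w] * (B.[q * w] * (conj_recip N 1 B).[w]).
    by ring.
  by rewrite -h1 -h2; ring.
have diln n z : A.[q ^+ n * z] * B.[z] = A.[z] * B.[q ^+ n * z].
  elim: n z => [|n IH] z; first by rewrite expr0 mul1r.
  have Bq : B \Po (q *: 'X) != 0 by rewrite comp_poly2_eq0// size_scale// size_polyX.
  pose p2 := (A \Po (q ^+ n.+1 *: 'X)) * B - A * (B \Po (q ^+ n.+1 *: 'X)).
  have p2E w : p2.[w] = A.[q ^+ n.+1 * w] * B.[w] - A.[w] * B.[q ^+ n.+1 * w].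
    by rewrite /p2 hornerD hornerN !hornerM !horner_dil.
  apply/eqP; rewrite -subr_eq0 -p2E; apply/eqP.
  apply: (cancel_poly Bq) => w; rewrite p2E horner_dil.
  have := IH (q * w); have := dil1 w; rewrite mulrA -exprSr => h1 h2.
  have -> : B.[q * w] * (A.[q ^+ n.+1 * w] * B.[w] - A.[w] * B.[q ^+ n.+1 * w]) =
    (A.[q ^+ n.+1 * w] * B.[q * w]) * B.[w] - (A.[w] * B.[q * w]) * B.[q ^+ n.+1 * w].
    by ring.
  by rewrite -h1 h2; ring.
have [z0 z0r Bz0] := poly_neq0_circle r0 B0.
have z00 : z0 != 0 by rewrite -cm_gt0 z0r.
pose k := A.[z0] / B.[z0].
exists k; first by rewrite /k cm_div AB// divff// cm_eq0.
pose p := B.[z0] *: (A \Po (z0 *: 'X)) - A.[z0] *: (B \Po (z0 *: 'X)).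
have pE w : p.[w] = B.[z0] * A.[z0 * w] - A.[z0] * B.[z0 * w].
  by rewrite /p hornerD hornerN !hornerZ !horner_dil.
have p0 : p = 0.
  apply/eqP/negPn/negP => /poly_roots_fin[s sP].
  have qs n : q ^+ n \in s.
    apply: sP; rewrite pE [z0 * _]mulrC; have := diln n z0 => h.
    by rewrite [B.[z0] * _]mulrC h subrr.
  have ux : uniq [seq q ^+ n | n <- iota 0 (size s).+1].
    rewrite map_inj_uniq ?iota_uniq// => j l.
    rewrite /q -!RCX => /complexI.
    have h : 0 < rho ^+ 2 < 1.
      by rewrite exprn_gt0// expr2 mulr_ilt1 ?(ltW r0).
    case/andP: h => h0 h1.
    wlog jl : j l / (j < l)%N.
      move=> W jlE; have [jl|lj|//] := ltngtP j l; first exact: W.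
      by apply/esym; apply: W.
    move=> /eqP; rewrite gt_eqF// -(subnK jl) addnS exprS exprD mulrCA mulrA.
    by rewrite gtr_pMl ?exprn_gt0// -exprSr exprn_ilt1// ltW.
  have := @uniq_leq_size _ _ s ux.
  rewrite size_map size_iota ltnn => E; suff: false by [].
  by apply: E => _ /mapP[n _ ->].
move=> z; have := pE (z / z0); rewrite p0 horner0.
rewrite (_ : z0 * (z / z0) = z); last by field.
move/eqP; rewrite eq_sym subr_eq0 => /eqP h.
by apply: (mulfI Bz0); rewrite h /k; field.
Qed.

End Polynomials.

(** * Almost everywhere differentiability of Lipschitz functions *)

Section AlmostEverywhere.
Variable R : realType.
Local Notation leb := (@lebesgue_measure R).

Lemma ae_mono (P Q : R -> Prop) : (forall x, P x -> Q x) ->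
  {ae leb, forall x, P x} -> {ae leb, forall x, Q x}.
Proof.
by move=> PQ; apply: filterS => //; exact: (ae_filter_ringOfSetsType leb).
Qed.

Lemma ae_and (P Q : R -> Prop) :
  {ae leb, forall x, P x} -> {ae leb, forall x, Q x} ->
  {ae leb, forall x, P x /\ Q x}.
Proof. by apply: filterI; exact: (ae_filter_ringOfSetsType leb). Qed.

End AlmostEverywhere.

Section LipschitzDifferentiable.
Variable R : realType.
Implicit Types (t x : R).

Local Notation leb := (@lebesgue_measure R).

Variables (h : R -> R) (L a b : R).
Hypotheses (ab : a < b) (L0 : 0 <= L).
Hypothesis lip : forall x y, `|h x - h y| <= L * `|x - y|.

(* [h] plus a steep linear function increases; extended by constants outside the
   segment and rescaled by [W], it is a distribution function [G]. *)
Let clamp t := Num.min (Num.max t a) b.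
Let W := (h b + (L + 1) * b) - (h a + (L + 1) * a).
Let G t := (h (clamp t) + (L + 1) * clamp t - (h a + (L + 1) * a)) / W.

Let clamp_nd x y : x <= y -> clamp x <= clamp y.
Proof.
move=> xy; rewrite /clamp.
case: (lerP x a) => ?; case: (lerP y a) => ?; case: (lerP x b) => ?;
  case: (lerP y b) => ?; case: (lerP a b) => ?; lra.
Qed.

Let clamp_lip x y : x <= y -> clamp y - clamp x <= y - x.
Proof.
move=> xy; rewrite /clamp.
case: (lerP x a) => ?; case: (lerP y a) => ?; case: (lerP x b) => ?;
  case: (lerP y b) => ?; case: (lerP a b) => ?; lra.
Qed.

Let clampE t : a <= t <= b -> clamp t = t.
Proof. by move=> /andP[ta tb]; rewrite /clamp max_l// min_l. Qed.

Let lip_le x y : x <= y -> - (L * (y - x)) <= h y - h x <= L * (y - x).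
Proof. by move=> xy; rewrite -ler_norml -[y - x]ger0_norm ?subr_ge0. Qed.

Let W0 : 0 < W.
Proof. have -> : W = (h b - h a + L * (b - a)) + (b - a) by rewrite /W; ring.
have /andP[H _] := lip_le (ltW ab).
by rewrite ltr_wpDl ?subr_gt0// -lerBlDr sub0r. Qed.

Let K := (2 * L + 1) / W.
Let K0 : 0 <= K.
Proof. by rewrite divr_ge0 ?(ltW W0)// addr_ge0// mulr_ge0. Qed.

Let G_nd x y : x <= y -> G x <= G y.
Proof.
move=> xy; rewrite /G ler_pM2r ?invr_gt0// lerD2r.
have /andP[H _] := lip_le (clamp_nd xy); rewrite -subr_ge0.
have -> : h (clamp y) + (L + 1) * clamp y - (h (clamp x) + (L + 1) * clamp x) =
  (h (clamp y) - h (clamp x) + L * (clamp y - clamp x)) + (clamp y - clamp x) by ring.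
by rewrite addr_ge0 ?subr_ge0 ?clamp_nd// -lerBlDr sub0r.
Qed.

Let G_lip x y : x <= y -> G y - G x <= K * (y - x).
Proof.
move=> xy; have -> : G y - G x = ((h (clamp y) - h (clamp x)) +
    (L + 1) * (clamp y - clamp x)) / W by rewrite /G; field; rewrite gt_eqF.
rewrite /K mulrAC ler_pM2r ?invr_gt0//.
have /andP[_ H] := lip_le (clamp_nd xy).
have H2 : (2 * L + 1) * (clamp y - clamp x) <= (2 * L + 1) * (y - x).
  by rewrite ler_wpM2l ?clamp_lip// addr_ge0// mulr_ge0.
apply: le_trans H2; have -> : (2 * L + 1) * (clamp y - clamp x) =
  L * (clamp y - clamp x) + (L + 1) * (clamp y - clamp x) by ring.
by rewrite lerD2r.
Qed.

Let G_cont : continuous G.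
Proof.
move=> x; apply/cvgrPdist_le => e e0; near=> y.
have d : `|x - y| <= e / (K + 1).
  by near: y; apply: cvgr_dist_le; [exact: cvg_id|rewrite divr_gt0// ltr_wpDl].
have K1 : 0 < K + 1 by rewrite ltr_wpDl.
move: d; rewrite ler_pdivlMr// => d.
have [xy|/ltW yx] := leP x y.
  rewrite distrC ger0_norm ?subr_ge0 ?G_nd// (le_trans (G_lip xy))//.
  move: d; rewrite distrC ger0_norm ?subr_ge0// => d.
  have := mulr_ge0 K0 K0; nra.
rewrite ger0_norm ?subr_ge0 ?G_nd// (le_trans (G_lip yx))//.
move: d; rewrite ger0_norm ?subr_ge0// => d.
nra.
Unshelve. all: by end_near. Qed.

Let G_rc : forall x, G @ at_right x --> G x.
Proof. exact: right_continuousW. Qed.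

Let G_le t : t <= a -> G t = 0.
Proof.
move=> ta; rewrite /G (_ : clamp t = a) ?subrr ?mul0r//.
by rewrite /clamp max_r// min_l// ltW.
Qed.

Let G_ge t : b <= t -> G t = 1.
Proof.
move=> tb; rewrite /G (_ : clamp t = b) ?divff ?gt_eqF//.
by rewrite /clamp min_r// le_max tb.
Qed.

Let GNy : G @ -oo --> (0 : R).
Proof.
by apply: cvg_near_cst; near=> t; apply: G_le; near: t; apply: nbhs_ninfty_le; rewrite num_real.
Unshelve. all: by end_near. Qed.

Let Gy : G @ +oo --> (1 : R).
Proof.
by apply: cvg_near_cst; near=> t; apply: G_ge; near: t; apply: nbhs_pinfty_ge; rewrite num_real.
Unshelve. all: by end_near. Qed.

HB.instance Definition _ := isCumulative.Build R _ R G G_nd G_rc.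
HB.instance Definition _ := isCumulativeBounded.Build R 0 1 G GNy Gy.

Let nu := lebesgue_stieltjes_measure (G : cumulativeBounded 0 1).

Let nu_itv x y : x <= y -> nu `]x, y]%classic = (G y - G x)%:E.
Proof.
move=> xy; rewrite /nu /lebesgue_stieltjes_measure /measure_extension.
rewrite measurable_mu_extE/=; last exact: is_ocitv.
by rewrite wlength_itv_bnd// EFinB.
Qed.

Let G_dom (A : set R) : ocitv A -> (wlength G A <= K%:E * wlength idfun A)%E.
Proof.
move=> /ocitvP[->|[[x y] /= xy ->]]; first by rewrite !wlength0 mule0.
by rewrite !wlength_itv_bnd ?(ltW xy)// -EFinM lee_fin G_lip// ltW.
Qed.

Let nu_dom : nu `<< leb.
Proof.
apply/null_content_dominatesP => A mA A0.
apply/eqP; rewrite eq_le measure_ge0 andbT.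
apply/lee_addgt0Pr => e e0; rewrite add0e.
have K1 : 0 < K + 1 by rewrite ltr_wpDl.
have : (leb A < (e / (K + 1))%:E)%E by rewrite A0 lte_fin divr_gt0.
move=> /ereal_inf_lt[_ [F [mF AF] <-]] Fe.
have nuF : (nu A <= \sum_(k <oo) wlength G (F k))%E.
  by apply: ereal_inf_lbound; exists F.
apply: (le_trans nuF).
apply: (@le_trans _ _ (\sum_(k <oo) K%:E * wlength idfun (F k))%E).
  apply: lee_nneseries => [k _ _|k _]; first exact: wlength_ge0.
  exact/G_dom/mF.
rewrite nneseriesZl//.
apply: (@le_trans _ _ (K%:E * (e / (K + 1))%:E)%E).
  by apply: lee_wpmul2l; [rewrite lee_fin|exact: ltW].
by rewrite -EFinM lee_fin mulrCA ler_piMr ?(ltW e0)// ler_pdivrMr// mul1r lerDl.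
Qed.

(** Up to a linear function and a scale, [h] is the distribution function of a
    measure dominated by a multiple of Lebesgue measure. By Radon-Nikodym it is
    the integral of a density, and so it is differentiable at the Lebesgue points
    of the density. *)
Lemma lipschitz_derivable : {ae leb, forall t, a < t < b -> derivable h t 1}.
Proof.
have [d [_ dfin dint dE]] :=
  @radon_nikodym_sigma_finite _ _ _ leb (nu : {finite_measure set _ -> \bar R}) nu_dom.
pose f t := fine (d t).
have fE t : (f t)%:E = d t by rewrite /f fineK.
have fi : leb.-integrable setT (EFin \o f).
  by rewrite (_ : EFin \o f = d)//; apply/funext => t; exact: fE.
have fS (A : set R) : measurable A -> leb.-integrable A (EFin \o f).
  by move=> mA; apply: integrableS fi.
have := @FTC1 R f (BRight a) (fun y => fS _ (measurable_itv _))
  (open_integrable_locally openT fi).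
apply: ae_mono => t H /andP[at_ tb].
have [|dF _] := H; first by [].
set F := (fun x => _) in dF.
have FE x : a <= x -> F x = G x.
  move=> ax; rewrite /F /Rintegral.
  have -> : (\int[leb]_(t in `]a, x]) (f t)%:E)%E = nu `]a, x]%classic.
    rewrite [RHS]dE//.
    by apply: eq_integral => y _; rewrite fE.
  by rewrite nu_itv//= (G_le (lexx a)) subr0.
pose g x := W * F x + (h a + (L + 1) * a) - (L + 1) * x.
apply: (@near_eq_derivable _ _ _ g).
- near=> x; have /andP[ax xb] : a < x < b.
    near: x; have : t \in `]a, b[ by rewrite in_itv/= at_ tb.
    by move=> /near_in_itvoo; apply: filterS => y; rewrite in_itv.
  rewrite /g FE ?(ltW ax)// /G clampE ?(ltW ax) ?(ltW xb)//.
  by field; rewrite gt_eqF.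
- have dc (k : R) : derivable ((fun=> k) : R -> R) t 1 by exact: derivable_cst.
  exact: (derivableB (derivableD (derivableM (dc W) dF) (dc _))
    (derivableM (dc (L + 1)) (@derivable_id R R t 1))).
Unshelve. all: by end_near. Qed.

End LipschitzDifferentiable.

(** * Primitives *)

Section Primitive.
Variable R : realType.
Implicit Types (f u F : R[i] -> R[i]) (t r : R) (z w l : R[i]).

Lemma rderP (F : R -> R) x (l : R) : is_derive x (1 : R) F l <->
  forall e : R, 0 < e -> exists2 d : R, 0 < d &
  forall y, `|y - x| < d -> `|F y - F x - l * (y - x)| <= e * `|y - x|.
Proof.
split=> [[dF lE] e e0|H].
  have /cvgrPdist_lt : (fun h => h^-1 *: (F (h *: 1 + x) - F x)) @ 0^' --> l.
    by rewrite -lE; exact: dF.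
  move=> /(_ e e0) /nbhs_ballP[d /= d0 dH]; exists d => // y yd.
  have [->|yx] := eqVneq y x; first by rewrite !subrr mulr0 subrr normr0 mulr0.
  have yx0 : y - x != 0 by rewrite subr_eq0.
  have := dH (y - x); rewrite /ball /= sub0r normrN => /(_ yd yx0) /ltW.
  rewrite /GRing.scale /= mulr1 subrK => E.
  have -> : F y - F x - l * (y - x) = - (l - (y - x)^-1 * (F y - F x)) * (y - x).
    by field.
  by rewrite normrM normrN ler_wpM2r.
have C : (fun h => h^-1 *: (F (h *: 1 + x) - F x)) @ 0^' --> l.
  apply/cvgrPdist_le => e /H[d d0 dH]; apply/nbhs_ballP; exists d => //= h.
  rewrite /ball /= sub0r normrN => hd h0; have := dH (h + x).
  rewrite addrK => /(_ hd) E; rewrite /GRing.scale /= mulr1.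
  have -> : l - h^-1 * (F (h + x) - F x) = - (F (h + x) - F x - l * h) / h by field.
  by rewrite normrM normrN normfV ler_pdivrMr ?normr_gt0.
apply: DeriveDef; first by apply/cvg_ex; exists l.
exact: cvg_lim.
Qed.

Lemma kderivP (g : R -> R[i]) x l : kderiv g x l <->
  forall e : R, 0 < e -> exists2 d : R, 0 < d &
  forall y, `|y - x| < d -> cm (g y - g x - l * (y - x)%:C) <= e * `|y - x|.
Proof.
have rE y : Re (g y - g x - l * (y - x)%:C) = Re (g y) - Re (g x) - Re l * (y - x).
  by rewrite !raddfB /=; case: (l) => ? ? /=; ring.
have iE y : Im (g y - g x - l * (y - x)%:C) = Im (g y) - Im (g x) - Im l * (y - x).
  by rewrite !raddfB /=; case: (l) => ? ? /=; ring.
split=> [[/rderP dR /rderP dI] e e0|H].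
  have e20 : 0 < e / 2 by rewrite divr_gt0.
  have [d d0 dH] := dR _ e20; have [d' d'0 d'H] := dI _ e20.
  exists (Num.min d d'); first by rewrite lt_min d0.
  move=> y; rewrite lt_min => /andP[/dH A /d'H B].
  rewrite (le_trans (cm_le _))// rE iE (le_trans (lerD A B))//.
  by rewrite -mulrDl -splitr.
split; apply/rderP => e /H[d d0 dH]; exists d => // y /dH; apply: le_trans.
  by rewrite -rE; exact: Re_le.
by rewrite -iE; exact: Im_le.
Qed.

Lemma kderiv_ray f z t l : cder f (t%:C * z) l ->
  kderiv (fun s => f (s%:C * z)) t (l * z).
Proof.
move=> H; apply/kderivP => e e0.
have z1 : 0 < cm z + 1 by rewrite ltr_wpDl// cm_ge0.
have [d d0 dH] := H _ (divr_gt0 e0 z1).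
exists (d / (cm z + 1)); first exact: divr_gt0.
move=> y; rewrite ltr_pdivlMr// => yd.
have E : y%:C * z - t%:C * z = (y - t)%:C * z by rewrite RCB; ring.
have C : cm (y%:C * z - t%:C * z) <= `|y - t| * (cm z + 1).
  by rewrite E cmM cmR ler_wpM2l// lerDl.
have := dH _ (le_lt_trans C yd); rewrite E => {}dH.
rewrite (_ : l * z * _ = l * ((y - t)%:C * z)); last by ring.
rewrite (le_trans dH)// -E (le_trans (ler_wpM2l _ C))//.
  by rewrite divr_ge0// ltW.
by rewrite mulrA (mulrAC e) divfK ?gt_eqF// mulrC.
Qed.

(** Adding the expansion at [a], evaluated at [z], to the one at [z], evaluated
    at [a], eliminates [f]. *)
Lemma cderive_lip f r (K : R) : 0 <= K ->
  (forall a z, cm a <= r -> cm z <= r ->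
    cm (f z - f a - cderive f a * (z - a)) <= K * cm (z - a) ^+ 2) ->
  forall a z, cm a <= r -> cm z <= r -> cm (cderive f z - cderive f a) <= 2 * K * cm (z - a).
Proof.
move=> K0 H a z ar zr; have [->|za] := eqVneq z a.
  by rewrite !subrr cm0 mulr0.
have c0 : 0 < cm (z - a) by rewrite cm_gt0 subr_eq0.
rewrite -(ler_pM2r c0) -cmM.
have -> : (cderive f z - cderive f a) * (z - a) =
  (f z - f a - cderive f a * (z - a)) + (f a - f z - cderive f z * (a - z)) by ring.
rewrite (le_trans (cmD _ _))// (le_trans (lerD (H a z ar zr) (H z a zr ar)))//.
by rewrite (cmBC a z) le_eqVlt; apply/orP; left; apply/eqP; ring.
Qed.

(** The primitive is [F z = \int_0^1 z * u (t * z) dt]; differentiating under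
    the integral gives the exact derivative [d/dt (t * u (t * z))]. *)
Lemma primitive u : holo u -> exists F, forall z, cm z < 1 -> cder F z (u z).
Proof.
move=> hu; pose F z := z * cI 0 1 (fun t => u (t%:C * z)).
exists F => z z1; have cz0 := cm_ge0 z.
pose r := (1 + cm z) / 2; pose r2 := (1 + r) / 2.
have [r0 zr rr2 r21] : [/\ 0 <= r, cm z < r, r < r2 & r2 < 1].
  by rewrite /r2 /r; split; lra.
have [K K0 T] := taylor2 r0 rr2 (holo_holo_on r21 hu).
have L := cderive_lip K0 T.
have r1 : r < 1 := lt_trans rr2 r21.
pose du := cderive u.
have tz t w : 0 <= t <= 1 -> cm w <= r -> cm (t%:C * w) <= r.
  move=> /andP[t0 t1] wr; rewrite cmM cmR ger0_norm// (le_trans _ wr)//.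
  by rewrite ler_piMl// cm_ge0.
have cray (x : R) : {for x, continuous ((fun t => t%:C * z) : R -> R[i]^o)}.
  by apply: cvgM; [exact: RC_cont|exact: cvg_cst].
have cu w : cm w <= r -> ccont_itv 0 1 (fun t => u (t%:C * w)).
  move=> wr t th; apply: (@cont_comp R (fun t => t%:C * w)).
    by apply: cvgM; [exact: RC_cont|exact: cvg_cst].
  by apply/cdiff_cont/hu; apply: le_lt_trans r1; exact: tz.
have cdu : ccont_itv 0 1 (fun t => du (t%:C * z)).
  move=> t th; apply: (@cont_comp R (fun t => t%:C * z)); first exact: cray.
  apply/ccontP => e e0.
  have azr : cm (t%:C * z) <= cm z.
    case/andP: th => t0 t1; rewrite cmM cmR ger0_norm//.
    by rewrite ler_piMl.
  have K1 : 0 < 2 * K + 1 by rewrite ltr_wpDl// mulr_ge0.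
  exists (Num.min (r - cm z) (e / (2 * K + 1))).
    by rewrite lt_min subr_gt0 zr divr_gt0.
  move=> w; rewrite lt_min ltr_pdivlMr// => /andP[wr we].
  have wr' : cm w <= r.
    by rewrite -(subrK (t%:C * z) w) (le_trans (cmD _ _))//; lra.
  rewrite (le_lt_trans (L _ _ _ wr'))//; first by rewrite (le_trans azr)// ltW.
  by rewrite (le_lt_trans _ we)// mulrC ler_wpM2l ?cm_ge0// lerDl.
have cRC : ccont_itv (0 : R) 1 (fun t => t%:C) by move=> t _; exact: RC_cont.
have cc (k : R[i]) : ccont_itv (0 : R) 1 (fun=> k) by exact: cont_itv_cst.
pose G t := u (t%:C * z) + t%:C * (du (t%:C * z) * z).
have cG : ccont_itv 0 1 G.
  apply: (@cconD R 0 1 (fun t => u (t%:C * z))); first exact: (cu z (ltW zr)).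
  exact: (cconM cRC (cconM cdu (cc z))).
have IG : cI 0 1 G = u z.
  rewrite (cI_FTC (F := fun t => t%:C * u (t%:C * z)) ler01 cG).
    by rewrite !mul0r subr0 !mul1r.
  move=> t th; have tz1 : cm (t%:C * z) < 1.
    by apply: le_lt_trans r1; apply: tz => //; exact: ltW.
  apply: kderiv_eq (kderivM (kderiv_RC t) (kderiv_ray (cderiveP (hu _ tz1)))) _.
  by rewrite mul1r.
pose D := cm (du 0) + 2 * K; have D0 : 0 <= D by rewrite addr_ge0 ?cm_ge0 ?mulr_ge0.
have duD w : cm w <= r -> cm (du w) <= D.
  move=> wr; rewrite -(subrK (du 0) (du w)) (le_trans (cmD _ _))// addrC lerD2l.
  rewrite (le_trans (L 0 w _ wr)) ?cm0// subr0 ler_piMr ?mulr_ge0//.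
  by rewrite (le_trans wr)// ltW.
move=> e e0; have Q0 : 0 < 2 * (K + D) + 1 by rewrite ltr_wpDl// mulr_ge0// addr_ge0.
exists (Num.min (r - cm z) (e / (2 * (K + D) + 1))).
  by rewrite lt_min subr_gt0 zr divr_gt0.
move=> w; rewrite lt_min ltr_pdivlMr// => /andP[wzr we].
have wr : cm w <= r by rewrite -(subrK z w) (le_trans (cmD _ _))//; lra.
pose H t := w * u (t%:C * w) - z * u (t%:C * z) - (w - z) * G t.
have c1 := cconM (cc w) (cu w wr); have c2 := cconM (cc z) (cu z (ltW zr)).
have c3 := cconM (cc (w - z)) cG; have c12 := cconD c1 (cconN c2).
have cH : ccont_itv 0 1 H by exact: (cconD c12 (cconN c3)).
have E : F w - F z - u z * (w - z) = cI 0 1 H.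
  rewrite /H (cIB c12 c3) (cIB c1 c2) (cIZ _ (cu w wr)).
  by rewrite (cIZ _ (cu z (ltW zr))) (cIZ _ cG) IG [u z * _]mulrC.
have HB t : 0 <= t <= 1 -> cm (H t) <= (K + D) * cm (w - z) ^+ 2.
  move=> th; have zr' := tz t z th (ltW zr); have wr' := tz t w th wr.
  have [t0 t1] := andP th.
  have -> : H t =
    w * (u (t%:C * w) - u (t%:C * z) - du (t%:C * z) * (t%:C * w - t%:C * z)) +
    t%:C * (w - z) ^+ 2 * du (t%:C * z) by rewrite /H /G; ring.
  rewrite (le_trans (cmD _ _))// (cmM w) (cmM (_ * _)) (cmM t%:C) cmX cmR ger0_norm//
    mulrDl.
  have tw : cm (t%:C * w - t%:C * z) <= cm (w - z).
    by rewrite -mulrBr cmM cmR ger0_norm// ler_piMl// cm_ge0.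
  apply: lerD.
    rewrite -[leRHS]mul1r; apply: ler_pM; rewrite ?cm_ge0//.
      by rewrite (le_trans wr)// ltW.
    by rewrite (le_trans (T _ _ zr' wr'))// ler_wpM2l// lerXn2r ?nnegrE ?cm_ge0.
  rewrite mulrC; apply: ler_pM; rewrite ?cm_ge0 ?mulr_ge0 ?exprn_ge0 ?cm_ge0 ?duD//.
  by rewrite ler_piMl// exprn_ge0// cm_ge0.
rewrite E (le_trans (cI_bound ler01 cH HB))//.
rewrite subr0 mulr1 expr2 !mulrA ler_wpM2r ?cm_ge0//.
move: we => /ltW; apply: le_trans; rewrite [leRHS]mulrC ler_wpM2r ?cm_ge0//.
by rewrite lerDl.
Qed.

Lemma bounded_lipschitz F u (M : R) : (forall z, cm z < 1 -> cder F z (u z)) ->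
  (forall z, cm z < 1 -> cm (u z) <= M) ->
  forall z w, cm z < 1 -> cm w < 1 -> cm (F w - F z) <= M * cm (w - z).
Proof.
move=> dF uM z w z1 w1; pose r' := Num.max (cm z) (cm w).
have r'1 : r' < 1 by rewrite gt_max z1.
pose r := (1 + r') / 2; have [r'r r1] : r' < r /\ r < 1 by rewrite /r; split; lra.
apply: (@mean_value R F r r' M) => //.
- by move=> x xr; exists (u x); apply: dF; exact: le_lt_trans r1.
- move=> x xr; have x1 := le_lt_trans xr r'1.
  have dx := dF x x1; rewrite (cder_unique (cderiveP _) dx) ?uM//.
  by exists (u x).
- by rewrite le_max lexx.
- by rewrite le_max lexx orbT.
Qed.

(** The difference quotient at [a] is at most [2 * m / r] on the circle, and its
    value at [a] is [l]. *)
Lemma cauchy_estimate f a (r m : R) l : 0 < r ->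
  (forall z, cm (z - a) <= r -> cdiff f z) ->
  (forall z, cm (z - a) <= r -> cm (f z) <= m) -> cder f a l -> cm l <= 2 * m / r.
Proof.
move=> r0 df fm dl; pose g z := f (1 * z + a).
have gE z : 1 * z + a - a = z by rewrite addrK mul1r.
have hg : holo_on r g.
  by move=> z zr; apply: cdiff_affine; apply: df; rewrite gE.
have c0r : cm 0 < r by rewrite cm0.
have [q [qE qd]] := quotient_hol c0r hg.
have hq : holo_on r q by move=> z zr; apply: qd; exact: hg.
have qM z : cm z <= r -> cm (q z) <= 2 * m / r.
  move=> zr; apply: (max_principle hq) zr => w wr.
  rewrite ler_pdivlMr// -{1}wr -cmM [q w * w]mulrC.
  have := qE w; rewrite subr0 => <-; rewrite (le_trans (cmB _ _))//.
  rewrite mulr_natl mulr2n lerD// fm// gE ?wr//.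
  by rewrite cm0 ltW.
apply/ler_addgt0Pr => e e0; have [d d0 dH] := dl e e0.
pose s := Num.min d r / 2.
have m0 : 0 < Num.min d r by rewrite lt_min d0.
have s0 : 0 < s by rewrite divr_gt0.
have [sd sr] : s < d /\ s < r.
  by apply/andP; rewrite -lt_min /s; lra.
have cs : cm (s%:C) = s by rewrite cmR gtr0_norm.
have := dH (1 * s%:C + a); rewrite gE cs => /(_ sd).
rewrite -/(g _) => H.
have fa : f a = g 0 by rewrite /g mulr0 add0r.
rewrite -(ler_pM2r s0) -{1}cs -cmM.
have -> : l * s%:C = (g s%:C - f a) - (g s%:C - f a - l * s%:C) by ring.
rewrite (le_trans (cmB _ _))// mulrDl lerD//.
rewrite fa qE subr0 cmM cs mulrC ler_wpM2r ?(ltW s0)// qM// cs ltW//.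
Qed.

End Primitive.

(** * Radial limits of bounded holomorphic functions *)

Section Fatou.
Variable R : realType.
Implicit Types (f u F : R[i] -> R[i]) (t r : R) (z w l : R[i]).

(** The angle is the arc sine of the imaginary part; the bound by the chord comes
    from the derivative of the sine at 0. *)
Lemma arc_param (e0 : R) : 0 < e0 -> exists2 eta : R, 0 < eta &
  forall w : R[i], cm w = 1 -> cm (w - 1) < eta ->
  exists t, [/\ w = expi t, `|t| < e0 & `|t| <= 2 * cm (w - 1)].
Proof.
move=> e00.
have /rderP ds := is_derive_sin (0 : R).
have [d d0 dH] := ds 2^-1 ltac:(by rewrite invr_gt0).
have m0 : 0 < Num.min e0 d by rewrite lt_min e00.
have I0 : -1 < (0 : R) < 1 by rewrite ltr01 oppr_lt0 ltr01.
have asin0 : asin (0 : R) = 0.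
  rewrite -{1}(sin0 R) sinK// in_itv/= oppr_le0 divr_ge0// ?pi_ge0//.
have /cvgrPdist_lt := continuous_asin I0.
move=> /(_ _ m0) /nbhs_ballP[d' /= d'0 d'H].
exists (Num.min d' 1); first by rewrite lt_min d'0/=.
move=> w w1; rewrite lt_min => /andP[wd w1'].
have Iw : `|Im w| <= cm (w - 1).
  by rewrite (le_trans _ (Im_le _))// raddfB /= subr0.
have Rw : 0 <= Re w.
  have := Re_le (w - 1); rewrite raddfB /= ler_norml => /andP[]; lra.
pose t := asin (Im w).
have I1 : -1 <= Im w <= 1 by rewrite -ler_norml (le_trans Iw)// ltW.
have tE : w = expi t.
  apply/eqP; rewrite eq_complex /= /t cos_asin// asinK ?in_itv//= eqxx andbT.
  have := cm_sqr w; rewrite w1 expr1n => E.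
  by rewrite E addrK sqrtr_sqr ger0_norm.
have tm : `|t| < Num.min e0 d.
  have := d'H (Im w); rewrite /ball /= sub0r normrN asin0 sub0r normrN.
  by apply; rewrite (le_lt_trans Iw).
move: tm; rewrite lt_min => /andP[te td]; exists t; split => //.
have := dH t; rewrite subr0 => /(_ td).
rewrite sin0 cos0 subr0 mul1r /t asinK ?in_itv//= => H.
have := ler_normB (asin (Im w)) (asin (Im w) - Im w).
rewrite subKr [`|asin _ - Im w|]distrC => H2.
have : `|asin (Im w)| <= `|Im w| + 2^-1 * `|asin (Im w)|.
  rewrite -[X in `|X| <= _](subrK (Im w)) (le_trans (ler_normD _ _))// addrC lerD2l.
  by rewrite distrC.
by move: Iw; lra.
Qed.

(** If the boundary function of a Lipschitz holomorphic [F] is differentiable at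
    the boundary point [1], then [F'] has a radial limit there. After
    subtraction of the tangent the boundary values are [o(|w - 1|)]; the
    multiplier [d / (1 + d - z) ^+ 2] keeps them small and damps the rest of the
    circle, so the maximum principle gives [F = o(d)] on a disc of radius
    comparable to [d] about [1 - d], and Cauchy's estimate applies. *)
Lemma fatou_local F (c : R[i]) (psi : R -> R[i]) (M : R) : 0 <= M -> holo F ->
  (forall z w, cm z < 1 -> cm w < 1 -> cm (F w - F z) <= M * cm (w - z)) ->
  (forall r t, 0 <= r < 1 -> cm (F (r%:C * expi t) - psi t) <= M * (1 - r)) ->
  kderiv psi 0 (c * 'i) ->
  forall e : R, 0 < e -> exists2 d0 : R, 0 < d0 & forall d l, 0 < d -> d < d0 ->
    cder F (1 - d)%:C l -> cm (l - c) <= e.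
Proof.
move=> M0 hF lipF Fpsi dpsi e e0.
pose H z := F z - psi 0 - c * (z - 1).
pose Hb t := psi t - psi 0 - c * (expi t - 1).
(* The maximum principle yields [|H| <= 16 * e1 * d] on a disc of radius [d / 4],
   whence a derivative at most [2 * (16 * e1 * d) / (d / 4) = e]. *)
pose e1 := e / 128; have e10 : 0 < e1 by rewrite divr_gt0.
have c0 := cm_ge0 c.
pose B := M + cm c; have B0 : 0 <= B by rewrite addr_ge0.
have Hb0 : Hb 0 = 0 by rewrite /Hb expi0; ring.
have dHb : kderiv Hb 0 0.
  have := kderivD (kderivD dpsi (kderiv_cst (- psi 0) 0))
    (kderivZ (- c) (kderivD (kderiv_expi 0) (kderiv_cst (- 1) 0))).
  rewrite (_ : (fun t => _) = Hb); last by apply/funext => t; rewrite /Hb mulNr.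
  by move/kderiv_eq; apply; rewrite expi0; ring.
have /kderivP/(_ _ e10)[eta0 eta00 Hb_small] := dHb.
have [eta eta_gt0 arc_eta] := arc_param eta00.
have HbE t : `|t| < eta0 -> cm (Hb t) <= e1 * `|t|.
  by move=> te; have := Hb_small t; rewrite Hb0 mul0r !subr0 => /(_ te).
have HB z : cm z < 1 -> cm (H z) <= B * cm (z - 1).
  move=> z1; rewrite /H (le_trans (cmB _ _))// cmM mulrDl lerD2r.
  apply/ler_addgt0Pr => q q0.
  have M1 : 0 < 2 * M + 1 by rewrite ltr_wpDl// mulr_ge0.
  pose k := Num.min 2^-1 (q / (2 * M + 1)).
  have k0 : 0 < k by rewrite lt_min invr_gt0 ltr0n divr_gt0.
  have k2 : k <= 2^-1 by rewrite ge_min lexx.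
  have kq : k * (2 * M + 1) <= q by rewrite -ler_pdivlMr// ge_min lexx orbT.
  have r01 : 0 <= 1 - k < 1 by apply/andP; split; lra.
  have ck : cm ((1 - k)%:C * expi 0) < 1.
    by rewrite cm_pol//; [case/andP: r01|lra].
  rewrite (le_trans (cm_tri (F ((1 - k)%:C * expi 0)) _ _))//.
  rewrite (le_trans (lerD (lipF _ _ ck z1) (Fpsi _ 0 r01)))// expi0 mulr1.
  have T : cm (z - (1 - k)%:C) <= cm (z - 1) + k.
    rewrite (le_trans (cm_tri 1 _ _))// lerD2l.
    by rewrite (_ : 1 - (1 - k)%:C = k%:C) ?cmR ?gtr0_norm// RCB; ring.
  rewrite (le_trans (lerD (ler_wpM2l M0 T) (lexx _)))//.
  rewrite mulrDr -addrA lerD2l; have := k0; lra.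
have Hs s t : 0 <= s < 1 -> cm (H (s%:C * expi t)) <= cm (Hb t) + B * (1 - s).
  move=> s01; have s1 : 0 <= 1 - s by case/andP: s01; lra.
  have -> : H (s%:C * expi t) = Hb t + ((F (s%:C * expi t) - psi t) + c * ((1 - s)%:C * expi t)).
    by rewrite /H /Hb RCB; ring.
  rewrite (le_trans (cmD _ _))// lerD2l (le_trans (cmD _ _))// mulrDl lerD ?Fpsi//.
  by rewrite cmM cm_pol.
have B1 : 0 < 2 * B + 1 by rewrite ltr_wpDl// mulr_ge0.
exists (Num.min 1 (e1 * eta / (2 * B + 1))).
  by rewrite lt_min ltr01 divr_gt0// mulr_gt0.
move=> d l d0; rewrite lt_min ltr_pdivlMr// => /andP[d1 dB] dF.
have EB : 0 < 2 * e1 + B + 1 by rewrite ltr_wpDl// addr_ge0// mulr_ge0// ltW.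
pose k := Num.min (d / 2) (Num.min (eta / 2) (e1 * d / (2 * e1 + B + 1))).
have k0 : 0 < k by rewrite !lt_min !divr_gt0// mulr_gt0.
have kd : k <= d / 2 by rewrite ge_min lexx.
have keta : k <= eta / 2 by rewrite !ge_min lexx orbT.
have kE : k * (2 * e1 + B + 1) <= e1 * d.
  by rewrite -ler_pdivlMr// !ge_min lexx !orbT.
pose s := 1 - k; have [s0 s1] : 0 < s /\ s < 1 by rewrite /s; split; lra.
pose D z := (1 + d)%:C - z.
have Dd z : cm z <= 1 -> d <= cm (D z).
  move=> z1; rewrite (le_trans _ (cm_sub _ _))// cmR ger0_norm; lra.
have D1 z : cm z <= 1 -> cm (z - 1) <= cm (D z).
  move=> z1; rewrite -ler_sqr ?nnegrE ?cm_ge0// !cm_sqr /D.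
  have : Re z <= 1 by rewrite (le_trans _ z1)// (le_trans _ (Re_le z))// ler_norm.
  case: (z) => x y /= x1.
  by rewrite -subr_ge0 (_ : _ - _ = d * (2 * (1 - x) + d)) ?mulr_ge0//; [lra|lra|ring].
have Dn0 z : cm z <= 1 -> D z != 0 by move=> /Dd h; rewrite -cm_gt0; lra.
pose Psi z := H z * (d%:C / D z ^+ 2).
have hH z : cm z < 1 -> cdiff H z.
  move=> z1; apply: cdiffB.
    by apply: cdiffB; [exact: hF|exact: cdiff_cst].
  by apply: cdiffM; [exact: cdiff_cst|apply: cdiffB; [exact: cdiff_id|exact: cdiff_cst]].
have hPsi : holo_on s Psi.
  move=> z zs; have z1 := le_lt_trans zs s1.
  apply: cdiffM; first exact: hH.
  apply: cdiffM; first exact: cdiff_cst.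
  apply: cdiffV; first by rewrite expf_neq0// Dn0// ltW.
  by apply: cdiffX; apply: cdiffB; [exact: cdiff_cst|exact: cdiff_id].
have PsiE z : cm z <= 1 -> forall m, cm (Psi z) <= m <-> cm (H z) * d <= m * cm (D z) ^+ 2.
  move=> z1 m; rewrite /Psi cmM cm_div cmX cmR gtr0_norm// mulrA ler_pdivrMr//.
  by rewrite exprn_gt0// cm_gt0 Dn0.
have circ z : cm z = s -> cm (Psi z) <= 3 * e1.
  move=> zs; have z1 : cm z < 1 by rewrite zs.
  apply/PsiE; first exact: ltW.
  have X1 := D1 z (ltW z1); have Xd := Dd z (ltW z1).
  set X := cm (D z) in X1 Xd *.
  have sn0 : s%:C != 0 :> R[i] by rewrite RCeq0 gt_eqF.
  pose w := z / s%:C; have zE : z = s%:C * w by rewrite /w; field.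
  have w1 : cm w = 1 by rewrite /w cm_div cmR zs gtr0_norm// divff// gt_eqF.
  have wz : cm (w - z) = k.
    rewrite (_ : w - z = k%:C * w); last by rewrite zE /s RCB; ring.
    by rewrite cmM w1 mulr1 cmR gtr0_norm.
  have [we|we] := ltP (cm (w - 1)) eta.
    have [t [wt te tw]] := arc_eta w w1 we.
    have s01 : 0 <= s < 1 by rewrite (ltW s0).
    have h1 := Hs s t s01; rewrite -wt -zE in h1.
    have h2 := HbE t te.
    have h3 : cm (w - 1) <= k + cm (z - 1) by rewrite -wz; exact: cm_tri.
    have h4 : cm (H z) <= 2 * e1 * X + (2 * e1 + B) * k.
      rewrite (le_trans h1)// (_ : 1 - s = k); last by rewrite /s; ring.
      have h5 : e1 * `|t| <= e1 * (2 * (k + X)).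
        by rewrite ler_pM2l// (le_trans tw)// ler_pM2l//; lra.
      by have := B0; lra.
    have h5 : cm (H z) * d <= (2 * e1 * X + e1 * d) * d.
      rewrite ler_pM2r// (le_trans h4)// lerD2l.
      by rewrite (le_trans _ kE)// mulrC ler_pM2l// lerDl.
    rewrite (le_trans h5)//.
    have h6 : e1 * X * d <= e1 * X * X.
      by rewrite ler_wpM2l// mulr_ge0 ?cm_ge0// ltW.
    have h7 : e1 * (d * d) <= e1 * (X * X).
      by rewrite ler_pM2l//; apply: ler_pM => //; exact: ltW.
    by rewrite expr2; lra.
  have h1 := HB z z1.
  have h2 : eta / 2 <= X.
    by have := cm_tri z w 1; rewrite wz; lra.
  have h3 : cm (H z) * d <= B * X * d.
    by rewrite ler_pM2r// (le_trans h1)// ler_wpM2l.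
  have h4 : B * d <= 3 * e1 * X.
    have : e1 * (eta / 2) <= e1 * X by rewrite ler_pM2l.
    have : 0 <= e1 * X by rewrite mulr_ge0 ?cm_ge0// ltW.
    by have := B0; have := d0; lra.
  rewrite (le_trans h3)// expr2 mulrAC mulrA ler_wpM2r// cm_ge0//.
have inner z : cm (z - (1 - d)%:C) <= d / 4 -> cm (H z) <= 16 * e1 * d.
  move=> zd.
  have zs : cm z <= s.
    rewrite -(subrK (1 - d)%:C z) (le_trans (cmD _ _))// cmR ger0_norm; last lra.
    by rewrite /s; lra.
  have z1 : cm z <= 1 by rewrite (le_trans zs)// ltW.
  have /(PsiE z z1) E := max_principle hPsi circ zs.
  have X : cm (D z) <= d * (9 / 4).
    rewrite (_ : D z = (2 * d)%:C - (z - (1 - d)%:C)); last first.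
      by rewrite /D !RCD RCN RCM; ring.
    rewrite (le_trans (cmB _ _))// cmR ger0_norm; last by rewrite mulr_ge0// ltW.
    by lra.
  rewrite -(ler_pM2r d0) (le_trans E)//.
  have X2 : cm (D z) ^+ 2 <= (d * (9 / 4)) ^+ 2.
    by rewrite lerXn2r ?nnegrE ?cm_ge0// mulr_ge0// ltW.
  have e3 : 0 <= 3 * e1 by rewrite mulr_ge0// ltW.
  rewrite (le_trans (ler_wpM2l e3 X2))//.
  have : 0 <= e1 * (d * d) by rewrite !mulr_ge0// ltW.
  rewrite exprMn expr2; lra.
have dH : cder H (1 - d)%:C (l - c).
  move=> q q0; have [g g0 gH] := dF q q0; exists g => // w /gH.
  by rewrite (_ : H w - _ - _ = F w - F (1 - d)%:C - l * (w - (1 - d)%:C))// /H; ring.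
have := @cauchy_estimate R H (1 - d)%:C (d / 4) (16 * e1 * d) (l - c).
rewrite divr_gt0// => /(_ isT) CE.
rewrite (le_trans (CE _ inner dH))//.
  move=> z zd; apply: hH; rewrite -(subrK (1 - d)%:C z) (le_lt_trans (cmD _ _))//.
  by rewrite cmR ger0_norm; lra.
rewrite le_eqVlt; apply/orP; left; apply/eqP; rewrite /e1.
by field; rewrite gt_eqF.
Qed.

Definition rlim f z l := forall e : R, 0 < e -> exists2 d : R, 0 < d &
  forall r, 1 - d < r -> r < 1 -> cm (f (r%:C * z) - l) <= e.

(** [h r + M * r] is nondecreasing and bounded. *)
Lemma lipschitz_radial (h : R -> R) (M : R) : 0 <= M ->
  (forall r s, 0 <= r < 1 -> 0 <= s < 1 -> `|h r - h s| <= M * `|r - s|) ->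
  exists l : R, forall r, 0 <= r < 1 -> `|h r - l| <= M * (1 - r).
Proof.
move=> M0 lip; pose A := [set h r + M * r | r in [set r | 0 <= r < 1]].
have ub r s : 0 <= r < 1 -> 0 <= s < 1 -> h s + M * s <= h r + M * r + 2 * M * (1 - r).
  move=> r01 s01; have := lip s r s01 r01.
  have [r0 r1] := andP r01; have [s0 s1] := andP s01.
  have [sr|rs] := leP s r.
    rewrite [`|s - r|]ler0_norm ?subr_le0// ler_norml => /andP[_ h1].
    have : 0 <= M * (1 - r) by rewrite mulr_ge0// subr_ge0 ltW.
    by lra.
  rewrite [`|s - r|]gtr0_norm ?subr_gt0// ler_norml => /andP[_ h1].
  have : M * s <= M * 1 by rewrite ler_wpM2l// ltW.
  by lra.
have z01 : 0 <= (0 : R) < 1 by rewrite lexx ltr01.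
have ne : A !=set0 by exists (h 0 + M * 0), 0.
exists (sup A - M) => r r01.
have h1 : h r + M * r <= sup A.
  apply: ub_le_sup; last by exists r.
  by exists (h 0 + M * 0 + 2 * M * (1 - 0)) => _ [s s01 <-]; exact: ub.
have h2 : sup A <= h r + M * r + 2 * M * (1 - r).
  by apply: ge_sup => // _ [s s01 <-]; exact: ub.
by rewrite ler_norml; apply/andP; split; lra.
Qed.

(** A primitive of [u] is Lipschitz on the disc, so its boundary values form a
    Lipschitz function of the angle. This function is differentiable almost
    everywhere, and a tangent to the boundary curve suffices for a radial limit
    of [u]. *)
Theorem fatou u (M : R) : holo u -> (forall z, cm z < 1 -> cm (u z) <= M) ->
  {ae @lebesgue_measure R, forall t, 0 <= t < 2 * pi -> exists l, rlim u (expi t) l}.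
Proof.
move=> hu uM; have [F dF] := primitive hu.
have M0 : 0 <= M by rewrite (le_trans _ (uM 0 _)) ?cm_ge0 ?cm0.
have lipF := bounded_lipschitz dF uM.
have hF : holo F by move=> z z1; exists (u z); exact: dF.
have pol r t : 0 <= r < 1 -> cm (r%:C * expi t) < 1.
  by move=> /andP[r0 r1]; rewrite cm_pol.
have lipr t r s : 0 <= r < 1 -> 0 <= s < 1 ->
    cm (F (r%:C * expi t) - F (s%:C * expi t)) <= M * `|r - s|.
  move=> r01 s01; rewrite (le_trans (lipF _ _ (pol s t s01) (pol r t r01)))//.
  by rewrite -mulrBl -RCB cmM cm_expi mulr1 cmR.
have /choice[pR pRP] : forall t, exists l : R, forall r, 0 <= r < 1 ->
    `|Re (F (r%:C * expi t)) - l| <= M * (1 - r).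
  move=> t; apply: lipschitz_radial => // r s r01 s01.
  by rewrite -raddfB (le_trans (Re_le _))// lipr.
have /choice[pI pIP] : forall t, exists l : R, forall r, 0 <= r < 1 ->
    `|Im (F (r%:C * expi t)) - l| <= M * (1 - r).
  move=> t; apply: lipschitz_radial => // r s r01 s01.
  by rewrite -raddfB (le_trans (Im_le _))// lipr.
have lip_t (p : R -> R) (P : R[i] -> R) :
    (forall z w, `|P z - P w| <= cm (z - w)) ->
    (forall t r, 0 <= r < 1 -> `|P (F (r%:C * expi t)) - p t| <= M * (1 - r)) ->
    forall x y, `|p x - p y| <= 2 * M * `|x - y|.
  move=> P1 pP x y; apply/ler_addgt0Pr => e e0.
  have M1 : 0 < 2 * M + 1 by rewrite ltr_wpDl// mulr_ge0.
  pose k := Num.min 2^-1 (e / (2 * M + 1)).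
  have k0 : 0 < k by rewrite lt_min invr_gt0 ltr0n divr_gt0.
  have k2 : k <= 2^-1 by rewrite ge_min lexx.
  have kq : k * (2 * M + 1) <= e by rewrite -ler_pdivlMr// ge_min lexx orbT.
  have r01 : 0 <= 1 - k < 1 by apply/andP; split; lra.
  have h1 := pP x _ r01; have h2 := pP y _ r01.
  have h3 : `|P (F ((1 - k)%:C * expi x)) - P (F ((1 - k)%:C * expi y))| <= 2 * M * `|x - y|.
    rewrite (le_trans (P1 _ _))// (le_trans (lipF _ _ (pol _ y r01) (pol _ x r01)))//.
    rewrite -mulrBr cmM cmR ger0_norm; last by case/andP: r01.
    have -> : 2 * M * `|x - y| = M * (2 * `|x - y|) by ring.
    rewrite ler_wpM2l// (le_trans _ (expi_lip y x))// ler_piMl ?cm_ge0//.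
    by case/andP: r01; lra.
  rewrite (_ : p x - p y = - (P (F ((1 - k)%:C * expi x)) - p x) +
    (P (F ((1 - k)%:C * expi x)) - P (F ((1 - k)%:C * expi y))) +
    (P (F ((1 - k)%:C * expi y)) - p y)); last by ring.
  rewrite (le_trans (ler_normD _ _))// (le_trans (lerD (ler_normD _ _) (lexx _)))//.
  rewrite normrN (le_trans (lerD (lerD h1 h3) h2))//.
  by rewrite (_ : 1 - (1 - k) = k); [lra|ring].
have lipR := lip_t pR (fun z => Re z) (fun z w => _) pRP.
have lipI := lip_t pI (fun z => Im z) (fun z w => _) pIP.
have {}lipR : forall x y, `|pR x - pR y| <= 2 * M * `|x - y|.
  by apply: lipR => z w; rewrite -raddfB Re_le.
have {}lipI : forall x y, `|pI x - pI y| <= 2 * M * `|x - y|.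
  by apply: lipI => z w; rewrite -raddfB Im_le.
have ab : -1 < 2 * pi + 1 :> R by have := pi2_ge0 R; lra.
have M2 : 0 <= 2 * M by rewrite mulr_ge0.
have := ae_and (lipschitz_derivable ab M2 lipR) (lipschitz_derivable ab M2 lipI).
apply: ae_mono => t [dR dI] /andP[t0 t2].
have tt : -1 < t < 2 * pi + 1 by apply/andP; split; lra.
pose p := 'D_1 pR t +i* 'D_1 pI t.
pose psi s := pR (t + s) +i* pI (t + s).
pose zeta := expi t.
have z0 : zeta != 0 := expi_neq0 t.
have i0 : ('i : R[i]) != 0 by rewrite -cm_eq0 cmi oner_eq0.
pose c := p / 'i.
have dpsi : kderiv psi 0 (c * 'i).
  rewrite /c divfK//.
  have shift (q : R -> R) : derivable q t 1 -> is_derive (0 : R) (1 : R)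
      (fun s => q (t + s)) ('D_1 q t).
    move=> /derivableP /rderP dq; apply/rderP => e /dq[d d0 dH]; exists d => // y.
    by rewrite subr0 addr0 => yd; have := dH (t + y); rewrite addrC addKr; exact.
  by split; [exact: shift (dR tt)|exact: shift (dI tt)].
pose G z := F (zeta * z + 0).
have zz z : cm z < 1 -> cm (zeta * z + 0) < 1 by rewrite addr0 cmM cm_expi mul1r.
have hG : holo G by move=> z z1; apply: cdiff_affine; apply: hF; exact: zz.
have lipG z w : cm z < 1 -> cm w < 1 -> cm (G w - G z) <= M * cm (w - z).
  move=> z1 w1; rewrite (le_trans (lipF _ _ (zz z z1) (zz w w1)))//.
  by rewrite !addr0 -mulrBr cmM cm_expi mul1r.
have Gpsi r s : 0 <= r < 1 -> cm (G (r%:C * expi s) - psi s) <= 2 * M * (1 - r).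
  move=> r01; rewrite /G addr0 mulrCA -expiD.
  rewrite (le_trans (cm_le _))// !raddfB /= -mulrA mulr_natl mulr2n.
  by rewrite lerD ?pRP ?pIP.
have lipG2 z w : cm z < 1 -> cm w < 1 -> cm (G w - G z) <= 2 * M * cm (w - z).
  move=> z1 w1; rewrite (le_trans (lipG z w z1 w1))// ler_wpM2r ?cm_ge0//; lra.
have FL := fatou_local M2 hG lipG2 Gpsi dpsi.
exists (c / zeta) => e e0; have [d0 d00 H] := FL e e0.
exists (Num.min d0 1); first by rewrite lt_min d00 ltr01.
move=> r r1; move: r1; rewrite ltrBlDr -ltrBlDl lt_min => /andP[rd rd1] r1.
have r0 : 0 <= r by lra.
have a0 : 0 < 1 - r by lra.
have dG : cder G (1 - (1 - r))%:C (u (r%:C * zeta) * zeta).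
  rewrite (_ : 1 - (1 - r) = r); last by ring.
  have r01 : 0 <= r < 1 by rewrite r0.
  move=> q q0; have [g g0 gH] := dF _ (pol r t r01) q q0; exists g => // w wg.
  have E : zeta * w + 0 - r%:C * zeta = zeta * (w - r%:C) by ring.
  have := gH (zeta * w + 0); rewrite E cmM cm_expi mul1r => /(_ wg).
  by rewrite /G (_ : zeta * r%:C + 0 = r%:C * zeta) ?mulrA//; ring.
have := H (1 - r) _ a0 rd dG.
have -> : u (r%:C * zeta) * zeta - c = (u (r%:C * zeta) - c / zeta) * zeta by field.
by rewrite cmM cm_expi mulr1.
Qed.

End Fatou.

(** * Uniqueness from radial limits *)

Section RadialLimits.
Variable R : realType.
Implicit Types (z : R[i]) (e r t x : R) (u v f g : R[i] -> R[i]).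

Local Notation leb := (@lebesgue_measure R).

Lemma con_cm a b (h : R -> R[i]) : ccont_itv a b h -> cont_itv a b (fun t => cm (h t)).
Proof.
move=> ch x xab; have /ccvgP hx := ch x xab.
apply/cvgrPdist_lt => e e0; have := hx e e0; apply: filterS => y hy.
rewrite (le_lt_trans _ hy)// ler_norml.
by have := cm_sub (h y) (h x); have := cm_sub (h x) (h y); rewrite cmBC; lra.
Qed.

Lemma cI_bound2 a b (h : R -> R[i]) : ccont_itv a b h ->
  cm (cI a b h) <= 2 * rI a b (fun t => cm (h t)).
Proof.
move=> ch; rewrite (le_trans (cm_le _))//= mulr_natl mulr2n.
have cc := con_cm ch.
have bnd (q : R -> R) : cont_itv a b q -> (forall x, `|q x| <= cm (h x)) ->
    `|rI a b q| <= rI a b (fun t => cm (h t)).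
  move=> cq qh; rewrite (le_trans (le_normr_Rintegral _ (cont_itv_integrable cq)))//.
  apply: le_rI cc _ => // x xab; have := cq x xab; exact: cvg_norm.
apply: lerD; apply: bnd.
- exact: con_Re.
- by move=> x; exact: Re_le.
- exact: con_Im.
- by move=> x; exact: Im_le.
Qed.

Lemma ae_notin (s : seq R) : {ae leb, forall t, t \notin s}.
Proof.
have cs : countable [set` s].
  by apply: finite_set_countable; apply/finite_seqP; exists s.
exists [set` s]; split.
- by apply: countable_measurable cs => t; exact: measurable_set1.
- exact: countable_lebesgue_measure0.
- by move=> t /= /negP; rewrite negbK.
Qed.

Lemma rI_bounded_cvg0 a b M (F : nat -> R -> R) :
  (forall n, cont_itv a b (F n)) -> (forall n t, a <= t <= b -> `|F n t| <= M) ->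
  {ae leb, forall t, a <= t <= b -> F n t @[n --> \oo] --> (0 : R)} ->
  rI a b (F n) @[n --> \oo] --> (0 : R).
Proof.
move=> cF FM F0.
have mD : measurable (`[a, b] : set R) by exact: measurable_itv.
have ig : leb.-integrable `[a, b] (EFin \o (fun=> M)).
  by apply: cont_itv_integrable; exact: cont_itv_cst.
have := @dominated_convergence _ _ R leb `[a, b] mD (fun n t => (F n t)%:E)
  (fun=> 0%E) (fun=> M%:E) _ _ _ ig _.
case.
- by move=> n; exact: measurable_int (cont_itv_integrable (cF n)).
- exact: measurable_cst.
- apply: ae_mono F0 => t tF; rewrite /= in_itv /= => /tF tF0.
  by apply: cvg_EFin => //; near=> n.
- apply: (ae_mono _ F0) => t _ n; rewrite /= in_itv /= => tab.
  by rewrite lee_fin FM.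
- move=> _ _; rewrite integral0 => /fine_cvg; exact.
Unshelve. all: by end_near. Qed.

(** The Cauchy formula on circles of radius tending to [1] bounds [|w z|] by the
    mean of [|w|] over those circles, which tends to [0] by dominated
    convergence. *)
Lemma radial_zero (w : R[i] -> R[i]) M : holo w -> (forall z, cm z < 1 -> cm (w z) <= M) ->
  {ae leb, forall t, 0 <= t < 2 * pi -> rlim w (expi t) 0} ->
  forall z, cm z < 1 -> w z = 0.
Proof.
move=> hw wM w0 z z1.
pose rr n : R := 1 - n.+2%:R^-1.
have n20 n : 0 < n.+2%:R^-1 :> R by rewrite invr_gt0.
have rr1 n : rr n < 1 by rewrite /rr gtrDl oppr_lt0.
have rr0 n : 0 <= rr n by rewrite subr_ge0 invf_le1 ?ler1n.
have rrd d : 0 < d -> \forall n \near \oo, 1 - d < rr n.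
  move=> d0; exists (Num.truncn d^-1) => // n /= nd.
  rewrite ltrD2l ltrN2 invf_plt ?posrE// (lt_le_trans (truncnS_gt _))//.
  by rewrite ler_nat ltnW// ltnS.
pose F n t := cm (w ((rr n)%:C * expi t)).
have cF n : cont_itv 0 (2 * pi) (F n).
  by apply/con_cm/circle_fcon => //; exact: holo_holo_on.
have FM n t : 0 <= t <= 2 * pi -> `|F n t| <= M.
  by move=> _; rewrite ger0_norm ?cm_ge0// wM// cm_pol.
have F0 : {ae leb, forall t, 0 <= t <= 2 * pi -> F n t @[n --> \oo] --> (0 : R)}.
  apply: ae_mono (ae_and w0 (ae_notin [:: 2 * pi])) => t [wt].
  rewrite inE => t2 /andP[t0 t2']; apply/cvgrPdist_lt => e e0.
  have e20 : 0 < e / 2 by rewrite divr_gt0.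
  have tt : 0 <= t < 2 * pi by rewrite t0 lt_neqAle t2.
  have [d d0 dH] := wt tt _ e20.
  have := rrd d d0; apply: filterS => n nd.
  rewrite sub0r normrN ger0_norm ?cm_ge0//.
  have := dH _ nd (rr1 n); rewrite subr0 => /le_lt_trans; apply.
  by rewrite ltr_pdivrMr// ltr_pMr// ltr1n.
have C0 := rI_bounded_cvg0 cF FM F0.
apply/eqP; rewrite -cm_eq0; apply/eqP; apply: contraPP C0 => /eqP wz0 C0.
have wz : 0 < cm (w z) by rewrite lt_neqAle eq_sym wz0 cm_ge0.
pose k := (1 - cm z) / 2.
have k0 : 0 < k by rewrite divr_gt0// subr_gt0.
pose e := cm (w z) * (2 * pi) / 2 * k.
have e0 : 0 < e by apply: mulr_gt0 k0; rewrite divr_gt0// mulr_gt0// pi2_gt0.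
have [n []] : exists n, 1 - k < rr n /\ `|0 - rI 0 (2 * pi) (F n)| < e.
  have : \forall n \near \oo, 1 - k < rr n /\ `|0 - rI 0 (2 * pi) (F n)| < e.
    by apply: filterI; [exact: rrd|move/cvgrPdist_lt: C0; apply].
  by move=> /filter_ex.
move=> nk; apply/negP; rewrite -leNgt sub0r normrN.
apply: le_trans (ler_norm _).
have zr : cm z + k < rr n.
  by apply: le_lt_trans nk; rewrite /k; lra.
have zr' : cm z < rr n by rewrite (lt_trans _ zr)// ltrDl.
have hn := holo_holo_on (rr1 n) hw.
have cK : ccont_itv 0 (2 * pi)
    (fun t => (rr n)%:C * expi t / ((rr n)%:C * expi t - z)).
  by apply: cconM => [t _|]; [exact: polt_cont|exact: circle_con].
have cH := cconM (circle_fcon (rr0 n) hn) cK.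
have := cauchy_formula zr' hn; move/(congr1 (@cm R)).
rewrite cmM cmR (ger0_norm (pi2_ge0 R)) => E.
have := cI_bound2 cH; rewrite E => B.
have kF : cont_itv 0 (2 * pi) (fun t => k^-1 * F n t).
  by move=> t /(cF n); exact: cvgMr.
have LE : rI 0 (2 * pi) (fun t => cm (w ((rr n)%:C * expi t) *
    ((rr n)%:C * expi t / ((rr n)%:C * expi t - z)))) <= k^-1 * rI 0 (2 * pi) (F n).
  rewrite -rIZ//; apply: le_rI (con_cm cH) kF _ => t _.
  rewrite cmM [leLHS]mulrC ler_wpM2r ?cm_ge0// cm_div cm_pol//.
  rewrite -[leRHS]mul1r ler_pM ?invr_ge0 ?cm_ge0//; first exact: ltW (rr1 n).
  rewrite lef_pV2 ?posrE// ?cm_gt0 ?circle_sub_neq0//.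
  by apply: le_trans (circle_sub t zr'); rewrite lerBrDl ltW.
have := le_trans B (ler_wpM2l (ler0n R 2) LE).
move=> H; rewrite /e -ler_pdivlMr// ler_pdivrMr// [leRHS]mulrC [_ / k]mulrC.
exact: H.
Qed.

Lemma rlimP f z (l : R[i]) : rlim f z l <->
  ((f (r%:C * z) : R[i]^o) @[r --> (1 : R)^'-] --> (l : R[i]^o)).
Proof.
split=> [H|/ccvgP H].
  apply/ccvgP => e e0; have e20 : 0 < e / 2 by rewrite divr_gt0.
  have [d d0 dH] := H _ e20; near=> r.
  have r1 : r < 1 by near: r; exact: nbhs_left_lt.
  have rd : 1 - d < r by near: r; apply: nbhs_left_gt; rewrite gtrDl oppr_lt0.
  rewrite (le_lt_trans (dH r rd r1))//.
  by rewrite ltr_pdivrMr// ltr_pMr// ltr1n.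
move=> e e0; have [d /= d0 dH] := (nbhs_ballP _ _).1 (H e e0).
exists d => // r rd r1; apply/ltW/dH => //.
by rewrite /ball /= ger0_norm ?subr_ge0 ?ltW// ltrBlDr -ltrBlDl.
Unshelve. all: by end_near. Qed.

Lemma rlimM f g z (k l : R[i]) : rlim f z k -> rlim g z l ->
  rlim (fun z => f z * g z) z (k * l).
Proof. by move=> /rlimP fk /rlimP gl; apply/rlimP; exact: cvgM fk gl. Qed.

Lemma rlim_cont f z : cm z = 1 -> {for z, continuous (f : R[i]^o -> R[i]^o)} ->
  rlim f z (f z).
Proof.
move=> z1 /ccontP fz e /fz[d d0 dH]; exists d => // r rd r1; apply/ltW/dH.
rewrite -{2}[z]mul1r -mulrBl cmM z1 mulr1 -RCB cmR distrC ger0_norm ?subr_ge0 ?ltW//.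
by rewrite ltrBlDr -ltrBlDl.
Qed.

Lemma radial_value_quotient f u v z (k l : R[i]) : cm z = 1 ->
  rlim u z k -> rlim v z l -> l != 0 ->
  (forall w, cm w < 1 -> f w * v w = u w) -> radial_value f z = k / l.
Proof.
move=> z1 uk vl l0 fvu; have /rlimP vl' := vl; have /rlimP uk' := uk.
have H : hausdorff_space R[i]^o by exact: norm_hausdorff.
have C : ((u (r%:C * z) / v (r%:C * z) : R[i]^o) @[r --> (1 : R)^'-] -->
    (k / l : R[i]^o)).
  by apply: cvgM uk' _; apply: cvgV.
suff E : {near (1 : R)^'-,
    (fun r : R => u (r%:C * z) / v (r%:C * z)) =1 (fun r => f (r%:C * z))}.
  exact: (cvg_lim H (cvg_trans (near_eq_cvg E) C)).
have l1 : 0 < cm l by rewrite cm_gt0.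
have [d d0 dH] := vl _ (divr_gt0 l1 (ltr0n R 2)).
near=> r.
have r1 : r < 1 by near: r; exact: nbhs_left_lt.
have r0 : 0 < r by near: r; apply: nbhs_left_gt.
have rd : 1 - d < r by near: r; apply: nbhs_left_gt; rewrite gtrDl oppr_lt0.
have vr0 : v (r%:C * z) != 0.
  apply/eqP => vr; have := dH r rd r1; rewrite vr sub0r cmN; apply/negP.
  by rewrite -ltNge ltr_pdivrMr// ltr_pMr// ltr1n.
have rz : cm (r%:C * z) < 1 by rewrite cmM z1 mulr1 cmR gtr0_norm.
by rewrite -(fvu _ rz) mulfK.
Unshelve. all: by end_near. Qed.

Lemma expi_inj t t' : 0 <= t < 2 * pi -> 0 <= t' < 2 * pi -> expi t = expi t' -> t = t'.
Proof.
wlog tt : t t' / t < t'.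
  move=> H h h' E; case: (ltgtP t t') => // [tt|tt]; first exact: H.
  by apply/esym; exact: H.
move=> /andP[t0 _] /andP[_ t2] E.
have : expi (t' - t) = 1 by rewrite expiD -E -expiD subrr expi0.
move=> /(congr1 (fun z => Re z)) /=.
have p0 : 0 < (t' - t) / 2 < pi by apply/andP; split; lra.
rewrite -[X in cos X](@divfK _ 2)// mulr_natr cos_mulr2n cos2sin2 => C.
have /(_ _ p0) sp := @sin_gt0_pi R; exfalso.
have : 0 < sin ((t' - t) / 2) ^+ 2 by rewrite exprn_gt0.
lra.
Qed.

Lemma ae_expi_notin (s : seq R[i]) :
  {ae leb, forall t, 0 <= t < 2 * pi -> expi t \notin s}.
Proof.
pose p z : R := xget 0 [set t | 0 <= t < 2 * pi /\ expi t = z].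
apply: ae_mono (ae_notin (map p s)) => t tp th; apply: contra tp => ts.
have /= [h E] := @xgetI R 0 [set t' | 0 <= t' < 2 * pi /\ expi t' = expi t] t
  (conj th erefl).
by rewrite (expi_inj th h (esym E)); apply/mapP; exists (expi t).
Qed.

Lemma holo_eq0_circle f rho : 0 < rho -> rho < 1 -> holo f ->
  (forall z, cm z = rho -> f z = 0) -> forall z, cm z < 1 -> f z = 0.
Proof.
move=> r0 r1 hf f0; apply: (identity_holo hf r0) => z zr.
apply/eqP; rewrite -cm_eq0 eq_le cm_ge0 andbT.
apply: (max_principle (holo_holo_on r1 hf)) zr => w wr.
by rewrite f0// cm0.
Qed.

(** Where [u] and [v] have nonzero radial limits, [f] and [g] have radial values
    in the ratio [B] to [A], so [|A| = |B|] there. If this held at finitely many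
    points of the unit circle only, [u * v] would have zero radial limits almost
    everywhere, and [f] would vanish. *)
Lemma proportional_of_radial f g u v M rho z0 : 0 < rho -> rho < 1 ->
  holo f -> holo g -> holo u -> holo v ->
  (forall z, cm z < 1 -> cm (u z) <= M) -> (forall z, cm z < 1 -> cm (v z) <= M) ->
  cm z0 < 1 -> v z0 != 0 -> (forall z, cm z < 1 -> f z * v z = u z) ->
  (forall z, cm z = rho -> cm (f z) = cm (g z)) ->
  {ae leb, forall t, 0 <= t < 2 * pi ->
    cm (radial_value f (expi t)) = cm (radial_value g (expi t))} ->
  exists2 k, cm k = 1 & forall z, cm z < 1 -> g z = k * f z.
Proof.
move=> r0 r1 hf hg hu hv uM vM z01 vz0 fvu fg hT.
case: (pselect (exists2 z, cm z < 1 & f z != 0)) => [[zf zf1 fz]|F0]; last first.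
  have {}F0 z : cm z < 1 -> f z = 0.
    by move=> z1; apply/eqP; apply: contra_notT F0 => fz; exists z.
  exists 1; first exact: cm1.
  move=> z z1; rewrite F0// mulr0; apply: (holo_eq0_circle r0 r1 hg) z1 => w wr.
  by apply/eqP; rewrite -cm_eq0 -fg// F0 ?cm0// wr.
case: (pselect (exists2 z, cm z < 1 & g z != 0)) => [[zg zg1 gz]|G0]; last first.
  have {}G0 z : cm z < 1 -> g z = 0.
    by move=> z1; apply/eqP; apply: contra_notT G0 => gz; exists z.
  case/eqP: fz; apply: (holo_eq0_circle r0 r1 hf) zf1 => w wr.
  by apply/eqP; rewrite -cm_eq0 fg// G0 ?cm0// wr.
have [A [B [A0 B0 AB fAB]]] := rational_quotient r0 r1 hf hg zf1 fz zg1 gz fg.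
pose N := maxn (size A) (size B).
have sA : (size A <= N.+1)%N by rewrite leqW// leq_maxl.
have sB : (size B <= N.+1)%N by rewrite leqW// leq_maxr.
(* On the unit circle [D.[z] = z ^+ N * (|A.[z]| ^ 2 - |B.[z]| ^ 2)]. *)
pose D := A * conj_recip N 1 A - B * conj_recip N 1 B.
have D0 : D = 0.
  apply/eqP; apply: contraT => D0.
  have [s sP] := poly_roots_fin (mulf_neq0 D0 B0).
  have uv0 : {ae leb, forall t, 0 <= t < 2 * pi -> rlim (fun z => u z * v z) (expi t) 0}.
    have := ae_and (ae_and (fatou hu uM) (fatou hv vM)) (ae_and hT (ae_expi_notin s)).
    apply: ae_mono => t [[Ru Rv] [RT Rs]] th.
    have [k uk] := Ru th; have [l vl] := Rv th.
    have [kl0|kl0] := eqVneq (k * l) 0; first by rewrite -kl0; exact: rlimM.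
    have := Rs th; set z := expi t in uk vl *; case/negP; apply: sP.
    have z1 : cm z = 1 by exact: cm_expi.
    move: kl0; rewrite mulf_eq0 negb_or => /andP[k0 l0].
    have pc (p : {poly R[i]}) : rlim (horner p) z p.[z].
      by apply: rlim_cont z1 _; apply/cdiff_cont/cdiff_horner.
    have [Bz|Bz] := eqVneq B.[z] 0; first by rewrite hornerM Bz mulr0.
    have fE := radial_value_quotient z1 uk vl l0 fvu.
    have gE := radial_value_quotient z1 (rlimM uk (pc A)) (rlimM vl (pc B))
      (mulf_neq0 l0 Bz) _.
    have {}gE : radial_value g z = k * A.[z] / (l * B.[z]).
      apply: gE => w w1; rewrite mulrCA -fAB// mulrA.
      by rewrite [_ * f w]mulrC fvu.
    have := RT th; rewrite -/z fE gE => E.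
    have {}E : cm A.[z] = cm B.[z].
      have kn0 : cm k != 0 by rewrite cm_eq0.
      apply: (mulfI kn0); rewrite -[LHS]cmM -[RHS]cmM.
      rewrite -[k * A.[z]](divfK (mulf_neq0 l0 Bz)) [LHS]cmM -E -[LHS]cmM.
      by congr cm; rewrite mulrA divfK.
    rewrite hornerM /D hornerD hornerN (mul_conj_recip_circle sA z1) (mul_conj_recip_circle sB z1) E.
    by rewrite subrr mul0r.
  have uvM z : cm z < 1 -> cm (u z * v z) <= M * M.
    by move=> z1; rewrite cmM ler_pM ?cm_ge0 ?uM ?vM.
  have huv : holo (fun z => u z * v z).
    by move=> z z1; apply: cdiffM; [exact: hu|exact: hv].
  have u0 := mul_eq0_holo hu hv z01 vz0 (radial_zero huv uvM uv0).
  case/eqP: fz; apply: (mul_eq0_holo hf hv z01 vz0) zf1 => z z1.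
  by rewrite fvu// u0.
have [k k1 kE] := two_circles A0 B0 sA sB r0 r1 AB (subr0_eq D0).
exists k => //.
have [zB zBr Bz] := poly_neq0_circle r0 B0.
have zB1 : cm zB < 1 by rewrite zBr.
have hd : holo (fun z => k * f z - g z).
  move=> z z1; apply: cdiffB; last exact: hg.
  by apply: cdiffM; [exact: cdiff_cst|exact: hf].
have hB : holo (horner B) by move=> z _; exact: cdiff_horner.
move=> z z1; apply/esym/eqP; rewrite -subr_eq0; apply/eqP; move: z z1.
apply: (mul_eq0_holo hd hB zB1 Bz) => z z1.
by rewrite mulrBl -fAB// kE; ring.
Qed.

End RadialLimits.

(** * The theorem *)

Section Bridge.
Variable R : realType.
Implicit Types (f u : R[i] -> R[i]).

Lemma unit_discE (z : R[i]) : unit_disc z = (cm z < 1) :> Prop.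
Proof. by rewrite /unit_disc /= normE ltcR. Qed.

Lemma holomorphic_discW f : holomorphic_disc f -> holo f.
Proof.
by move=> hf z z1; apply/cdiffP; apply: hf; rewrite unit_discE.
Qed.

Lemma Hinfty_bound u : Hinfty u ->
  exists M, forall z, cm z < 1 -> cm (u z) <= M.
Proof.
move=> [_ [M [Mr MH]]].
(* The bound [M] lies in [R[i]], and every [x] with [M < x] bounds [|u z|]. *)
exists (Re M + 1) => z z1.
have uz : `|u z| <= M + 1.
  by apply: (MH (M + 1) _ z); rewrite ?ltrDl ?ltr01// unit_discE.
by move: uz; rewrite normE lecE /= => /andP[_]; rewrite raddfD.
Qed.

End Bridge.

Theorem theorem2p2 (R : realType) (f g : R[i] -> R[i]) (rho : R)
  (hf : nevanlinna f) (hg : nevanlinna g) (hrho : 0 < rho < 1)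
  (hT : ae_circle (fun zeta : R[i] => `|radial_value f zeta| = `|radial_value g zeta|))
  (hrhoT : forall z : R[i], `|z| = rho%:C -> `|f z| = `|g z|) :
  exists2 c : R[i], `|c| = 1 & forall z : R[i], unit_disc z -> g z = c * f z.
Proof.
have [hf1 [u [v [hu hv [z0 z01 vz0] fuv]]]] := hf; have [hg1 _] := hg.
move: hrho => /andP[r0 r1].
have [M1 uM] := Hinfty_bound hu; have [M2 vM] := Hinfty_bound hv.
have Hf := holomorphic_discW hf1; have Hg := holomorphic_discW hg1.
have Hu := holomorphic_discW hu.1; have Hv := holomorphic_discW hv.1.
rewrite unit_discE in z01.
have fvu z : cm z < 1 -> f z * v z = u z.
  move=> z1; apply/eqP; rewrite -subr_eq0; apply/eqP; move: z z1.
  have hd : holo (fun z => f z * v z - u z).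
    move=> z z1; apply: cdiffB; last exact: Hu.
    by apply: cdiffM; [exact: Hf|exact: Hv].
  apply: (mul_eq0_holo hd Hv z01 vz0) => z z1.
  have [->|vz] := eqVneq (v z) 0; first by rewrite mulr0.
  by rewrite fuv ?unit_discE// divfK// subrr mul0r.
have fg z : cm z = rho -> cm (f z) = cm (g z).
  by move=> zr; apply: complexI; rewrite -!normE hrhoT// normE zr.
have hT' : {ae @lebesgue_measure R, forall t, 0 <= t < 2 * pi ->
    cm (radial_value f (expi t)) = cm (radial_value g (expi t))}.
  apply: ae_mono hT => t tH /tH; rewrite !normE; exact: complexI.
have uM' z : cm z < 1 -> cm (u z) <= Num.max M1 M2.
  by move=> /uM h; rewrite le_max h.
have vM' z : cm z < 1 -> cm (v z) <= Num.max M1 M2.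
  by move=> /vM h; rewrite le_max h orbT.
have [k k1 kE] := proportional_of_radial r0 r1 Hf Hg Hu Hv uM' vM' z01 vz0 fvu fg hT'.
by exists k => [|z]; rewrite ?normE ?k1// unit_discE; exact: kE.
Qed.
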